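(* Let $(X_p,T_p,\mu_q)$, $q\in(0,1/a_0)$, be a polynomial adic system and let $g$ be a cylindric function of rank $N$ which is not cohomologous to a constant in $L^\infty(X_p,\mu_q)$. Then for $\mu_q$-a.e. $x\in X_p$ there is a sequence $n_j\to\infty$ such that $R^g_{n_j,k_{n_j}(x)}>0$ for all $j$ and the functions $\varphi^g_{n_j,k_{n_j}(x)}$ converge uniformly on $[0,1]$ to a continuous function.
   Context: Let $p(x)=a_0+a_1x+\dots+a_dx^d$, $d\ge1$, all $a_i$ positive integers, $r=p(1)$. The diagram $B_p$ has vertices $(n,k)$, $n\ge0$, $0\le k\le nd$; for every $n,k$ and $0\le j\le d$, $(n,k)$ and $(n+1,k+j)$ are joined by $a_j$ edges (edges of type $j$). Edges entering a vertex are linearly ordered canonically: first the $a_d$ edges of type $d$, then those of type $d-1$, ..., last the $a_0$ edges of type $0$ (parallel edges in a fixed order). $X_p$ is the set of infinite paths $x=(x_1,x_2,\dots)$ from $(0,0)$; $(n,k_n(x))$ is the vertex of $x$ at level $n$. Paths agreeing from some index on are compared by: $x\prec y$ iff at the largest index $i$ with $x_i\ne y_i$, $x_i$ precedes $y_i$; the same rule orders finite paths to a common vertex. $T_p x$ is the successor of $x$, defined off the maximal and minimal paths. $H_{n,k}=C_p(n,k)$, the coefficient of $x^k$ in $p(x)^n$, is the number of paths from $(0,0)$ to $(n,k)$; the tower $\tau_{n,k}$ consists of the cylinders $\tau_{n,k}(j)=[c_1\dots c_n]$, where $c$ is the $j$-th finite path to $(n,k)$. For $q\in(0,1/a_0)$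 let $t_q\in(0,1)$ be the unique solution of $a_0q^d+a_1q^{d-1}t+\dots+a_dt^d=q^{d-1}$; $\mu_q$ is the product measure on $X_p$ under which the $x_n$ are independent and every edge of type $j$ has probability $t_q^j/q^{j-1}$; it is $T_p$-invariant and ergodic; $(X_p,T_p,\mu_q)$ is the polynomial adic system. A cylindric function of rank $N$ is constant on every cylinder $[c_1\dots c_N]$; for $n\ge N$ write $g(\tau_{n,k}(i))$ for its value on $\tau_{n,k}(i)$. $F^g_{n,k}(j)=\sum_{i=1}^jg(\tau_{n,k}(i))$, $0\le j\le H_{n,k}$, linearly interpolated on $[0,H_{n,k}]$; $R^g_{n,k}=\max_{t\in[0,1]}|F^g_{n,k}(tH_{n,k})-tF^g_{n,k}(H_{n,k})|$; if $R^g_{n,k}>0$, $\varphi^g_{n,k}(t)=(F^g_{n,k}(tH_{n,k})-tF^g_{n,k}(H_{n,k}))/R^g_{n,k}$. $g$ is cohomologous to a constant in $L^\infty$ if $g=c+h\circ T_p-h$ a.e. for some $c\in\mathbb R$, $h\in L^\infty$. *)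

(* Defs.v *)
From Stdlib Require Import Reals Lra Lia Arith List Bool.
Import ListNotations.
Open Scope R_scope.

(* The polynomial p is given by its degree d and coefficients a : nat -> nat
   (only a 0 .. a d are relevant).  An edge between (n,k) and (n+1,k+j) is
   encoded by its label (j,m): type j, m-th of the a_j parallel edges.
   Since a path starts at (0,0), a path is determined by its labels. *)
Definition label := (nat * nat)%type.
Definition path := nat -> label.   (* x i = x_{i+1} *)

Definition valid_label (d : nat) (a : nat -> nat) (e : label) : Prop :=
  (fst e <= d)%nat /\ (snd e < a (fst e))%nat.

Definition in_X (d : nat) (a : nat -> nat) (x : path) : Prop :=
  forall i, valid_label d a (x i).

(* k_n(x): second coordinate of the vertex of x at level n *)
Definition kn (x : path) (n : nat) : nat :=
  fold_right plus 0%nat (map (fun i => fst (x i)) (seq 0 n)).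

Definition edge_prec (e e' : label) : Prop :=
  (fst e' < fst e)%nat \/ (fst e = fst e' /\ (snd e < snd e')%nat).

Definition edge_precb (e e' : label) : bool :=
  Nat.ltb (fst e') (fst e) || (Nat.eqb (fst e) (fst e') && Nat.ltb (snd e) (snd e')).

(* x precedes y: they agree (as edges, i.e. same labels and same vertices)
   after index i, and at index i the edge of x precedes that of y *)
Definition path_prec (x y : path) : Prop :=
  exists i, x i <> y i /\ edge_prec (x i) (y i) /\ kn x (S i) = kn y (S i) /\
    forall i', (i < i')%nat -> x i' = y i'.

Definition succ (d : nat) (a : nat -> nat) (x y : path) : Prop :=
  in_X d a x /\ in_X d a y /\ path_prec x y /\
  ~ (exists z, in_X d a z /\ path_prec x z /\ path_prec z y).

Definition t_eq (d : nat) (a : nat -> nat) (q t : R) : Prop :=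
  fold_right Rplus 0 (map (fun j => INR (a j) * q ^ (d - j) * t ^ j) (seq 0 (S d)))
  = q ^ (d - 1).

(* mu_q: each edge of type j has probability t^j / q^(j-1) = q (t/q)^j *)
Definition edge_weight (q t : R) (e : label) : R := q * (t / q) ^ (fst e).

Definition cyl_weight (q t : R) (c : list label) : R :=
  fold_right Rmult 1 (map (edge_weight q t) c).

Definition in_cyl (c : list label) (x : path) : Prop :=
  forall i, (i < length c)%nat -> x i = nth i c (0%nat, 0%nat).

Definition mu_null (d : nat) (a : nat -> nat) (q t : R) (A : path -> Prop) : Prop :=
  forall eps, 0 < eps ->
    exists cs : nat -> list label,
      (forall x, in_X d a x -> A x -> exists i, in_cyl (cs i) x) /\
      (forall n, fold_right Rplus 0 (map (fun i => cyl_weight q t (cs i)) (seq 0 n)) <= eps).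

Definition mu_ae (d : nat) (a : nat -> nat) (q t : R) (P : path -> Prop) : Prop :=
  mu_null d a q t (fun x => ~ P x).

Inductive cyl_meas : (path -> Prop) -> Prop :=
| cm_cyl (c : list label) : cyl_meas (in_cyl c)
| cm_compl (A : path -> Prop) : cyl_meas A -> cyl_meas (fun x => ~ A x)
| cm_union (A : nat -> path -> Prop) :
    (forall n, cyl_meas (A n)) -> cyl_meas (fun x => exists n, A n x)
| cm_ext (A B : path -> Prop) : cyl_meas A -> (forall x, A x <-> B x) -> cyl_meas B.

Definition meas_fun (h : path -> R) : Prop :=
  forall r, cyl_meas (fun x => h x <= r).

Definition in_Linf (d : nat) (a : nat -> nat) (q t : R) (h : path -> R) : Prop :=
  exists (h0 : path -> R) (M : R), meas_fun h0 /\ (forall x, Rabs (h0 x) <= M) /\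
    mu_ae d a q t (fun x => h x = h0 x).

Definition cohom_const (d : nat) (a : nat -> nat) (q t : R) (g : path -> R) : Prop :=
  exists (c : R) (h : path -> R), in_Linf d a q t h /\
    mu_ae d a q t (fun x => exists y, succ d a x y /\ g x = c + h y - h x).

Definition cylindric (d : nat) (a : nat -> nat) (N : nat) (g : path -> R) : Prop :=
  forall x y, in_X d a x -> in_X d a y ->
    (forall i, (i < N)%nat -> x i = y i) -> g x = g y.

Definition labels (d : nat) (a : nat -> nat) : list label :=
  flat_map (fun j => map (fun m => (j, m)) (seq 0 (a j))) (seq 0 (S d)).

Fixpoint all_paths (d : nat) (a : nat -> nat) (n : nat) : list (list label) :=
  match n with
  | O => [[]]
  | S n' => flat_map (fun c => map (fun e => c ++ [e]) (labels d a)) (all_paths d a n')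
  end.

Definition endk (c : list label) : nat := fold_right plus 0%nat (map fst c).

Definition paths_to (d : nat) (a : nat -> nat) (n k : nat) : list (list label) :=
  filter (fun c => Nat.eqb (endk c) k) (all_paths d a n).

Fixpoint lt_rev (r r' : list label) : bool :=
  match r, r' with
  | e :: r0, e' :: r0' =>
      if Nat.eqb (fst e) (fst e') && Nat.eqb (snd e) (snd e') then lt_rev r0 r0'
      else edge_precb e e'
  | _, _ => false
  end.

(* order on finite paths to a common vertex (largest differing index decides) *)
Definition fpath_lt (c c' : list label) : bool := lt_rev (rev c) (rev c').

(* rank of c among the paths to its endpoint: c is the (frank c + 1)-th path *)
Definition frank (d : nat) (a : nat -> nat) (c : list label) : nat :=
  length (filter (fun c' => fpath_lt c' c) (paths_to d a (length c) (endk c))).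

Definition ext (c : list label) : path := fun i => nth i c (0%nat, 0%nat).

Definition clamp01 (u : R) : R := Rmin 1 (Rmax 0 u).

Definition Hnk (d : nat) (a : nat -> nat) (n k : nat) : R :=
  INR (length (paths_to d a n k)).

(* F^g_{n,k}, linearly interpolated on [0,H_{n,k}]:
   F(s) = sum_i g(tau_{n,k}(i)) * clamp01(s - (i-1)) *)
Definition Fg (d : nat) (a : nat -> nat) (g : path -> R) (n k : nat) (s : R) : R :=
  fold_right Rplus 0
    (map (fun c => g (ext c) * clamp01 (s - INR (frank d a c))) (paths_to d a n k)).

Definition Dg (d : nat) (a : nat -> nat) (g : path -> R) (n k : nat) (tt : R) : R :=
  Fg d a g n k (tt * Hnk d a n k) - tt * Fg d a g n k (Hnk d a n k).

Definition is_Rg (d : nat) (a : nat -> nat) (g : path -> R) (n k : nat) (r : R) : Prop :=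
  (forall tt, 0 <= tt <= 1 -> Rabs (Dg d a g n k tt) <= r) /\
  (exists tt, 0 <= tt <= 1 /\ Rabs (Dg d a g n k tt) = r).

(* Main.v *)
Require Import Defs.
From Stdlib Require Import Reals Lra Lia Arith List Bool Permutation Sorted Cantor.
From Stdlib Require Import ClassicalEpsilon FunctionalExtensionality.
From mathcomp Require all_boot all_order all_algebra boolp reals sequences exp Rstruct.
From mathcomp Require ring lra zify.
Import ListNotations.
Open Scope R_scope.

(** Put u = t/q. The numbers q^n u^k H_{n,k} are the coefficients of w^n, where w
    is the generating function of the step law a_j q u^j, and once the mean of g
    is subtracted, the weighted tower sums of g are the coefficients of
    w^(n-N) Gamma with Gamma(1) = 0. If Gamma = 0, the partial sums of g along
    the towers of level N form a bounded transfer function; so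
    Gamma = (1-X)^m G with m > 0 and G(1) <> 0.

    An energy argument of Nash type bounds the coefficients of (1-X)^i w^n by
    C n^(-(i+1)/2), and reading X (w^n)' = n X w' w^(n-1) coefficientwise yields
    a Hermite recurrence with lower-order error, hence matching lower bounds for
    k - n mu in [Z sqrt n, (Z+1) sqrt n], Z large (mu is the mean step).
    Below such a vertex the tower means of g vary by at most C n^(-(m+1)/2) per
    level, whereas R_{n,k} >= c H_{n,k} n^(-(m+1)/2). Since heights decay
    geometrically with the depth, cutting the tower into blocks of depth l shows
    that the normalized curve is C l-Lipschitz up to an error C rho^l + o(1), so
    that Arzela-Ascoli applies. Finally the window is hit with conditional
    probability bounded below after every prefix, hence infinitely often almost
    surely. *)

(** In the variable (k - n mu)/sqrt n, a tower mean is up to a constant multiple of n^(-m/2) the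
    Hermite polynomial of degree m, and passing one level down along an edge of type j changes it by
    (mu - j)/sqrt n times its derivative, which is m times the Hermite polynomial of degree m - 1.
    To the right of all zeros this change has exactly the order of the upper bound valid in the
    whole cone, so division by R loses only a constant; at a vertex near a zero the bound from below
    could fail. The limit law behind this picture is never established: orders of magnitude suffice
    for compactness, and the energy argument with the recurrence delivers them. Depths up to sqrt n
    are admissible because k - n mu then moves by O(sqrt n). At depth sqrt n the trivial bound on
    block errors is geometrically small in sqrt n, hence negligible against n^(-(m+1)/2). The
    Lipschitz constant grows with l while the error falls with l, so l is fixed first and n is taken
    large afterwards. *)

(** Convolution with the step law, hence multiplication of generating functions. The test removes
    the terms in which [k - j] would be truncated to 0. *)
Definition walk_step (d : nat) (w g : nat -> R) (k : nat) : R :=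
  sum_f_R0 (fun j => if (j <=? k)%nat then w j * g (k - j)%nat else 0) d.

(** [b] is the law of a random walk with steps [w]; [f] is a nonzero signed measure of total mass
    zero at time [N], transported by the same walk. Towers enter the local analysis only through
    these data. *)
Record walk_data (d N : nat) (w : nat -> R) (b f : nat -> nat -> R) : Prop := {
  wd_d : (1 <= d)%nat;
  wd_pos : forall j, (j <= d)%nat -> 0 < w j;
  wd_sum : sum_f_R0 w d = 1;
  wd_b0 : forall k, b 0%nat k = if (k =? 0)%nat then 1 else 0;
  wd_bS : forall n k, b (S n) k = walk_step d w (b n) k;
  wd_fS : forall n k, (N <= n)%nat -> f (S n) k = walk_step d w (f n) k;
  wd_fN : forall k, (N * d < k)%nat -> f N k = 0;
  wd_fsum : sum_f_R0 (f N) (N * d) = 0;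
  wd_fnz : exists k, f N k <> 0 }.

Definition rt (n : nat) : R := sqrt (INR (S n)).

(** Once the measure of a cylinder cancels, [f / b] is a tower mean minus the mean value of [g]. The
    lower bound is asked for the edge of type [d] because its block comes first in the tower. The
    first clause supplies about sqrt n consecutive good vertices, each of mass at least [c / rt n],
    so that a level is hit with probability bounded below. *)
Definition window_estimates (d N : nat) (b f : nat -> nat -> R) (m : nat)
  (good : nat -> nat -> Prop) (c C : R) (n1 : nat) : Prop :=
  (forall n, (n1 <= n)%nat -> exists k1, forall i, (S i * S i <= n)%nat ->
     good n (k1 + i)%nat) /\
  (forall n k, (n1 <= n)%nat -> good n k ->
    (forall l i, (l * l <= n)%nat -> (i <= d * l)%nat ->
       (i <= k)%nat /\ (N + l < n)%nat /\
       c / rt n <= b (n - l)%nat (k - i)%nat <= C / rt n) /\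
    (forall l i j, (S l * S l <= n)%nat -> (i <= d * l)%nat -> (j <= d)%nat ->
       Rabs (f (n - S l)%nat (k - (i + j))%nat / b (n - S l)%nat (k - (i + j))%nat
             - f (n - l)%nat (k - i)%nat / b (n - l)%nat (k - i)%nat)
       <= C / rt n ^ S m) /\
    c / rt n ^ S m <=
      Rabs (f (n - 1)%nat (k - d)%nat / b (n - 1)%nat (k - d)%nat - f n k / b n k)).

(** * Local limit estimates *)

Module LocalLimit.
Import all_boot all_order all_algebra boolp reals sequences exp Rstruct.
Import mathcomp.algebra_tactics.ring mathcomp.algebra_tactics.lra mathcomp.zify.zify.
Set Implicit Arguments. Unset Strict Implicit. Unset Printing Implicit Defensive.
Import Order.TTheory GRing.Theory Num.Theory.
Local Open Scope ring_scope.

(** * Energy inequalities for coefficient sequences *)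

Section Energy.
Variable R : realFieldType.
Implicit Types p w : {poly R}.

Definition sqnorm p : R := \sum_(k < size p) p`_k ^+ 2.

Lemma sqnormE p K : (size p <= K)%N -> sqnorm p = \sum_(k < K) p`_k ^+ 2.
Proof.
move=> le_pK; rewrite /sqnorm -(subnKC le_pK) big_split_ord /=.
rewrite [X in _ = _ + X]big1 ?addr0 // => i _.
by rewrite nth_default ?expr0n // leq_addr.
Qed.

Lemma sqnorm_ge0 p : 0 <= sqnorm p.
Proof. by apply: sumr_ge0 => i _; apply: sqr_ge0. Qed.

Lemma sqnormXnM p j : sqnorm ('X^j * p) = sqnorm p.
Proof.
rewrite (@sqnormE _ (j + size p)%N); last first.
  by apply: leq_trans (size_polyMleq _ _) _; rewrite size_polyXn.
rewrite big_split_ord /= big1 ?add0r => [|i _]; last first.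
  by rewrite coefXnM /= ltn_ord expr0n.
by apply: eq_bigr => i _; rewrite coefXnM ltnNge leq_addr /= addKn.
Qed.

(** Jensen's inequality with its defect. Two terms of the variance give w_i A^2 + w_j B^2, and (w_i
    + w_j) times this exceeds w_i w_j (A - B)^2 by the square of w_i A + w_j B, where w_i + w_j <=
    1. *)
Lemma variance_ge (I : finType) (w x : I -> R) (i j : I) :
  (forall k, 0 <= w k) -> \sum_k w k = 1 -> i != j ->
  (\sum_k w k * x k) ^+ 2 <=
  \sum_k w k * x k ^+ 2 - w i * w j * (x i - x j) ^+ 2.
Proof.
move=> w0 w1 neij; set m := \sum_k w k * x k.
have E : \sum_k w k * (x k - m) ^+ 2 = \sum_k w k * x k ^+ 2 - m ^+ 2.
  rewrite (eq_bigr (fun k => w k * x k ^+ 2 - (2 * m) * (w k * x k)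
     + m ^+ 2 * w k)); last by move=> k _; ring.
  by rewrite big_split sumrB /= -!mulr_sumr w1 -/m; ring.
have split2 (F : I -> R) : (forall k, 0 <= F k) -> F i + F j <= \sum_k F k.
  move=> F0; rewrite (bigD1 i) //= (bigD1 j) //= 1?eq_sym //.
  by rewrite addrA lerDl sumr_ge0.
have := split2 _ w0; rewrite w1 => wij1.
have := split2 _ (fun k => mulr_ge0 (w0 k) (sqr_ge0 (x k - m))).
rewrite E /=.
have ri := w0 i; have rj := w0 j.
set A := x i - m; set B := x j - m => h.
have -> : x i - x j = A - B by rewrite /A /B; ring.
have h1 : w i * w j * (A - B) ^+ 2 <=
   (w i + w j) * (w i * A ^+ 2 + w j * B ^+ 2).
  by rewrite -subr_ge0 (_ : _ - _ = (w i * A + w j * B) ^+ 2) ?sqr_ge0 //; ring.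
have h2 : 0 <= w i * A ^+ 2 + w j * B ^+ 2.
  by apply: addr_ge0; apply: mulr_ge0 => //; apply: sqr_ge0.
nra.
Qed.

Lemma coef_mul_sum w p K k : (size w <= K)%N ->
  (w * p)`_k = \sum_(j < K) w`_j * ('X^j * p)`_k.
Proof.
move=> hK; rewrite -{1}[w]coefK poly_def.
rewrite mulr_suml coef_sum -(subnKC hK) [RHS]big_split_ord /=.
rewrite [X in _ = _ + X]big1 ?addr0 => [|i _].
  by apply: eq_bigr => i _; rewrite -scalerAl coefZ.
by rewrite nth_default ?mul0r // leq_addr.
Qed.

(** Each coefficient of [w * p] averages those of the shifts ['X^j * p], all of norm [sqnorm p]. The
    defect in Jensen's inequality for the shifts by 0 and 1 sums to the energy of [(1 - 'X) * p]. *)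
Lemma sqnorm_mul_le w p : (forall j, 0 <= w`_j) -> w.[1] = 1 ->
  sqnorm (w * p) <= sqnorm p - w`_0 * w`_1 * sqnorm ((1 - 'X) * p).
Proof.
(* Two extra slots make the indices 0 and 1 available whatever the size of [w]. *)
move=> w0 w1; pose D := (size w).+2; pose K := (D + size p)%N.
have sX j : (j < D)%N -> (size ('X^j * p)%R <= K)%N.
  move=> jD; apply: leq_trans (size_polyMleq _ _) _; rewrite size_polyXn /=.
  by rewrite leq_add2r ltnW.
have sw : (size w <= D)%N by rewrite /D; apply: leq_trans (leqnSn _) _.
have w1' : \sum_(j < D) w`_j = 1.
  rewrite -w1 (horner_coef_wide _ sw).
  by apply: eq_bigr => i _; rewrite expr1n mulr1.
have i0 : (0 < D)%N by []. have i1 : (1 < D)%N by [].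
rewrite (@sqnormE (w * p) K); last first.
  apply: leq_trans (size_polyMleq _ _) _.
  by rewrite (leq_trans (leq_pred _)) // leq_add2r.
rewrite (@sqnormE ((1 - 'X) * p) K); last first.
  rewrite mulrBl mul1r; apply: leq_trans (size_polyD _ _) _.
  by rewrite size_polyN geq_max -{1}[p]mul1r -(expr0 'X) sX // -(expr1 'X) sX.
have -> : sqnorm p = \sum_(k < K) \sum_(j < D) w`_j * ('X^j * p)`_k ^+ 2.
  rewrite exchange_big /= -[sqnorm p]mul1r -w1' mulr_suml.
  apply: eq_bigr => j _; rewrite -mulr_sumr; congr (_ * _).
  by rewrite -(sqnormE (sX j (ltn_ord j))) sqnormXnM.
rewrite mulr_sumr -sumrB; apply: ler_sum => k _.
rewrite (coef_mul_sum _ _ sw).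
pose a := Ordinal i0; pose b := Ordinal i1.
have := @variance_ge _ (fun j : 'I_D => w`_j) (fun j : 'I_D => ('X^j * p)`_k) a b.
by rewrite /= mul1r mulrBl mul1r coefB expr1 => ->.
Qed.

(** One-dimensional Sobolev inequality: the square of a coefficient telescopes into differences of
    squares, and (a - b)(a + b) is split by the arithmetic-geometric mean with free weight [x]. *)
Lemma coef_sqr_le p k (x : R) : 0 < x ->
  p`_k ^+ 2 <= x * sqnorm ((1 - 'X) * p) + x^-1 * sqnorm p.
Proof.
move=> x0; pose q := 'X * p.
have cq j : q`_j = if (j == 0)%N then 0 else p`_j.-1 by rewrite /q coefXM.
have step n : p`_n ^+ 2 = \sum_(j < n.+1) (p`_j ^+ 2 - q`_j ^+ 2).
  elim: n => [|n IHn]; first by rewrite big_ord1 cq /= expr0n subr0.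
  by rewrite big_ord_recr /= -IHn cq /=; ring.
pose K := (maxn k.+1 (size p).+1)%N.
have sp : (size p <= K)%N by rewrite /K leq_max leqnSn orbT.
have sq : (size q <= K)%N.
  apply: leq_trans (size_polyMleq _ _) _; rewrite size_polyX /=.
  by rewrite /K leq_max leqnn orbT.
have sd : (size ((1 - 'X) * p)%R <= K)%N.
  rewrite mulrBl mul1r; apply: leq_trans (size_polyD _ _) _.
  by rewrite size_polyN geq_max sp sq.
have term j : p`_j ^+ 2 - q`_j ^+ 2 <=
    x * ((1 - 'X) * p)`_j ^+ 2 + x^-1 / 2 * (p`_j ^+ 2 + q`_j ^+ 2).
  rewrite mulrBl mul1r coefB -/q; set a := p`_j; set b := q`_j.
  have y0 : 0 < x^-1 by rewrite invr_gt0.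
  have E : x * x^-1 = 1 by rewrite divff ?gt_eqF.
  have H1 : 0 <= x * (a - b - x^-1 / 2 * (a + b)) ^+ 2.
    by rewrite mulr_ge0 ?sqr_ge0 ?ltW.
  have H2 : x * (a - b - x^-1 / 2 * (a + b)) ^+ 2 =
     x * (a - b) ^+ 2 - (x * x^-1) * (a - b) * (a + b)
      + (x * x^-1) * x^-1 / 4 * (a + b) ^+ 2 by field; rewrite gt_eqF.
  rewrite E in H2.
  have H3 : (a + b) ^+ 2 <= 2 * (a ^+ 2 + b ^+ 2).
    by have := sqr_ge0 (a - b); nra.
  nra.
have nn j : 0 <= x * ((1 - 'X) * p)`_j ^+ 2 + x^-1 / 2 * (p`_j ^+ 2 + q`_j ^+ 2).
  have x0' := ltW x0.
by apply: addr_ge0; apply: mulr_ge0; rewrite ?sqr_ge0 // ?addr_ge0 ?divr_ge0 ?invr_ge0 ?sqr_ge0.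
have kK : (k.+1 <= K)%N by rewrite /K leq_max leqnn.
rewrite step; apply: (@le_trans _ _ (\sum_(j < k.+1) (x * ((1 - 'X) * p)`_j ^+ 2 +
   x^-1 / 2 * (p`_j ^+ 2 + q`_j ^+ 2)))).
  by apply: ler_sum => j _; exact: term.
apply: (@le_trans _ _ (\sum_(j < K) (x * ((1 - 'X) * p)`_j ^+ 2 +
   x^-1 / 2 * (p`_j ^+ 2 + q`_j ^+ 2)))).
  rewrite -(subnKC kK) [X in _ <= X]big_split_ord /= lerDl.
  by apply: sumr_ge0 => i _.
rewrite big_split /= -!mulr_sumr big_split /=.
rewrite -(sqnormE sp) -(sqnormE sq) -(sqnormE sd).
rewrite /q -(expr1 'X) sqnormXnM expr1.
set A := sqnorm p; set B := sqnorm _.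
have -> : x^-1 / 2 * (A + A) = x^-1 * A by field; rewrite gt_eqF.
by [].
Qed.
End Energy.

(** * Decay of the differences of the walk *)

Section Decay.
Variable R : realType.

Definition sq1 (n : nat) : R := Num.sqrt n.+1%:R.

Lemma sq1_gt0 n : 0 < sq1 n.
Proof. by rewrite sqrtr_gt0 ltr0Sn. Qed.

Lemma sq1_ge0 n : 0 <= sq1 n.
Proof. exact: sqrtr_ge0. Qed.

Lemma sq1_sqr n : sq1 n ^+ 2 = n.+1%:R.
Proof. by rewrite sqr_sqrtr ?ler0n. Qed.

Lemma sq1_le n m : (n <= m)%N -> sq1 n <= sq1 m.
Proof. by move=> le_nm; rewrite ler_wsqrtr // ler_nat. Qed.

Lemma sq1_sub n r : (r <= n)%N -> sq1 n <= sq1 r * sq1 (n - r).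
Proof.
move=> le_rn; rewrite -sqrtrM ?ler0n // ler_wsqrtr // -natrM ler_nat.
by rewrite -{1}(subnK le_rn); move: (n - r)%N => m; nia.
Qed.

Variable w : {poly R}.
Hypotheses (w_ge0 : forall j, 0 <= w`_j) (w_sum : w.[1] = 1)
  (w0_gt0 : 0 < w`_0) (w1_gt0 : 0 < w`_1).
Notation D := (1 - 'X : {poly R}).
Let beta := w`_0 * w`_1.
Let beta_gt0 : 0 < beta. Proof. exact: mulr_gt0. Qed.

Lemma coef_pow_ge0 n k : 0 <= (w ^+ n)`_k.
Proof.
elim: n k => [|n IHn] k; first by rewrite expr0 coef1 ler0n.
by rewrite exprS coefM; apply: sumr_ge0 => j _; rewrite mulr_ge0.
Qed.

Lemma pow_horner1 n : (w ^+ n).[1] = 1.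
Proof. by rewrite horner_exp w_sum expr1n. Qed.

Lemma beta_le1 : beta <= 1.
Proof.
have H : w`_0 + w`_1 <= 1.
  have sw : (size w <= (size w).+2)%N by apply: leq_trans (leqnSn _) _.
  have := horner_coef_wide 1 sw; rewrite w_sum => ->.
  rewrite 2!big_ord_recl /= expr0 expr1 !mulr1 addrA lerDl.
  by apply: sumr_ge0 => j _; rewrite expr1n mulr1.
have := w0_gt0; have := w1_gt0; move: H.
rewrite /beta; set u := w`_0; set v := w`_1 => *; nra.
Qed.

(** Nash's inequality. The coefficients are nonnegative with sum 1, so [sqnorm] is at most any bound
    on them, and [coef_sqr_le] provides one in terms of the energy. *)
Lemma sqnorm_pow_nash n :
  sqnorm (w ^+ n) ^+ 3 / 4 <= sqnorm ((1 - 'X) * w ^+ n).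
Proof.
set p := w ^+ n; set y := sqnorm (_ * p); set x := sqnorm p.
have x0 : 0 <= x := sqnorm_ge0 _.
have y0 : 0 <= y := sqnorm_ge0 _.
have [->|xn0] := eqVneq x 0; first by rewrite expr0n mul0r.
have xp : 0 < x by rewrite lt_def xn0.
(* With this weight [l^-1 * x] equals [x ^+ 2 / 2] and is absorbed by the left side. *)
pose l := 2 / x.
have l0 : 0 < l by rewrite divr_gt0.
pose S := l * y + l^-1 * x.
have S0 : 0 <= S by rewrite addr_ge0 // mulr_ge0 ?invr_ge0 // ltW.
have pS k : p`_k <= Num.sqrt S.
  by rewrite -[leLHS]ger0_norm ?coef_pow_ge0 // -sqrtr_sqr ler_wsqrtr // coef_sqr_le.
have xS : x <= Num.sqrt S.
  have <- : \sum_(k < size p) p`_k * Num.sqrt S = Num.sqrt S.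
    rewrite -mulr_suml -[RHS]mul1r; congr (_ * _).
    rewrite -(pow_horner1 n) horner_coef.
    by apply: eq_bigr => k _; rewrite expr1n mulr1.
  by apply: ler_sum => k _; rewrite expr2 ler_wpM2l ?coef_pow_ge0.
have xxS : x ^+ 2 <= S by rewrite -(sqr_sqrtr S0) ler_pXn2r ?nnegrE ?sqrtr_ge0.
have E : S = 2 * y / x + x ^+ 2 / 2.
  by rewrite /S /l; field; rewrite gt_eqF // divr_gt0.
rewrite E in xxS.
have H : x * (x ^+ 2 / 2) <= x * (2 * y / x) by rewrite ler_wpM2l //; lra.
have E2 : x * (2 * y / x) = 2 * y by field; rewrite gt_eqF.
rewrite E2 in H.
have -> : x ^+ 3 / 4 = x * (x ^+ 2 / 2) / 2 by field.
lra.
Qed.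

(** Discrete form of x' = -(beta/4) x^3, under which x^(-2) grows with slope beta/2. *)
Lemma sqnorm_pow_decay n :
  sqnorm (w ^+ n) ^+ 2 * (n%:R * (beta / 2) + 1) <= 1.
Proof.
elim: n => [|n IHn].
  by rewrite expr0 /sqnorm size_poly1 big_ord1 coef1 mul0r add0r mulr1 !expr1n.
set x := sqnorm (w ^+ n) in IHn *; set x' := sqnorm _.
have x0 : 0 <= x := sqnorm_ge0 _.
have x'0 : 0 <= x' := sqnorm_ge0 _.
have n0 : 0 <= n%:R :> R by [].
have H1 : x' <= x - beta * (x ^+ 3 / 4).
  rewrite /x' exprS; apply: le_trans (sqnorm_mul_le _ w_ge0 w_sum) _.
  by rewrite lerD2l lerN2 ler_wpM2l ?(ltW beta_gt0) // sqnorm_pow_nash.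
have b0 := beta_gt0; have b1 := beta_le1.
(* The relative loss in one step; the induction closes because (1 - z)^2 (1 + 2z) <= 1. *)
pose z := beta / 4 * x ^+ 2.
have bb : x ^+ 2 <= 1.
  apply: le_trans IHn; rewrite -{1}[x ^+ 2]mulr1 ler_wpM2l ?sqr_ge0 //.
  by rewrite lerDr; rewrite mulr_ge0 // divr_ge0 // ltW.
have z0 : 0 <= z by rewrite /z mulr_ge0 ?sqr_ge0 // divr_ge0 // ltW.
have z1 : z <= 1 / 4 by rewrite /z; nra.
have H2 : x' <= x * (1 - z).
  by apply: le_trans H1 _; rewrite /z le_eqVlt; apply/orP; left; apply/eqP; field.
have H3 : x' ^+ 2 <= (x * (1 - z)) ^+ 2.
  by rewrite ler_pXn2r ?nnegrE //; apply: mulr_ge0 => //; lra.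
rewrite -natr1; set N := n%:R in IHn n0 *.
have P0 : 0 <= (N + 1) * (beta / 2) + 1.
  by rewrite addr_ge0 // mulr_ge0 ?addr_ge0 // divr_ge0 // ltW.
apply: le_trans (ler_wpM2r P0 H3) _.
have -> : (x * (1 - z)) ^+ 2 * ((N + 1) * (beta / 2) + 1) =
   (1 - z) ^+ 2 * (x ^+ 2 * (N * (beta / 2) + 1) + 2 * z) by rewrite /z; field.
have H4 : (1 - z) ^+ 2 * (x ^+ 2 * (N * (beta / 2) + 1) + 2 * z) <=
  (1 - z) ^+ 2 * (1 + 2 * z) by rewrite ler_wpM2l ?sqr_ge0 // lerD2r.
apply: le_trans H4 _.
have : 0 <= z ^+ 2 * (3 - 2 * z) by rewrite mulr_ge0 ?sqr_ge0 //; lra.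
have -> : z ^+ 2 * (3 - 2 * z) = 1 - (1 - z) ^+ 2 * (1 + 2 * z) by ring.
lra.
Qed.

(** The energy of order i + 1 is, up to beta, what the energy of order i loses per step. It is
    nonincreasing in n, so summing the losses over the second half of the steps bounds it by the
    energy of order i at n/2 divided by a multiple of n. *)
Lemma sqnorm_diff_decay i : exists2 K, 0 <= K &
  forall n, sqnorm (D ^+ i * w ^+ n) <= K / sq1 n ^+ (2 * i).+1.
Proof.
have b0 := beta_gt0.
elim: i => [|i [K K0 IH]].
  exists (Num.sqrt (2 / beta)); first exact: sqrtr_ge0.
  move=> n; rewrite expr0 mul1r muln0 expr1.
  have s0 := sq1_gt0 n.
  rewrite ler_pdivlMr // -[leLHS]ger0_norm; last by rewrite mulr_ge0 ?sqnorm_ge0 // ltW.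
  rewrite -sqrtr_sqr ler_wsqrtr // exprMn sq1_sqr.
  rewrite ler_pdivlMr //.
  have := sqnorm_pow_decay n; rewrite -(natr1 n).
  have b1 := beta_le1; move: (sqr_ge0 (sqnorm (w ^+ n))).
  set X := _ ^+ 2 => X0 H; set N := n%:R in H *.
  have H2 : X * beta <= X * 1 by rewrite ler_wpM2l.
  have -> : X * (N + 1) * beta = 2 * (X * (N * (beta / 2) + 1)) + (X * beta - X * 1) - X by field.
  by lra.
exists (2 ^+ (2 * i).+2 * K / beta).
  by apply: divr_ge0; [apply: mulr_ge0; rewrite ?exprn_ge0 | exact: ltW].
move=> n.
pose y j m := sqnorm (D ^+ j * w ^+ m).
have step j m : y j m.+1 <= y j m - beta * y j.+1 m.
  have := sqnorm_mul_le (D ^+ j * w ^+ m) w_ge0 w_sum.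
  by rewrite mulrCA -exprS mulrA -exprS.
have mono j m : y j m.+1 <= y j m.
  apply: le_trans (step j m) _; rewrite gerBl mulr_ge0 ?(ltW b0) //.
  exact: sqnorm_ge0.
have tel m r : beta * r.+1%:R * y i.+1 (m + r)%N <= y i m - y i (m + r).+1.
  elim: r => [|r IHr].
    rewrite addn0 mulr1; have := step i m; lra.
  have h1 := step i (m + r.+1)%N; rewrite !addnS in h1 *.
  have h2 := mono i.+1 (m + r)%N.
  have h3 : beta * r.+1%:R * y i.+1 (m + r).+1 <= beta * r.+1%:R * y i.+1 (m + r)%N.
    by rewrite ler_wpM2l // mulr_ge0 ?(ltW b0).
  rewrite -[r.+2%:R]natr1 mulrDr mulrDl mulr1.
  lra.
have := tel n./2 (n - n./2)%N.
have hn : (n./2 <= n)%N by lia.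
rewrite subnKC // -/(y i.+1 n) => H.
have ym0 : 0 <= y i n.+1 := sqnorm_ge0 _.
have {H}H : beta * (n - n./2).+1%:R * y i.+1 n <= K / sq1 n./2 ^+ (2 * i).+1.
  by apply: le_trans (IH _); rewrite -/(y i _); lra.
have s0 := sq1_gt0 n.
have s2 : sq1 n / 2 <= sq1 n./2.
  have e : Num.sqrt 4 = 2 :> R.
    by rewrite (_ : 4 = 2 ^+ 2) ?sqrtr_sqr ?ger0_norm //; ring.
  rewrite ler_pdivrMr // -e -sqrtrM ?ler0n // ler_wsqrtr // -natrM ler_nat.
  lia.
have H2 : K / sq1 n./2 ^+ (2 * i).+1 <= K / (sq1 n / 2) ^+ (2 * i).+1.
  have q0 : 0 < sq1 n / 2 by rewrite divr_gt0.
  rewrite ler_wpM2l // lef_pV2 ?posrE ?exprn_gt0 ?sq1_gt0 //.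
  by rewrite ler_pXn2r ?nnegrE // ltW // sq1_gt0.
have H3 : sq1 n ^+ 2 / 2 <= (n - n./2).+1%:R.
  rewrite sq1_sqr ler_pdivrMr // -natrM ler_nat.
  lia.
have y0 : 0 <= y i.+1 n := sqnorm_ge0 _.
have H4 : beta * (sq1 n ^+ 2 / 2) * y i.+1 n <= K / (sq1 n / 2) ^+ (2 * i).+1.
  apply: le_trans H2; apply: le_trans H; rewrite ler_wpM2r //.
  by rewrite ler_wpM2l // ltW.
rewrite mulnS add2n.
have E : 2 ^+ (2 * i).+2 * K / beta / sq1 n ^+ (2 * i).+3 =
   (K / (sq1 n / 2) ^+ (2 * i).+1) * (2 / (beta * sq1 n ^+ 2)).
  rewrite expr_div_n -[(2 * i).+3]addn2 exprD [2 ^+ _.+2]exprS.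
  by field; rewrite !gt_eqF ?exprn_gt0.
rewrite E -ler_pdivrMr; last by rewrite divr_gt0 ?mulr_gt0 ?exprn_gt0.
apply: le_trans H4; rewrite le_eqVlt; apply/orP; left; apply/eqP.
by rewrite /y; field; rewrite !gt_eqF.
Qed.

(** The Sobolev inequality with weight [sq1 n], for which the contributions of orders i and i + 1
    have equal size. *)
Lemma coef_diff_decay i : exists2 C, 0 <= C &
  forall n k, `|(D ^+ i * w ^+ n)`_k| <= C / sq1 n ^+ i.+1.
Proof.
have [K K0 HK] := sqnorm_diff_decay i.
have [K' K'0 HK'] := sqnorm_diff_decay i.+1.
exists (Num.sqrt (K + K')); first exact: sqrtr_ge0.
move=> n k; have s0 := sq1_gt0 n.
have -> : Num.sqrt (K + K') / sq1 n ^+ i.+1 =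
   Num.sqrt ((K + K') / (sq1 n ^+ i.+1) ^+ 2).
  rewrite sqrtrM ?addr_ge0 // sqrtrV ?sqr_ge0 // sqrtr_sqr ger0_norm //.
  by rewrite exprn_ge0 // ltW.
rewrite -sqrtr_sqr ler_wsqrtr //.
apply: le_trans (coef_sqr_le _ _ s0) _; rewrite mulrA -exprS.
have h1 := ler_wpM2l (ltW s0) (HK' n).
have sV : 0 <= (sq1 n)^-1 by rewrite invr_ge0 ltW.
have h2 := ler_wpM2l sV (HK n).
apply: le_trans (lerD h1 h2) _.
rewrite le_eqVlt; apply/orP; left; apply/eqP.
rewrite -exprM.
have -> : (i.+1 * 2 = (2 * i).+2)%N by rewrite mulnC mulnS.
have -> : (2 * i.+1 = (2 * i).+2)%N by rewrite mulnS.
rewrite !exprS.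
by field; rewrite !gt_eqF ?exprn_gt0.
Qed.

(** Converts the order of vanishing at 1 into decay: later error terms are factored as
    [c * (D ^+ i * w ^+ (n - r))] with [c] and [r] fixed. *)
Lemma coef_decay (c : {poly R}) i r : exists2 C, 0 <= C &
  forall n k, (r <= n)%N -> `|(c * (D ^+ i * w ^+ (n - r)))`_k| <= C / sq1 n ^+ i.+1.
Proof.
have [C C0 HC] := coef_diff_decay i.
pose A := \sum_(j < size c) `|c`_j|.
have A0 : 0 <= A by apply: sumr_ge0.
have sr := sq1_gt0 r.
exists (A * (C * sq1 r ^+ i.+1)).
  by rewrite mulr_ge0 // mulr_ge0 // exprn_ge0 // ltW.
move=> n k le_rn; set Q := D ^+ i * _; have s0 := sq1_gt0 n.
have bnd k' : `|Q`_k'| <= C * sq1 r ^+ i.+1 / sq1 n ^+ i.+1.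
  apply: le_trans (HC _ _) _; rewrite -mulrA ler_wpM2l //.
  rewrite ler_pdivlMr ?exprn_gt0 // mulrC ler_pdivrMr ?exprn_gt0 ?sq1_gt0 //.
  by rewrite -exprMn ler_pXn2r ?sq1_sub // nnegrE ?mulr_ge0 ?sq1_ge0.
rewrite (coef_mul_sum _ _ (leqnn _)).
apply: le_trans (ler_norm_sum _ _ _) _; rewrite -mulrA mulr_suml.
apply: ler_sum => j _; rewrite normrM ler_wpM2l // coefXnM.
case: ifP => _; last exact: bnd.
by rewrite normr0 divr_ge0 ?mulr_ge0 ?exprn_ge0 // ltW.
Qed.

End Decay.

(** * Moments of the walk and the Hermite recurrence *)

Section Window.
Variable R : realType.

Lemma sq1_ge1 n : 1 <= sq1 R n.
Proof. by rewrite -sqrtr1 ler_wsqrtr // ler1n. Qed.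

Lemma sq1_large (A : R) : exists n1, forall n, (n1 <= n)%N -> A <= sq1 R n.
Proof.
exists (Num.bound (A ^+ 2)) => n hn.
apply: le_trans (ler_norm A) _; rewrite -sqrtr_sqr ler_wsqrtr //.
apply: le_trans (ltW (archi_boundP (sqr_ge0 A))) _.
by rewrite ler_nat (leq_trans hn).
Qed.

Lemma count_interval (x y : R) M : x <= y ->
  \sum_(k < M) (x <= k%:R <= y)%R%:R <= y - x + 1.
Proof.
move=> xy; pose c m : R := \sum_(k < m) (x <= k%:R <= y)%R%:R.
(* Either nothing has been counted yet, or the first counted integer is at least [x]. *)
have H m : c m <= 0 \/ c m <= m%:R - x.
  elim: m => [|m IH]; first by left; rewrite /c big_ord0.
  rewrite /c big_ord_recr /= -/(c m) -natr1.
  case: (boolP (x <= m%:R <= y)) => [/andP[h1 h2]|_] /=; last first.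
    by rewrite addr0; case: IH => h; [left | right]; lra.
  by right; case: IH => h; lra.
rewrite -/(c M); elim: M => [|m IH]; first by rewrite /c big_ord0; lra.
have := H m.+1; rewrite /c big_ord_recr /= -/(c m) -natr1.
case: (boolP (x <= m%:R <= y)) => [/andP[h1 h2]|_] /=; last by rewrite addr0.
by case => h; lra.
Qed.

Notation D := (1 - 'X : {poly R}).

Lemma root1_factor (p : {poly R}) : p.[1] = 0 ->
  exists2 e, p = e * D & e.[1] = - p^`().[1].
Proof.
move=> /eqP /factor_theorem[e ->]; exists (- e).
  by rewrite polyC1; ring.
by rewrite derivM derivXsubC !hornerE /=; ring.
Qed.

Lemma root1_factor2 (p : {poly R}) : p.[1] = 0 -> p^`().[1] = 0 ->
  exists e, p = e * D ^+ 2.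
Proof.
move=> /root1_factor[e -> he] h'; move: he; rewrite h' oppr0.
by move=> /root1_factor[e' -> _]; exists e'; ring.
Qed.

Lemma horner_D1 : D.[1] = 0.
Proof. by rewrite !hornerE subrr. Qed.

(** The operator X d/dX multiplies the coefficient of X^k by k, so its iterates evaluated at 1 are
    moments. *)
Definition euler (p : {poly R}) : {poly R} := locked ('X * p^`()).

Lemma eulerE p : euler p = 'X * p^`().
Proof. by rewrite /euler -lock. Qed.

Lemma coef_euler p k : (euler p)`_k = k%:R * p`_k.
Proof.
by rewrite eulerE coefXM; case: k => [|k] /=; rewrite ?mul0r // coef_deriv mulr_natl.
Qed.

Lemma euler_horner1 p : (euler p).[1] = p^`().[1].
Proof. by rewrite eulerE hornerM hornerX mul1r. Qed.

Lemma eulerM p q : euler (p * q) = euler p * q + p * euler q.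
Proof. by rewrite !eulerE derivM; ring. Qed.

Lemma eulerD p q : euler (p + q) = euler p + euler q.
Proof. by rewrite !eulerE derivD mulrDr. Qed.

Lemma euler1 : euler 1 = 0.
Proof. by rewrite eulerE derivC mulr0. Qed.

Lemma eulerC0 : euler 0 = 0.
Proof. by rewrite eulerE derivC mulr0. Qed.

Variable w : {poly R}.
Hypotheses (w_ge0 : forall j, 0 <= w`_j) (w_sum : w.[1] = 1)
  (w0_gt0 : 0 < w`_0) (w1_gt0 : 0 < w`_1).

Definition mean := (euler w).[1].
Definition vari := (euler (euler w)).[1] - mean ^+ 2.

Lemma sum_sqr_dev (p : {poly R}) c :
  \sum_(k < size p) (k%:R - c) ^+ 2 * p`_k =
  (euler (euler p)).[1] - 2 * c * (euler p).[1] + c ^+ 2 * p.[1].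
Proof.
have E (q : {poly R}) : (forall k, (size p <= k)%N -> q`_k = 0) ->
    q.[1] = \sum_(k < size p) q`_k.
  move=> h; rewrite (@horner_coef_wide _ (size p)).
    by apply: eq_bigr => i _; rewrite expr1n mulr1.
  by apply/leq_sizeP.
rewrite !E => [|k h|k h|k h]; rewrite ?coef_euler ?nth_default ?mulr0 //.
rewrite !mulr_sumr -sumrB -big_split /=; apply: eq_bigr => k _.
by rewrite !coef_euler; ring.
Qed.

(** The term k = 0 of the variance is the squared mean times the positive probability of step 0, and
    the mean is positive because step 1 has positive probability. *)
Lemma vari_gt0 : 0 < vari.
Proof.
have -> : vari = \sum_(k < size w) (k%:R - mean) ^+ 2 * w`_k.
  by rewrite sum_sqr_dev w_sum /vari -/mean; ring.
have sw : (1 < size w)%N.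
  by rewrite ltnNge; apply/negP => h; move: w1_gt0; rewrite nth_default ?ltxx.
have i0 : (0 < size w)%N by apply: leq_trans sw.
have m0 : 0 < mean.
  have -> : mean = \sum_(k < size w) k%:R * w`_k.
    have sE : (size (euler w) <= size w)%N.
      by apply/leq_sizeP => j hj; rewrite coef_euler nth_default ?mulr0.
    rewrite /mean (horner_coef_wide _ sE); apply: eq_bigr => i _.
    by rewrite expr1n mulr1 coef_euler.
  rewrite (bigD1 (Ordinal sw)) //= mul1r ltr_pwDl //.
  by apply: sumr_ge0 => k _; rewrite mulr_ge0.
rewrite (bigD1 (Ordinal i0)) //= sub0r sqrrN ltr_pwDl //.
  by rewrite mulr_gt0 // exprn_gt0.
by apply: sumr_ge0 => k _; rewrite mulr_ge0 ?sqr_ge0.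
Qed.

Lemma pow_moments n :
  (euler (w ^+ n)).[1] = n%:R * mean /\
  (euler (euler (w ^+ n))).[1] = n%:R * vari + (n%:R * mean) ^+ 2.
Proof.
elim: n => [|n [IH1 IH2]].
  by rewrite expr0 euler1 eulerC0 horner0; split; ring.
have E : (euler (w ^+ n.+1)).[1] = n.+1%:R * mean.
  rewrite exprS eulerM hornerD. rewrite !hornerM IH1 w_sum pow_horner1 // -/mean -natr1.
  by ring.
split=> //; rewrite exprS eulerM eulerD !eulerM !hornerD !hornerM IH1 IH2 w_sum pow_horner1 //.
have -> : (euler (euler w)).[1] = vari + mean ^+ 2 by rewrite /vari; ring.
by rewrite -/mean -natr1; ring.
Qed.

Definition diff_coef i n k := (D ^+ i * w ^+ n)`_k.
Definition dev n k : R := k%:R - n%:R * mean.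

(** Replacing [c] by its value at 1 and [n - r] by [n] is harmless to leading order: [c - c.[1]%:P *
    w ^+ r] vanishes at 1 and yields one more factor [D]. *)
Lemma coef_lead (c : {poly R}) i r : exists2 C, 0 <= C &
  forall n k, (r <= n)%N ->
  `|(c * (D ^+ i * w ^+ (n - r)))`_k - c.[1] * diff_coef i n k| <= C / sq1 R n ^+ i.+2.
Proof.
have /root1_factor[e he _] : (c - c.[1]%:P * w ^+ r).[1] = 0.
  by rewrite !hornerE w_sum expr1n mulr1 subrr.
have [C C0 HC] := coef_decay w_ge0 w_sum w0_gt0 w1_gt0 e i.+1 r.
exists C => // n k le_rn; apply: le_trans (HC n k le_rn); rewrite le_eqVlt.
apply/orP; left; apply/eqP; congr (`|_|).
rewrite exprS -mulrA [e * (D * _)]mulrA -he mulrBl coefB; congr (_ - _).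
rewrite /diff_coef -mulrA [w ^+ r * _]mulrC -!mulrA -exprD subnK //.
by rewrite coefCM.
Qed.

(** The ring identity behind the recurrence, in independent letters. The two hypotheses carry the
    factors [j] and [n] so that they hold also for exponent 0, where the predecessor is
    truncated. *)
Lemma stein_algebra (S : comPzRingType) (X z z' A B U W j n m v : S) :
  j * A = (1 - X) * (j * B) -> n * U = n * (z * W) ->
  X * (j * (-1 * B)) * U + A * (X * (n * (z' * W))) - n * m * (A * U)
    + j * (B * U) + (n + 1) * v * ((1 - X) * A * U) =
  j * (A * U) + v * ((1 - X) * A * U)
    + n * ((X * z' - m * z + v * ((1 - X) * z)) * (A * W)).
Proof.
move=> hA hU.
transitivity ((j * A) * U + A * (X * (n * (z' * W))) - m * A * (n * U)
   + (n * U) * v * ((1 - X) * A) + v * ((1 - X) * A * U)); last by rewrite hU; ring.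
by rewrite hA; ring.
Qed.

(* The derivative of X -> (1 - X)^i w^n, read off coefficientwise, is the
   three-term recurrence of Hermite functions up to lower order. *)
Lemma stein i : exists2 C, 0 <= C & forall n k,
  `|dev n k * diff_coef i n k + i%:R * diff_coef i.-1 n k
    + sq1 R n ^+ 2 * vari * diff_coef i.+1 n k| <= C / sq1 R n ^+ i.+1.
Proof.
(* The last summand cancels the derivative [vari] of the others at 1, so [V] has a double zero
   there. The resulting [D ^+ 2] pays for the factor [n] in front. *)
pose V := euler w - mean%:P * w + vari%:P * (D * w).
have V0 : V.[1] = 0.
  rewrite /V hornerD hornerD hornerN !hornerM !hornerC horner_D1 w_sum -/mean; ring.
have V1 : V^`().[1] = 0.
  have -> : V^`() = (euler w)^`() - mean%:P * w^`() + vari%:P * (D * w^`() - w).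
    rewrite /V derivD derivB !derivM derivB derivX !derivC; ring.
  rewrite hornerD hornerD hornerN !hornerM hornerD hornerN hornerM !hornerC.
  rewrite horner_D1 w_sum -!euler_horner1 -/mean.
  have -> : (euler (euler w)).[1] = vari + mean ^+ 2 by rewrite /vari; ring.
  ring.
have [e eE] := root1_factor2 V0 V1.
have [C1 C10 H1] := coef_decay w_ge0 w_sum w0_gt0 w1_gt0 (i%:R)%:P i 0.
have [C2 C20 H2] := coef_decay w_ge0 w_sum w0_gt0 w1_gt0 vari%:P i.+1 0.
have [C3 C30 H3] := coef_decay w_ge0 w_sum w0_gt0 w1_gt0 e i.+2 1.
exists (C1 + C2 + C3); first by rewrite !addr_ge0.
move=> n k; have s0 := sq1_gt0 R n; have s1 := sq1_ge1 n.
have E : dev n k * diff_coef i n k + i%:R * diff_coef i.-1 n k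
    + sq1 R n ^+ 2 * vari * diff_coef i.+1 n k =
  ((i%:R)%:P * (D ^+ i * w ^+ n))`_k + (vari%:P * (D ^+ i.+1 * w ^+ n))`_k
  + n%:R * (e * (D ^+ i.+2 * w ^+ (n - 1)))`_k.
  have -> : dev n k * diff_coef i n k =
     (euler (D ^+ i * w ^+ n) - (n%:R * mean)%:P * (D ^+ i * w ^+ n))`_k.
    by rewrite coefB coef_euler coefCM /dev mulrBl.
  rewrite /diff_coef -!coefCM -!coefD; apply: (congr1 (fun p : {poly R} => p`_k)).
  rewrite eulerM !eulerE !deriv_exp derivB derivX derivC sub0r.
  have -> : (n%:R * mean)%:P = n%:R * mean%:P by rewrite polyCM polyC_natr.
  have -> : (sq1 R n ^+ 2 * vari)%:P = (n%:R + 1) * vari%:P.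
    by rewrite sq1_sqr polyCM polyC_natr natr1.
  have -> : i%:R%:P = i%:R :> {poly R} by rewrite polyC_natr.
  have -> : n%:R%:P = n%:R :> {poly R} by rewrite polyC_natr.
  rewrite -[- 1 * D ^+ i.-1 *+ i]mulr_natl -[w^`() * w ^+ n.-1 *+ n]mulr_natl.
  have -> : e * (D ^+ i.+2 * w ^+ (n - 1)) = V * (D ^+ i * w ^+ (n - 1)).
    by rewrite eE -addn2 exprD; ring.
  rewrite /V eulerE [D ^+ i.+1]exprS.
  have HB : i%:R * D ^+ i = D * (i%:R * D ^+ i.-1).
    by case: (i) => [|j]; rewrite ?mul0r ?mulr0 // exprS /=; ring.
  have HU : n%:R * w ^+ n = n%:R * (w * w ^+ n.-1).
    by case: (n) => [|l]; rewrite ?mul0r // exprS.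
  rewrite subn1.
  exact: (@stein_algebra {poly R} 'X w w^`() (D ^+ i) (D ^+ i.-1) (w ^+ n)
    (w ^+ n.-1) i%:R n%:R mean%:P vari%:P HB HU).
rewrite E; apply: le_trans (ler_normD _ _) _.
apply: le_trans (lerD (ler_normD _ _) (lexx _)) _.
rewrite normrM ger0_norm // !mulrDl.
apply: lerD; first apply: lerD.
- by have := H1 n k; rewrite subn0; apply.
- have := H2 n k; rewrite subn0 => /(_ isT) h; apply: le_trans h _.
  rewrite ler_wpM2l // lef_pV2 ?posrE ?exprn_gt0 //.
  by rewrite [leRHS]exprS ler_peMl // exprn_ge0 // ltW.
- case: n s0 s1 {E} => [|n] s0 s1.
    by rewrite mul0r divr_ge0 // exprn_ge0 // ltW.
  have h := H3 n.+1 k isT.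
  have n0 : 0 <= n.+1%:R :> R by [].
  apply: le_trans (ler_wpM2l n0 h) _.
  have hn : n.+1%:R <= sq1 R n.+1 ^+ 2 by rewrite sq1_sqr ler_nat.
  have p0 : 0 <= C3 / sq1 R n.+1 ^+ i.+3 by rewrite divr_ge0 // exprn_ge0 // ltW.
  apply: le_trans (ler_wpM2r p0 hn) _.
  rewrite le_eqVlt; apply/orP; left; apply/eqP.
  by rewrite !exprS; field; rewrite !gt_eqF ?exprn_gt0.
Qed.

End Window.

(** * Lower bounds for the walk by a Gronwall argument *)

Section Gronwall.
Variable R : realType.
Variable w : {poly R}.
Hypotheses (w_ge0 : forall j, 0 <= w`_j) (w_sum : w.[1] = 1)
  (w0_gt0 : 0 < w`_0) (w1_gt0 : 0 < w`_1).
Notation s := (sq1 R).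
Notation b n k := (w ^+ n)`_k.
Notation y := (dev w).
Notation v2 := (vari w).

(** Its square is at least four times the variance, so by Chebyshev's inequality mass at most 1/4
    lies farther than [center_radius * sq1 n] from the mean. *)
Definition center_radius := 2 * v2 + 2.
Notation K0 := center_radius.

Lemma center_radius_gt0 : 0 < K0.
Proof. by have := vari_gt0 w_ge0 w_sum w0_gt0 w1_gt0; rewrite /K0 => *; lra. Qed.

(** Otherwise the central interval, with at most [2 * K0 * s n + 1] integers, would carry mass at
    most 1/2 and its complement at most 1/4. *)
Lemma exists_center n : exists k, `|y n k| <= K0 * s n /\
  (2 * (2 * K0 + 1))^-1 / s n <= b n k.
Proof.
have s0 := sq1_gt0 R n; have s1 := sq1_ge1 R n.
have v0 := vari_gt0 w_ge0 w_sum w0_gt0 w1_gt0.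
have k0 := center_radius_gt0.
set c0 := (2 * (2 * K0 + 1))^-1.
have c00 : 0 < c0 by rewrite invr_gt0; lra.
apply: contrapT => noK.
have noK' k : `|y n k| <= K0 * s n -> b n k <= c0 / s n.
  by move=> h; rewrite leNgt; apply/negP => h'; apply: noK; exists k; split=> //; apply: ltW.
pose x1 := n%:R * mean w - K0 * s n; pose x2 := n%:R * mean w + K0 * s n.
have ks0 : 0 < K0 * s n by rewrite mulr_gt0.
have Hk k : b n k <= (K0 * s n) ^- 2 * ((k%:R - n%:R * mean w) ^+ 2 * b n k) +
   c0 / s n * (x1 <= k%:R <= x2)%R%:R.
  have b0 := coef_pow_ge0 w_ge0 n k.
  have q0 : 0 <= (K0 * s n) ^- 2 * ((k%:R - n%:R * mean w) ^+ 2 * b n k).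
    by rewrite mulr_ge0 ?invr_ge0 ?exprn_ge0 ?(ltW ks0) // mulr_ge0 // sqr_ge0.
  case: (boolP (x1 <= k%:R <= x2)) => [/andP[h1 h2]|h].
    rewrite mulr1; apply: le_trans (noK' k _) _; last by rewrite lerDr.
    by rewrite ler_norml /dev; rewrite /x1 /x2 in h1 h2; apply/andP; split; lra.
  rewrite mulr0 addr0 mulrA -[leLHS]mul1r ler_wpM2r //.
  rewrite mulrC ler_pdivlMr ?exprn_gt0 // mul1r -[leRHS]real_normK ?num_real ?normr_ge0 //.
  rewrite ler_pXn2r ?nnegrE ?(ltW ks0) // leNgt; apply/negP => h'.
  move: h; apply/negP; rewrite negbK; move: h'; rewrite ltr_norml /x1 /x2.
  by case/andP => h1 h2; apply/andP; split; lra.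
have := pow_horner1 w_sum n; rewrite horner_coef.
under eq_bigr => k _ do rewrite expr1n mulr1.
move=> E1; have {E1} : 1 <= \sum_(k < size (w ^+ n)) ((K0 * s n) ^- 2 *
   ((k%:R - n%:R * mean w) ^+ 2 * b n k) + c0 / s n * (x1 <= k%:R <= x2)%R%:R).
  by rewrite -{1}E1; apply: ler_sum => k _; exact: Hk.
rewrite big_split /= -!mulr_sumr sum_sqr_dev pow_horner1 //.
have [-> ->] := pow_moments w_sum n.
have -> : n%:R * v2 + (n%:R * mean w) ^+ 2 -
   2 * (n%:R * mean w) * (n%:R * mean w) + (n%:R * mean w) ^+ 2 * 1 = n%:R * v2.
  by ring.
have x12 : x1 <= x2 by rewrite /x1 /x2; lra.
have H1 := count_interval (size (w ^+ n)) x12.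
have H2 : (K0 * s n) ^- 2 * (n%:R * v2) <= 1 / 4.
  rewrite mulrC ler_pdivrMr ?exprn_gt0 // exprMn sq1_sqr.
  have n0 : 0 <= n%:R :> R by [].
  rewrite -(natr1 n); set X := n%:R in n0 *.
  have kk : v2 * 4 <= K0 ^+ 2.
    by rewrite /K0; have := sqr_ge0 v2; rewrite !expr2; nra.
  nra.
have cs : 0 <= c0 / s n by rewrite divr_ge0 // ltW.
have H3 := ler_wpM2l cs H1.
have H4 : c0 / s n * (x2 - x1 + 1) <= 1 / 2.
  have -> : x2 - x1 + 1 = 2 * K0 * s n + 1 by rewrite /x1 /x2; ring.
  rewrite mulrAC ler_pdivrMr //.
  have E : c0 * (2 * K0 + 1) = 1 / 2.
    by rewrite /c0; field; rewrite gt_eqF //; lra.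
  have E2 : c0 * (2 * K0 + 1) * s n = 1 / 2 * s n by rewrite E.
  nra.
lra.
Qed.

(** For i = 0 the recurrence bounds the relative decrease from one coefficient to the next by a
    multiple of 1/s n, up to an error of order (s n)^(-3). From the vertex of [exists_center] to [k]
    there are at most (K + K0) s n steps to the right, so the accumulated factor stays bounded. *)
Lemma window_lower K : 0 <= K -> exists2 c, 0 < c &
  exists n1, forall n k, (n1 <= n)%N -> K0 * s n <= y n k <= K * s n -> c / s n <= b n k.
Proof.
move=> Kge0.
have v0 := vari_gt0 w_ge0 w_sum w0_gt0 w1_gt0.
have k0 := center_radius_gt0.
have [C Cge0 HC] := stein w_ge0 w_sum w0_gt0 w1_gt0 0.
set c0 := (2 * (2 * K0 + 1))^-1.
have c00 : 0 < c0 by rewrite invr_gt0; lra.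
pose kap := K / v2; pose C' := C / v2.
have kap0 : 0 <= kap by rewrite divr_ge0 // ltW.
have C'0 : 0 <= C' by rewrite divr_ge0 // ltW.
pose M := expR (kap * (K + K0)).
have M0 : 0 < M := expR_gt0 _.
exists (c0 / (2 * M)); first by rewrite divr_gt0 // mulr_gt0.
(* Beyond this threshold the accumulated error costs at most half of the initial value
   [c0 / s n]. *)
have [n1 Hn1] := @sq1_large R (2 * (K + K0) * M * C' / c0).
exists n1 => n k /Hn1 sbig /andP[yk1 yk2].
have s0 := sq1_gt0 R n.
have [ks [hks1 hks2]] := exists_center n; rewrite -/c0 in hks2.
have leks : (ks <= k)%N.
  rewrite -(ler_nat R); move: hks1; rewrite ler_norml /dev => /andP[_].
  by move: yk1; rewrite /dev => *; lra.
pose x := kap / s n; pose e := C' / s n ^+ 3.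
have x0 : 0 <= x by rewrite divr_ge0 // ltW.
have e0 : 0 <= e by rewrite divr_ge0 // exprn_ge0 // ltW.
(* Since the coefficients are nonnegative only an upper bound on [y] is needed, so the chain may
   start to the left of the mean. *)
have step j : y n j.+1 <= K * s n -> b n j - e <= b n j.+1 * (1 + x).
  move=> hy; have := HC n j.+1.
  rewrite mul0r addr0 /diff_coef expr0 mul1r !expr1 [(1 - 'X) * _]mulrBl mul1r.
  rewrite coefB coefXM /=; set b1 := b n j.+1; set b0 := b n j.
  rewrite ler_norml => /andP[h _].
  have b1ge0 : 0 <= b1 := coef_pow_ge0 w_ge0 n j.+1.
  have h2 : y n j.+1 * b1 <= K * s n * b1 by rewrite ler_wpM2r.
  have q0 : 0 < s n ^+ 2 * v2 by rewrite mulr_gt0 // exprn_gt0.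
  rewrite -(ler_pM2l q0).
  have -> : s n ^+ 2 * v2 * (b1 * (1 + x)) = s n ^+ 2 * v2 * b1 + K * s n * b1.
    by rewrite /x /kap; field; rewrite !gt_eqF.
  have -> : s n ^+ 2 * v2 * (b0 - e) = s n ^+ 2 * v2 * b0 - C / s n.
    by rewrite /e /C'; field; rewrite !gt_eqF.
  lra.
have iter i : y n (ks + i)%N <= K * s n ->
   b n ks - i%:R * (1 + x) ^+ i * e <= b n (ks + i)%N * (1 + x) ^+ i.
  elim: i => [|i IH]; first by rewrite addn0 expr0 !mul0r subr0 mulr1.
  rewrite addnS => hy.
  have hy' : y n (ks + i)%N <= K * s n.
    by apply: le_trans hy; rewrite /dev -natr1; lra.
  have h1 := IH hy'; have h2 := step _ hy.
  have p0 : 0 <= (1 + x) ^+ i by rewrite exprn_ge0 //; lra.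
  have h3 := ler_wpM2r p0 h2.
  have -> : b n (ks + i).+1 * (1 + x) ^+ i.+1 = b n (ks + i).+1 * (1 + x) * (1 + x) ^+ i.
    by rewrite exprS; ring.
  apply: le_trans h3; rewrite mulrBl.
  have h4 : (i%:R + 1) * (1 + x) ^+ i * e <= i.+1%:R * (1 + x) ^+ i.+1 * e.
    rewrite -natr1 ler_wpM2r // ler_wpM2l ?addr_ge0 // exprS.
    by rewrite ler_peMl //; lra.
  have h5 : (i%:R + 1) * (1 + x) ^+ i * e = i%:R * (1 + x) ^+ i * e + e * (1 + x) ^+ i by ring.
  lra.
have := iter (k - ks)%N; rewrite subnKC // => /(_ yk2).
set i := (k - ks)%N => H.
have iE : i%:R = y n k - y n ks by rewrite /dev natrB //; ring.
have ile : i%:R <= (K + K0) * s n.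
  by rewrite iE; move: hks1; rewrite ler_norml => /andP[h1 _]; lra.
have PM : (1 + x) ^+ i <= M.
  apply: (@le_trans _ _ (expR x ^+ i)).
    by rewrite lerXn2r ?nnegrE ?expR_ge0 ?expR_ge1Dx //; lra.
  rewrite -expRM_natl ler_expR /x.
  have -> : kap * (K + K0) = (K + K0) * s n * (kap / s n) by field; rewrite gt_eqF.
  by rewrite ler_wpM2r.
have bk0 : 0 <= b n k := coef_pow_ge0 w_ge0 n k.
have H1 : b n k * (1 + x) ^+ i <= b n k * M by rewrite ler_wpM2l.
have H2 : i%:R * (1 + x) ^+ i * e <= (K + K0) * s n * M * e.
  by rewrite ler_wpM2r // ler_pM // exprn_ge0 //; lra.
have H3 : (K + K0) * s n * M * e <= c0 / (2 * s n).
  rewrite /e ler_pdivlMr ?mulr_gt0 //.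
  have -> : (K + K0) * s n * M * (C' / s n ^+ 3) * (2 * s n) =
     (2 * (K + K0) * M * C' / c0) / s n * c0 by field; rewrite !gt_eqF.
  by rewrite -[leRHS]mul1r ler_wpM2r ?(ltW c00) // ler_pdivrMr // mul1r.
have H4 : c0 / s n - c0 / (2 * s n) = c0 / (2 * s n) by field; rewrite gt_eqF.
have -> : c0 / (2 * M) / s n = c0 / (2 * s n) / M by field; rewrite !gt_eqF.
rewrite ler_pdivrMr //; lra.
Qed.
End Gronwall.

(** * Quotients over the cone below a window vertex *)

Section Cone.
Variable R : realType.
Variable w : {poly R}.
Hypotheses (w_ge0 : forall j, 0 <= w`_j) (w_sum : w.[1] = 1)
  (w0_gt0 : 0 < w`_0) (w1_gt0 : 0 < w`_1).
Notation s := (sq1 R).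
Notation b n k := (w ^+ n)`_k.
Notation y := (dev w).
Notation v2 := (vari w).
Notation K0 := (center_radius w).
Notation delta := (diff_coef w).
Notation D := (1 - 'X : {poly R}).

Lemma uniform_bound (P : nat -> R -> Prop) :
  (forall i C C', P i C -> C <= C' -> P i C') ->
  (forall i, exists2 C, 0 <= C & P i C) ->
  forall M, exists2 C, 0 <= C & forall i, (i < M)%N -> P i C.
Proof.
move=> mono ex; elim=> [|M [C C0 HC]]; first by exists 0.
have [C' C'0 HC'] := ex M; exists (C + C'); first exact: addr_ge0.
move=> i; rewrite ltnS leq_eqVlt => /orP[/eqP->|/HC h].
  by apply: mono HC' _; rewrite lerDr.
by apply: mono h _; rewrite lerDl.
Qed.

Lemma ler_div_sq1 (C C' : R) n i : C <= C' -> C / s n ^+ i <= C' / s n ^+ i.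
Proof. by move=> h; rewrite ler_wpM2r // invr_ge0 exprn_ge0 // sq1_ge0. Qed.

(* Far to the right of the mean the recurrence [stein] is dominated by its
   first term, so no difference of w^n is small there. *)
Lemma delta_lower M Z c : v2 + M%:R + 1 <= Z -> 0 < c ->
  exists n1, forall n k, (n1 <= n)%N -> Z * s n <= y n k -> c / s n <= b n k ->
  forall i, (i <= M)%N -> c <= s n ^+ i.+1 * `|delta i n k|.
Proof.
move=> hZ c0.
have v0 := vari_gt0 w_ge0 w_sum w0_gt0 w1_gt0.
have [C C0 HC] := @uniform_bound (fun i C => forall n k,
  `|y n k * delta i n k + i%:R * delta i.-1 n k
    + s n ^+ 2 * v2 * delta i.+1 n k| <= C / s n ^+ i.+1)
  (fun i C C' h hC n k => le_trans (h n k) (ler_div_sq1 n i.+1 hC))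
  (stein w_ge0 w_sum w0_gt0 w1_gt0) M.
have [n1 Hn1] := @sq1_large R (C / c).
exists n1 => n k /Hn1 sbig yk bk.
have s0 := sq1_gt0 R n; set S := s n in s0 sbig yk bk *.
pose V i := S ^+ i.+1 * `|delta i n k|.
(* The factor [i] makes the monotonicity clause void at i = 0, where [i.-1] is again 0. *)
suff H i : (i <= M)%N -> c <= V i /\ i%:R * V i.-1 <= i%:R * V i.
  by move=> i /H[].
elim: i => [|i IH] iM.
  rewrite !mul0r; split=> //; rewrite /V expr1 /diff_coef expr0 mul1r.
  by rewrite mulrC -ler_pdivrMr // (le_trans bk) // ler_norm.
have [IH1 IH2] := IH (ltnW iM).
(* Normalized, the recurrence reads Z V_i <= C/S + i V_(i-1) + v2 V_(i+1), and the first two terms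
   on the right are at most (i + 1) V_i. As Z >= v2 + i + 1, the sequence V cannot decrease. *)
suff H : V i <= V i.+1.
  by split; [exact: le_trans H | rewrite ler_wpM2l].
have := HC i iM n k; rewrite -/S.
set d0 := delta i n k; set dm := delta i.-1 n k; set dp := delta i.+1 n k.
move=> hst.
have y0 : 0 <= y n k.
  apply: le_trans yk; rewrite mulr_ge0 ?(ltW s0) // (le_trans _ hZ) //.
  exact: addr_ge0 (addr_ge0 (ltW v0) (ler0n _ _)) ler01.
have H1 : y n k * `|d0| <= C / S ^+ i.+1 + i%:R * `|dm| + S ^+ 2 * v2 * `|dp|.
  have e : y n k * d0 = (y n k * d0 + i%:R * dm + S ^+ 2 * v2 * dp)
     - i%:R * dm - S ^+ 2 * v2 * dp by ring.
  have -> : y n k * `|d0| = `|y n k * d0| by rewrite normrM (ger0_norm y0).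
  rewrite e; apply: le_trans (ler_normB _ _) _; apply: lerD; last first.
    by rewrite normrM ger0_norm // mulr_ge0 ?(ltW v0) // exprn_ge0 // ltW.
  apply: le_trans (ler_normB _ _) _; apply: lerD => //.
  by rewrite normrM ger0_norm.
have P0 : 0 < S ^+ i by rewrite exprn_gt0.
have H2 : Z * S * `|d0| <= y n k * `|d0| by rewrite ler_wpM2r.
have H3 := ler_wpM2l (ltW P0) (le_trans H2 H1).
have E1 : S ^+ i * (Z * S * `|d0|) = Z * V i by rewrite /V exprS -/d0; ring.
have E2 : S ^+ i * (C / S ^+ i.+1 + i%:R * `|dm| + S ^+ 2 * v2 * `|dp|) =
   C / S + S ^+ i * (i%:R * `|dm|) + v2 * V i.+1.
  rewrite /V -/dp !exprS; field; rewrite !gt_eqF //.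
rewrite E1 E2 in H3.
have H4 : S ^+ i * (i%:R * `|dm|) <= i%:R * V i.
  rewrite /dm; case: (i) IH2 => [_|j /= h]; first by rewrite !mul0r mulr0.
  by apply: le_trans h; rewrite /V mulrCA.
have H5 : C / S <= V i.
  by apply: le_trans IH1; rewrite ler_pdivrMr // mulrC -ler_pdivrMr.
have V0 : 0 <= V i by rewrite mulr_ge0 // exprn_ge0 // ltW.
have H6 : (v2 + i%:R + 1) * V i <= Z * V i.
  rewrite ler_wpM2r // (le_trans _ hZ) // lerD2r lerD2l ler_nat ltnW //.
rewrite -(ler_pM2l v0); lra.
Qed.

Variables (d N m : nat) (G : {poly R}).
Hypotheses (size_w : (size w <= d.+1)%N) (G1 : G.[1] != 0) (m_gt0 : (0 < m)%N).
Notation f n k := (G * (D ^+ m * w ^+ (n - N)))`_k.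
Notation mu := (mean w).

(** The upper bound is strict because step 0 has positive probability. It makes [mu - d%:R] nonzero,
    so that an edge of type [d] changes the quotients to leading order. *)
Lemma mean_bounds : 0 <= mu /\ mu < d%:R.
Proof.
have sE : (size (euler w) <= d.+1)%N.
  by apply/leq_sizeP => j hj; rewrite coef_euler nth_default ?mulr0 // (leq_trans size_w).
have -> : mu = \sum_(j < d.+1) j%:R * w`_j.
  rewrite /mean (horner_coef_wide _ sE); apply: eq_bigr => i _.
  by rewrite expr1n mulr1 coef_euler.
split; first by apply: sumr_ge0 => j _; rewrite mulr_ge0.
have d0 : 0 < d%:R :> R.
  rewrite ltr0n lt0n; apply/eqP => d0; move: w1_gt0.
  by rewrite nth_default ?ltxx // (leq_trans size_w) // d0.
have -> : d%:R = \sum_(j < d.+1) d%:R * w`_j.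
  rewrite -mulr_sumr -[LHS]mulr1 -w_sum (horner_coef_wide _ size_w).
  by congr (_ * _); apply: eq_bigr => i _; rewrite expr1n mulr1.
rewrite -subr_gt0 -sumrB big_ord_recl /= mul0r subr0 ltr_pwDl ?mulr_gt0 //.
apply: sumr_ge0 => j _; rewrite -mulrBl mulr_ge0 // subr_ge0 ler_nat.
exact: ltn_ord.
Qed.

Lemma coef_shift j (p : {poly R}) k : (j <= k)%N -> p`_(k - j) = ('X^j * p)`_k.
Proof. by move=> jk; rewrite coefXnM ltnNge jk. Qed.

(** Going back along an edge of type j compares w^(n-1) at k - j with w^n at k, that is, multiplies
    w^(n-1) by X^j instead of w; the difference contains one factor [D]. *)
Lemma XnBw_factor j : exists2 e, 'X^j - w = e * D & e.[1] = mu - j%:R.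
Proof.
have [e he he1] : exists2 e, 'X^j - w = e * D & e.[1] = - ('X^j - w)^`().[1].
  by apply: root1_factor; rewrite hornerD hornerN hornerXn expr1n w_sum subrr.
exists e; rewrite // he1 derivB derivXn hornerD hornerN hornerMn hornerXn expr1n.
by rewrite -euler_horner1 -/mu; ring.
Qed.

(** Increments along an edge of type [j] gain one factor [D]. After the two sizes come the two
    leading terms, in which [mu - j%:R] is the value at 1 of the cofactor in [XnBw_factor]. *)
Definition incr_approx j C :=
  forall n k, (N < n)%N -> (j <= k)%N ->
  [/\ `|b n.-1 (k - j) - b n k| <= C / s n ^+ 2,
   `|f n.-1 (k - j) - f n k| <= C / s n ^+ m.+2,
   `|b n.-1 (k - j) - b n k - (mu - j%:R) * delta 1 n k| <= C / s n ^+ 3 &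
   `|f n.-1 (k - j) - f n k - G.[1] * (mu - j%:R) * delta m.+1 n k|
       <= C / s n ^+ m.+3].

Lemma incr_approxP j : exists2 C, 0 <= C & incr_approx j C.
Proof.
have [e he he1] := XnBw_factor j.
have [C1 C10 H1] := coef_decay w_ge0 w_sum w0_gt0 w1_gt0 e 1 1.
have [C2 C20 H2] := coef_decay w_ge0 w_sum w0_gt0 w1_gt0 (G * e) m.+1 N.+1.
have [C3 C30 H3] := coef_lead w_ge0 w_sum w0_gt0 w1_gt0 e 1 1.
have [C4 C40 H4] := coef_lead w_ge0 w_sum w0_gt0 w1_gt0 (G * e) m.+1 N.+1.
exists (C1 + C2 + C3 + C4); first by rewrite !addr_ge0.
move=> n k Nn jk.
have n0 : (0 < n)%N by apply: leq_trans Nn.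
have Eb : b n.-1 (k - j) - b n k = (e * (D ^+ 1 * w ^+ (n - 1)))`_k.
  rewrite coef_shift // -coefB subn1; apply: (congr1 (fun p : {poly R} => p`_k)).
  rewrite -{2}(prednK n0) exprS expr1 mulrA -he; ring.
have Ef : f n.-1 (k - j) - f n k = ((G * e) * (D ^+ m.+1 * w ^+ (n - N.+1)))`_k.
  rewrite coef_shift // -coefB; apply: (congr1 (fun p : {poly R} => p`_k)).
  have -> : (n.-1 - N = n - N.+1)%N by rewrite -subn1 -subnDA add1n.
  have -> : (n - N = (n - N.+1).+1)%N by rewrite subnSK.
  set W := w ^+ (n - N.+1); rewrite [D ^+ m.+1]exprS exprS -/W.
  have -> : G * e * (D * D ^+ m * W) = G * (e * D) * (D ^+ m * W) by ring.
  by rewrite -he; ring.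
rewrite Eb Ef; split.
- apply: le_trans (H1 _ _ n0) _; apply: ler_div_sq1; lra.
- apply: le_trans (H2 _ _ Nn) _; apply: ler_div_sq1; lra.
- rewrite -he1; apply: le_trans (H3 _ _ n0) _; apply: ler_div_sq1; lra.
- rewrite -he1 -hornerM; apply: le_trans (H4 _ _ Nn) _; apply: ler_div_sq1; lra.
Qed.

Lemma ler_normM2 (x z X Z : R) : `|x| <= X -> `|z| <= Z -> `|x * z| <= X * Z.
Proof. by move=> h1 h2; rewrite normrM ler_pM. Qed.

(** [S] stands for [s n] and [p] for (s n)^(-(m+1)), the size of [f]. Both terms of the quotient
    rule have size [p]: an increment gains a factor 1/S, and division by [b] costs a factor S. *)
Lemma quotient_incr_upper (c C p S b0 b1 f0 f1 : R) :
  0 < S -> 0 <= p -> 0 < c -> c / S <= b0 -> c / S <= b1 ->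
  `|b1 - b0| <= C / S ^+ 2 -> `|f1 - f0| <= C * p / S -> `|f0| <= C * p ->
  `|f1 / b1 - f0 / b0| <= (C / c + C * C / c ^+ 2) * p.
Proof.
move=> S0 p0 c0 hb0 hb1 db df hf.
have cS : 0 < c / S by rewrite divr_gt0.
have b00 : 0 < b0 := lt_le_trans cS hb0.
have b10 : 0 < b1 := lt_le_trans cS hb1.
have V0 : `|b0^-1| <= S / c.
  by rewrite ger0_norm ?invr_ge0 ?(ltW b00) ?(ltW b10) // -[S / c]invf_div lef_pV2.
have V1 : `|b1^-1| <= S / c.
  by rewrite ger0_norm ?invr_ge0 ?(ltW b00) ?(ltW b10) // -[S / c]invf_div lef_pV2.
have -> : f1 / b1 - f0 / b0 = (f1 - f0) * b1^-1 - f0 * (b1 - b0) * (b1^-1 * b0^-1).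
  by field; rewrite !gt_eqF.
apply: le_trans (ler_normB _ _) _.
have -> : (C / c + C * C / c ^+ 2) * p =
  C * p / S * (S / c) + C * p * (C / S ^+ 2) * (S / c * (S / c)).
  by field; rewrite !gt_eqF.
by apply: lerD; repeat apply: ler_normM2.
Qed.

(** Wronskian cancellation. To leading order [b0 * (f1 - f0) - f0 * (b1 - b0)] is g a (b0 dp - dm
    d1). Multiplied by S^2 v, with the recurrences of orders m and 0 substituted for [dp] and [d1],
    the terms in [yy] cancel and - g a M b0 dm1 remains. This is H_m' = m H_(m-1) for Hermite
    polynomials, and a lower bound on the difference of order m - 1 is all it takes. *)
Lemma quotient_incr_lower (c C p S v g a M yy b0 b1 f0 f1 d1 dm dm1 dp : R) :
  0 < S -> 0 < p -> 0 < c -> 0 < C -> 0 < v -> 0 <= M ->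
  0 < b0 -> 0 < b1 -> b0 <= C / S -> b1 <= C / S ->
  `|dm| <= C * p ->
  `|b1 - b0| <= C / S ^+ 2 -> `|b1 - b0 - a * d1| <= C / S ^+ 3 ->
  `|f1 - f0 - g * a * dp| <= C * p / S ^+ 2 -> `|f0 - g * dm| <= C * p / S ->
  `|yy * dm + M * dm1 + S ^+ 2 * v * dp| <= C * p ->
  `|yy * b0 + S ^+ 2 * v * d1| <= C / S ->
  c / S <= b0 -> c * p * S <= `|dm1| ->
  `|g * a| * M * c ^+ 2 * p
     - C ^+ 2 * (v * (2 + `|g|) + 2 * `|g * a|) * p / S
  <= v * C ^+ 2 * `|f1 / b1 - f0 / b0|.
Proof.
move=> S0 p0 c0 C0 v0 M0 b00 b10 hb0 hb1 hdm db e2 e1 e3 st1 st2 lb ldm1.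
have S0' := ltW S0; have p0' := ltW p0; have c0' := ltW c0; have C0' := ltW C0.
have v0' := ltW v0; have b00' := ltW b00; have b10' := ltW b10.
pose X := S ^+ 2 * v * (b0 * b1) * (f1 / b1 - f0 / b0).
have XE : X = - (g * a * M * (b0 * dm1)) +
  (S ^+ 2 * v * (b0 * (f1 - f0 - g * a * dp) - g * (dm * (b1 - b0 - a * d1))
     - (f0 - g * dm) * (b1 - b0))
   + g * a * (b0 * (yy * dm + M * dm1 + S ^+ 2 * v * dp)
        - dm * (yy * b0 + S ^+ 2 * v * d1))).
  by rewrite /X; field; rewrite !gt_eqF.
have nb0 : `|b0| <= C / S by rewrite ger0_norm.
have Sv : `|S ^+ 2 * v| <= S ^+ 2 * v by rewrite ger0_norm // mulr_ge0 ?exprn_ge0.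
have Xup : `|X| <= v * C ^+ 2 * `|f1 / b1 - f0 / b0|.
  rewrite /X normrM ler_wpM2r // ger0_norm; last first.
    by rewrite !mulr_ge0 ?exprn_ge0.
  have h : b0 * b1 <= C / S * (C / S) by rewrite ler_pM.
  have q : 0 <= S ^+ 2 * v by rewrite mulr_ge0 ?exprn_ge0.
  apply: le_trans (ler_wpM2l q h) _.
  by rewrite le_eqVlt; apply/orP; left; apply/eqP; field; rewrite gt_eqF.
apply: le_trans Xup; rewrite XE.
set A := g * a * M * (b0 * dm1); set B := (X in - A + X).
have hA : `|g * a| * M * c ^+ 2 * p <= `|A|.
  rewrite /A !normrM (ger0_norm M0) (ger0_norm (ltW b00)).
  have -> : `|g| * `|a| * M * c ^+ 2 * p = `|g| * `|a| * M * (c / S * (c * p * S)).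
    by field; rewrite gt_eqF.
  rewrite ler_wpM2l ?mulr_ge0 // ler_pM // ?divr_ge0 ?mulr_ge0 //.
have hB : `|B| <= C ^+ 2 * (v * (2 + `|g|) + 2 * `|g * a|) * p / S.
  have -> : C ^+ 2 * (v * (2 + `|g|) + 2 * `|g * a|) * p / S =
     S ^+ 2 * v * (C / S * (C * p / S ^+ 2) + `|g| * (C * p * (C / S ^+ 3))
       + C * p / S * (C / S ^+ 2))
     + `|g * a| * (C / S * (C * p) + C * p * (C / S)).
    by field; rewrite gt_eqF.
  rewrite /B; apply: le_trans (ler_normD _ _) _; apply: lerD.
    apply: ler_normM2 => //; apply: le_trans (ler_normB _ _) _; apply: lerD.
      apply: le_trans (ler_normB _ _) _; apply: lerD; first exact: ler_normM2.
      by apply: ler_normM2 => //; apply: ler_normM2.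
    exact: ler_normM2.
  apply: ler_normM2 => //; apply: le_trans (ler_normB _ _) _.
  by apply: lerD; apply: ler_normM2.
have -> : - A + B = - (A - B) by ring.
rewrite normrN; have h := lerB_dist A B.
by apply: le_trans h; lra.
Qed.

Lemma sq1_sub_small n l : (1 < n)%N -> (l * l <= n)%N ->
  [/\ (l <= n)%N, (n <= (n - l) + (n - l))%N, l%:R <= s n,
   s (n - l) <= s n & s n <= 2 * s (n - l)].
Proof.
move=> n1 ll.
have h : (l + l <= n)%N.
  by case: l ll => [|[|l]] // ll; apply: leq_trans ll; nia.
have e : 2 = Num.sqrt 4 :> R.
  by rewrite (_ : 4 = 2 ^+ 2) ?sqrtr_sqr ?ger0_norm //; ring.
split; [lia | lia | | by apply: sq1_le; lia |].
  rewrite -[leLHS]ger0_norm // -sqrtr_sqr ler_wsqrtr // -natrX ler_nat.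
  by rewrite expnS expn1; lia.
rewrite e -sqrtrM ?ler0n // ler_wsqrtr // -natrM ler_nat; lia.
Qed.

(** [K0 + d%:R] keeps the cone of depth sqrt n to the right of [K0 * s n], where [window_lower]
    applies; [v2 + m%:R + 1] is the threshold of [delta_lower]. *)
Definition window_pos : R := K0 + d%:R + v2 + m%:R + 1.
Definition in_window n k := window_pos * s n <= y n k <= (window_pos + 1) * s n.

Lemma window_pos_ge : [/\ 0 < K0, 0 < v2 & K0 + d%:R + v2 + m%:R + 1 <= window_pos].
Proof.
by split=> //; [exact: center_radius_gt0 | exact: vari_gt0].
Qed.

Lemma cone_bounds : exists c C, [/\ 0 < c, 0 < C & exists n1,
  forall n k, (n1 <= n)%N -> in_window n k ->
  forall l i, (l * l <= n)%N -> (i <= d * l)%N ->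
  [/\ (i <= k)%N, (N + l < n)%N, c / s n <= b (n - l) (k - i) &
      b (n - l) (k - i) <= C / s n]].
Proof.
have [k0 v0 hZ] := window_pos_ge.
have [mu0 mud] := mean_bounds.
(* Within the cone the deviation grows by at most [d%:R * s n], and [s n <= 2 * s (n - l)]. *)
pose K := 2 * (window_pos + 1 + d%:R).
have d0 : 0 <= d%:R :> R := ler0n _ _.
have m0 : 0 <= m%:R :> R := ler0n _ _.
have Z0 : 0 <= window_pos by apply: le_trans hZ; lra.
have Kge0 : 0 <= K by rewrite /K; lra.
have [c c0 [n1 Hn1]] := window_lower w_ge0 w_sum w0_gt0 w1_gt0 Kge0.
have [C C0 HC] := coef_diff_decay w_ge0 w_sum w0_gt0 w1_gt0 0.
exists c, (2 * C + 1); split; [by []|lra|].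
exists (n1 + n1 + N + N + 4)%N => n k hn /andP[y1 y2] l i ll il.
have n2 : (1 < n)%N by clear -hn; lia.
have [h1 h2 h3 h4 h5] := sq1_sub_small n2 ll.
have s0 := sq1_gt0 R n; have s'0 := sq1_gt0 R (n - l).
have iR : i%:R <= d%:R * s n.
  have : i%:R <= d%:R * l%:R :> R by rewrite -natrM ler_nat.
  by move=> h; apply: le_trans h _; rewrite ler_wpM2l.
have ik : (i <= k)%N.
  rewrite -(ler_nat R); apply: le_trans iR _.
  have hh : d%:R * s n <= window_pos * s n by rewrite ler_wpM2r ?(ltW s0) //; lra.
  have : 0 <= n%:R * mu by rewrite mulr_ge0.
  by move: y1; rewrite /dev; lra.
have dE : y (n - l) (k - i)%N = y n k - i%:R + l%:R * mu.
  by rewrite /dev !natrB //; ring.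
have lm : l%:R * mu <= d%:R * s n.
  by rewrite mulrC ler_pM // ltW.
have lm0 : 0 <= l%:R * mu by rewrite mulr_ge0.
have i0 : 0 <= i%:R :> R by [].
have lowy : K0 * s (n - l) <= y (n - l) (k - i)%N.
  rewrite dE; apply: (@le_trans _ _ (K0 * s n)).
    by rewrite ler_wpM2l // ltW.
  have hh : (K0 + d%:R) * s n <= window_pos * s n by rewrite ler_wpM2r ?(ltW s0) //; lra.
  lra.
have upy : y (n - l) (k - i)%N <= K * s (n - l).
  rewrite dE; apply: (@le_trans _ _ ((window_pos + 1 + d%:R) * s n)); first by lra.
  have -> : K * s (n - l) = (window_pos + 1 + d%:R) * (2 * s (n - l)).
    by rewrite /K; ring.
  by rewrite ler_wpM2l //; lra.
split=> //; first by clear -hn h1 h2; lia.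
  apply: (@le_trans _ _ (c / s (n - l))).
    by rewrite ler_pM2l // lef_pV2 ?posrE.
  by apply: Hn1; [clear -hn h1 h2; lia | rewrite lowy upy].
have := HC (n - l)%N (k - i)%N; rewrite expr0 mul1r expr1.
move=> /(le_trans (ler_norm _)) h; apply: le_trans h _.
rewrite ler_pdivrMr // mulrAC ler_pdivlMr //.
have : C * s n <= C * (2 * s (n - l)) by rewrite ler_wpM2l.
lra.
Qed.

Lemma window_run n : exists k1, forall i, (i.+1 * i.+1 <= n)%N -> in_window n (k1 + i)%N.
Proof.
have [k0 v0 hZ] := window_pos_ge.
have [mu0 mud] := mean_bounds.
have s0 := sq1_gt0 R n.
have d0 : 0 <= d%:R :> R := ler0n _ _.
have m0 : 0 <= m%:R :> R := ler0n _ _.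
have Z0 : 0 <= window_pos by apply: le_trans hZ; lra.
pose x := n%:R * mu + window_pos * s n.
have x0 : 0 <= x by rewrite /x addr_ge0 // mulr_ge0 // ltW.
(* The first integer beyond the left end; the window has width [s n], and the bound on [i.+1] leaves
   room for the rounding. *)
exists (Num.trunc x).+1 => i ii.
have /andP[h1 h2] := trunc_itv x0.
have h3 : i%:R + 1 <= s n.
  rewrite natr1 -[leLHS]ger0_norm // -sqrtr_sqr ler_wsqrtr // -natrX ler_nat.
  by rewrite expnS expn1 leqW.
have i0 : 0 <= i%:R :> R by [].
rewrite /in_window /dev natrD; move: h1 h2; rewrite -natr1 /x => h1 h2.
apply/andP; split; lra.
Qed.

Definition ratio n k := f n k / b n k.

Lemma div_sq1_half (C : R) n n' i : 0 <= C -> s n <= 2 * s n' ->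
  C / s n' ^+ i <= 2 ^+ i * C / s n ^+ i.
Proof.
move=> C0 h; have s0 := sq1_gt0 R n; have s'0 := sq1_gt0 R n'.
rewrite ler_pdivrMr ?exprn_gt0 // mulrAC ler_pdivlMr ?exprn_gt0 //.
rewrite [leRHS](_ : _ = C * (2 * s n') ^+ i); last by rewrite exprMn; ring.
rewrite ler_wpM2l // lerXn2r // nnegrE ?ltW //.
by rewrite mulr_gt0.
Qed.

Lemma cone_incr : exists c C, [/\ 0 < c, 0 < C & exists n1,
  forall n k, (n1 <= n)%N -> in_window n k ->
  (forall l i j, (l.+1 * l.+1 <= n)%N -> (i <= d * l)%N -> (j <= d)%N ->
    `|ratio (n - l.+1) (k - (i + j)) - ratio (n - l) (k - i)| <= C / s n ^+ m.+1) /\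
  c / s n ^+ m.+1 <= `|ratio n.-1 (k - d) - ratio n k|].
Proof.
have [kr0 v0 hZ] := window_pos_ge.
have [mu0 mud] := mean_bounds.
have [c [C1 [c0 C10 [n1 H1]]]] := cone_bounds.
have [C2 C20 H2] := @uniform_bound incr_approx
  (fun j C C' (h : incr_approx j C) hC n k h1 h2 =>
    let: And4 e1 e2 e3 e4 := h n k h1 h2 in
    And4 (le_trans e1 (ler_div_sq1 _ _ hC)) (le_trans e2 (ler_div_sq1 _ _ hC))
     (le_trans e3 (ler_div_sq1 _ _ hC)) (le_trans e4 (ler_div_sq1 _ _ hC)))
  incr_approxP d.+1.
have [C3 C30 H3] := coef_decay w_ge0 w_sum w0_gt0 w1_gt0 G m N.
have [C4 C40 H4] := coef_lead w_ge0 w_sum w0_gt0 w1_gt0 G m N.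
have [C5 C50 H5] := coef_diff_decay w_ge0 w_sum w0_gt0 w1_gt0 m.
have [C6 C60 H6] := stein w_ge0 w_sum w0_gt0 w1_gt0 m.
have [C7 C70 H7] := stein w_ge0 w_sum w0_gt0 w1_gt0 0.
have d0 : 0 <= d%:R :> R := ler0n _ _.
have hZ2 : v2 + m%:R + 1 <= window_pos by apply: le_trans hZ; lra.
have [n2 H8] := delta_lower hZ2 c0.
(* Passing from [s (n - l)] to [s n] costs a factor 2 for each of at most m + 2 powers. *)
pose Cu := 2 ^+ m.+2 * (C2 + C3).
pose Cl := C1 + C2 + C4 + C5 + C6 + C7.
have Cl0 : 0 < Cl by rewrite /Cl; lra.
have [l1 l2 l4] : [/\ C1 <= Cl, C2 <= Cl & C4 <= Cl] by rewrite /Cl; split; lra.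
have [l5 l6 l7] : [/\ C5 <= Cl, C6 <= Cl & C7 <= Cl] by rewrite /Cl; split; lra.
pose g := G.[1]; pose a := mu - d%:R.
have a0 : a != 0 by rewrite /a lt_eqF // subr_lt0.
have M0 : 0 < m%:R :> R by rewrite ltr0n.
(* [A] measures the Wronskian term and [Bc / s n] the error against it; for large n the error is at
   most half of the term. *)
pose A := `|g * a| * m%:R * c ^+ 2.
have A0 : 0 < A.
  by rewrite /A !mulr_gt0 ?exprn_gt0 // normr_gt0 mulf_neq0.
pose Bc := Cl ^+ 2 * (v2 * (2 + `|g|) + 2 * `|g * a|).
have [n3 H9] := @sq1_large R (2 * Bc / A).
exists (A / (2 * v2 * Cl ^+ 2)), (Cu / c + Cu * Cu / c ^+ 2 + 1); split.
- by rewrite divr_gt0 // !mulr_gt0 // exprn_gt0.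
- have Cu0 : 0 <= Cu by rewrite /Cu mulr_ge0 ?exprn_ge0 // addr_ge0.
  have : 0 <= Cu / c by rewrite divr_ge0 // ltW.
  have : 0 <= Cu * Cu / c ^+ 2 by apply: divr_ge0; [exact: mulr_ge0 | exact: exprn_ge0 (ltW c0)].
  lra.
exists (n1 + n2 + n3 + N + 4)%N => n k hn win.
have s0 := sq1_gt0 R n.
pose p := (s n ^+ m.+1)^-1.
have p0 : 0 < p by rewrite invr_gt0 exprn_gt0.
have n1n : (n1 <= n)%N by clear -hn; lia.
have n2n : (1 < n)%N by clear -hn; lia.
split.
  move=> l i j ll il jd.
  have ll' : (l * l <= n)%N by clear -ll; nia.
  have [_ _ _ _ h5] := sq1_sub_small n2n ll'.
  have [ik Nl bl _] := H1 n k n1n win l i ll' il.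
  have ijl : (i + j <= d * l.+1)%N by rewrite mulnS addnC leq_add.
  have [ijk _ bl' _] := H1 n k n1n win l.+1 (i + j)%N ll ijl.
  have jk : (j <= k - i)%N by clear -ijk; lia.
  have Nn : (N < n - l)%N by clear -Nl; lia.
  have [e1 e2 _ _] := H2 j jd (n - l)%N (k - i)%N Nn jk.
  have E1 : (n - l).-1 = (n - l.+1)%N by rewrite subnS.
  have E2 : (k - i - j = k - (i + j))%N by rewrite subnDA.
  rewrite E1 E2 in e1 e2.
  have e3 := H3 (n - l)%N (k - i)%N (ltnW Nn).
  have P4 : 1 <= 2 ^+ m :> R by rewrite exprn_ege1 // ler1n.
  have hup := @quotient_incr_upper c Cu p (s n) (b (n - l) (k - i))
    (b (n - l.+1) (k - (i + j))) (f (n - l) (k - i)) (f (n - l.+1) (k - (i + j)))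
    s0 (ltW p0) c0 bl bl'.
  apply: (@le_trans _ _ ((Cu / c + Cu * Cu / c ^+ 2) * p)); last first.
    by rewrite /p ler_wpM2r ?(ltW p0) // lerDl ler01.
  apply: hup.
  - apply: le_trans e1 _; apply: le_trans (div_sq1_half 2 C20 h5) _.
    apply: ler_div_sq1; rewrite /Cu [2 ^+ m.+2]exprS [2 ^+ m.+1]exprS expr2.
    have : 0 <= (2 ^+ m - 1) * (C2 + C3) by apply: mulr_ge0; [rewrite subr_ge0 | exact: addr_ge0].
    by lra.
  - apply: le_trans e2 _; apply: le_trans (div_sq1_half m.+2 C20 h5) _.
    have -> : Cu * p / s n = Cu / s n ^+ m.+2.
      by rewrite /p [s n ^+ m.+2]exprSr; field; rewrite !gt_eqF ?exprn_gt0.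
    by apply: ler_div_sq1; rewrite /Cu ler_wpM2l ?exprn_ge0 // lerDl.
  - apply: le_trans e3 _; apply: le_trans (div_sq1_half m.+1 C30 h5) _.
    apply: ler_div_sq1; rewrite /Cu [2 ^+ m.+2]exprS.
    have : 0 <= 2 ^+ m.+1 * (2 * C2 + C3).
      by apply: mulr_ge0; rewrite ?exprn_ge0 // addr_ge0 // mulr_ge0.
    by lra.
have [_ _ lb0 ub0] := H1 n k n1n win 0 0 (leq0n _) (leq0n _).
rewrite !subn0 in lb0 ub0.
have n1' : (1 * 1 <= n)%N by rewrite mul1n ltnW.
have dd : (d <= d * 1)%N by rewrite muln1.
have [dk Nn lb1 ub1] := H1 n k n1n win 1 d n1' dd.
have Nn' : (N < n)%N by clear -Nn; lia.
rewrite subn1 in lb1 ub1.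
have [e1 e2 e3 e4] := H2 d (ltnSn d) n k Nn' dk.
have /andP[y1 y2] := win.
have lowd := H8 n k _ y1 lb0 m.-1 (leq_pred _).
have cS : 0 < c / s n by rewrite divr_gt0.
have b00 : 0 < b n k := lt_le_trans cS lb0.
have b10 : 0 < b n.-1 (k - d) := lt_le_trans cS lb1.
have pE C i : C / s n ^+ (m.+1 + i) = C * p / s n ^+ i.
  by rewrite /p exprD; field; rewrite !gt_eqF ?exprn_gt0.
have low := @quotient_incr_lower c Cl p (s n) v2 g a m%:R (y n k) (b n k)
  (b n.-1 (k - d)) (f n k) (f n.-1 (k - d)) (delta 1 n k) (delta m n k)
  (delta m.-1 n k) (delta m.+1 n k)
  s0 p0 c0 Cl0 v0 (ltW M0) b00 b10.
have {low} low : A * p - Bc * p / s n <=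
    v2 * Cl ^+ 2 * `|ratio n.-1 (k - d) - ratio n k|.
  apply: low.
  - by apply: le_trans ub0 _; have := @ler_div_sq1 C1 Cl n 1; rewrite expr1; exact.
  - by apply: le_trans ub1 _; have := @ler_div_sq1 C1 Cl n 1; rewrite expr1; exact.
  - by apply: le_trans (H5 n k) _; apply: ler_div_sq1.
  - by apply: le_trans e1 _; apply: ler_div_sq1.
  - by apply: le_trans e3 _; apply: ler_div_sq1.
  - by apply: le_trans e4 _; rewrite -pE addn2; apply: ler_div_sq1.
  - apply: le_trans (H4 n k (ltnW Nn')) _.
    by have := pE Cl 1%N; rewrite addn1 expr1 => <-; apply: ler_div_sq1.
  - by apply: le_trans (H6 n k) _; apply: ler_div_sq1.
  - have := H7 n k; rewrite mul0r addr0 {1}/diff_coef expr0 mul1r => h.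
    by apply: le_trans h _; rewrite -[X in _ <= _ / X](expr1 (s n)); apply: ler_div_sq1.
  - exact: lb0.
  - have := lowd _; rewrite prednK // => /(_ _) h.
    rewrite /p exprS.
    have -> : c * (s n * s n ^+ m)^-1 * s n = c / s n ^+ m.
      by field; rewrite !gt_eqF ?exprn_gt0.
    rewrite ler_pdivrMr ?exprn_gt0 // mulrC; apply: h.
    by clear -hn; lia.
have n3n : (n3 <= n)%N by clear -hn; lia.
have sbig := H9 n n3n.
have hB : Bc * p / s n <= A * p / 2.
  rewrite ler_pdivrMr //.
  have -> : A * p / 2 * s n = A / 2 * s n * p by field.
  rewrite ler_wpM2r ?(ltW p0) //.
  move: sbig; rewrite ler_pdivrMr //; lra.
rewrite -/p; have -> : A / (2 * v2 * Cl ^+ 2) * p = A * p / 2 / (v2 * Cl ^+ 2).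
  by field; rewrite !gt_eqF.
rewrite ler_pdivrMr ?mulr_gt0 ?exprn_gt0 // [leRHS]mulrC.
by apply: le_trans low; lra.
Qed.

End Cone.

(** * From random walks to powers of polynomials *)

Section Bridge.
Notation RR := Rdefinitions.R.

Lemma sum_f_R0E (F : nat -> RR) n :
  Rfunctions.sum_f_R0 F n = \sum_(j < n.+1) F j.
Proof.
elim: n => [|n IH]; first by rewrite big_ord1.
by rewrite big_ord_recr /= -IH.
Qed.

Lemma rtE n : rt n = sq1 RR n.
Proof. by rewrite /rt RsqrtE INRE. Qed.

Lemma walk_stepE d (w g : nat -> RR) (p q : {poly RR}) k :
  (size p <= d.+1)%N -> (forall j, (j <= d)%N -> p`_j = w j) ->
  (forall i, q`_i = g i) -> walk_step d w g k = (p * q)`_k.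
Proof.
move=> sp pw qg; rewrite /walk_step sum_f_R0E (coef_mul_sum _ _ sp).
apply: eq_bigr => j _; rewrite coefXnM pw ?leq_ord //.
have -> : PeanoNat.Nat.leb j k = (j <= k)%N.
  by apply/PeanoNat.Nat.leb_spec0/idP => /ssrnat.leP.
by rewrite ltnNge; case: leqP => _ /=; rewrite ?mulr0 ?qg.
Qed.

Theorem walk_window_estimates d N (w : nat -> RR) b f :
  walk_data d N w b f ->
  exists m good c C n1, [/\ Rdefinitions.Rlt 0 c, Rdefinitions.Rlt 0 C &
    window_estimates d N b f m good c C n1].
Proof.
case=> /ssrnat.leP d1 wpos wsum b0 bS fS fN fsum [k0 fnz].
pose p := \poly_(j < d.+1) w j : {poly RR}.
have sp : (size p <= d.+1)%N by apply: size_poly.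
have pj j : (j <= d)%N -> p`_j = w j by move=> jd; rewrite coef_poly ltnS jd.
have p_ge0 j : 0 <= p`_j.
  rewrite coef_poly; case: ltnP => // jd; apply/ltW/RltP/wpos; exact/ssrnat.leP.
have p1 : p.[1] = 1.
  rewrite (horner_coef_wide _ sp) -[RHS]wsum sum_f_R0E.
  by apply: eq_bigr => j _; rewrite expr1n mulr1 pj ?leq_ord.
have p0_gt0 : 0 < p`_0 by rewrite pj //; apply/RltP/wpos/ssrnat.leP.
have p1_gt0 : 0 < p`_1 by rewrite pj //; apply/RltP/wpos/ssrnat.leP.
have bE n k : b n k = (p ^+ n)`_k.
  elim: n k => [|n IH] k.
    by rewrite b0 expr0 coef1; case: k.
  by rewrite bS exprS; apply: walk_stepE => // i; rewrite IH.
pose Gam := \poly_(k < (N * d).+1) f N k : {poly RR}.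
have GamE k : Gam`_k = f N k.
  by rewrite coef_poly; case: ltnP => // h; rewrite fN //; apply/ssrnat.ltP.
have fE n k : (N <= n)%N -> f n k = (Gam * p ^+ (n - N))`_k.
  move=> /subnK <-; rewrite addnK; elim: (n - N)%N k => [|j IH] k.
    by rewrite add0n expr0 mulr1 GamE.
  rewrite addSn fS; last by apply/ssrnat.leP; rewrite leq_addl.
  rewrite exprS mulrCA; apply: walk_stepE => // i; by rewrite -IH.
have Gam0 : Gam != 0.
  by apply/eqP => h; apply: fnz; rewrite -GamE h coef0.
have Gam1 : Gam.[1] = 0.
  rewrite (horner_coef_wide _ (size_poly _ _)) -[RHS]fsum sum_f_R0E.
  by apply: eq_bigr => j _; rewrite expr1n mulr1 GamE.
(* The full multiplicity of the root 1 is removed, so the cofactor does not vanish there; the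
   multiplicity is positive because the coefficients of [Gam] sum to 0. *)
have [m [G' nroot GE]] := multiplicity_XsubC Gam 1.
rewrite Gam0 /= in nroot.
have m0 : (0 < m)%N.
  rewrite lt0n; apply/eqP => m0; move: nroot; rewrite -(mulr1 G').
  by rewrite (_ : G' * 1 = Gam) ?/root ?Gam1 ?eqxx // GE m0 expr0.
pose G := G' * ((-1) ^+ m)%:P.
have GE' : Gam = G * (1 - 'X) ^+ m.
  rewrite GE /G -mulrA polyC_exp -exprMn; congr (_ * _ ^+ _).
  by rewrite !polyCN !polyC1; ring.
have G1 : G.[1] != 0.
  by rewrite /G hornerM hornerC mulf_neq0 ?signr_eq0.
have fE' n k : (N <= n)%N -> f n k = (G * ((1 - 'X) ^+ m * p ^+ (n - N)))`_k.
  by move=> h; rewrite fE // GE' mulrA.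
have [c1 [C1 [c10 C10 [n1 H1]]]] := cone_bounds p_ge0 p1 p0_gt0 p1_gt0 N sp G1 m0.
have [c2 [C2 [c20 C20 [n2 H2]]]] := cone_incr p_ge0 p1 p0_gt0 p1_gt0 N sp G1 m0.
pose c := Num.min c1 c2; pose C := Num.max C1 C2.
have cc1 : c <= c1 by rewrite ge_min lexx.
have cc2 : c <= c2 by rewrite ge_min lexx orbT.
have CC1 : C1 <= C by rewrite le_max lexx.
have CC2 : C2 <= C by rewrite le_max lexx orbT.
exists m, (in_window p d m), c, C, (n1 + n2 + 2)%N; split.
- by apply/RltP; rewrite lt_min c10 c20.
- by apply/RltP; apply: lt_le_trans CC1.
split.
  move=> n _; have [k1 h] := window_run p_ge0 p1 p0_gt0 p1_gt0 m sp n.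
  by exists k1 => i /ssrnat.leP hi; apply: h.
move=> n k /ssrnat.leP hn win.
have h1 : (n1 <= n)%N by clear -hn; lia.
have h2 : (n2 <= n)%N by clear -hn; lia.
have {}H1 := H1 n k h1 win.
have [{}H2 H3] := H2 n k h2 win.
have s0 := sq1_gt0 RR n.
have fb l i : (N <= l)%N -> Rdefinitions.Rdiv (f l i) (b l i) =
    ratio p N m G l i.
  by move=> h; rewrite /Rdefinitions.Rdiv RinvE fE' // bE.
split; last split.
- move=> l i /ssrnat.leP ll /ssrnat.leP il.
  have [e1 e2 e3 e4] := H1 l i ll il.
  rewrite bE rtE; split; [exact/ssrnat.leP|split; first exact/ssrnat.ltP].
  rewrite /Rdefinitions.Rdiv RinvE; split; apply/RleP.
    by apply: le_trans e3; rewrite ler_wpM2r // invr_ge0 ltW.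
  by apply: le_trans e4 _; rewrite ler_wpM2r // invr_ge0 ltW.
- move=> l i j /ssrnat.leP ll /ssrnat.leP il /ssrnat.leP jd.
  have e := H2 l i j ll il jd.
  have ijl : (i + j <= d * l.+1)%N by rewrite mulnS addnC leq_add.
  have [_ e2 _ _] := H1 l.+1 (i + j)%N ll ijl.
  have nl1 : (N <= n - l.+1)%N by clear -e2; lia.
  have nl2 : (N <= n - l)%N by clear -e2; lia.
  rewrite !fb // rtE RpowE /Rdefinitions.Rdiv RinvE; apply/RleP.
  rewrite RabsE.
  by apply: le_trans e _; rewrite ler_wpM2r // invr_ge0 exprn_ge0 // ltW.
- have e2 : (1 * 1 <= n)%N by clear -hn; lia.
  have [_ e3 _ _] := H1 1%N 0%N e2 (leq0n _).
  have nl1 : (N <= n.-1)%N by clear -e3; lia.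
  have nl2 : (N <= n)%N by clear -e3; lia.
  have -> : PeanoNat.Nat.sub n 1 = n.-1 by rewrite -subn1.
  rewrite !fb // rtE RpowE /Rdefinitions.Rdiv RinvE; apply/RleP.
  rewrite RabsE.
  by apply: le_trans H3; rewrite ler_wpM2r // invr_ge0 exprn_ge0 // ltW.
Qed.
End Bridge.

End LocalLimit.

(** * Sums over lists *)

Definition lsum {A : Type} (l : list A) (F : A -> R) : R :=
  fold_right Rplus 0 (map F l).

Lemma lsum_cons {A} (x : A) l F : lsum (x :: l) F = F x + lsum l F.
Proof. reflexivity. Qed.

Lemma lsum_app {A} (l l' : list A) F : lsum (l ++ l') F = lsum l F + lsum l' F.
Proof.
  induction l as [|x l IH]; simpl; [unfold lsum; simpl; lra|].
  rewrite !lsum_cons, IH; lra.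
Qed.

Lemma lsum_ext {A} (l : list A) F G :
  (forall x, In x l -> F x = G x) -> lsum l F = lsum l G.
Proof.
  intros h; unfold lsum; f_equal; apply map_ext_in; exact h.
Qed.

Lemma lsum_plus {A} (l : list A) F G :
  lsum l (fun x => F x + G x) = lsum l F + lsum l G.
Proof. induction l; [unfold lsum; simpl; lra|]. rewrite !lsum_cons, IHl; lra. Qed.

Lemma lsum_scal {A} (l : list A) c F : lsum l (fun x => c * F x) = c * lsum l F.
Proof. induction l; [unfold lsum; simpl; lra|]. rewrite !lsum_cons, IHl; lra. Qed.

Lemma lsum_zero {A} (l : list A) : lsum l (fun _ => 0) = 0.
Proof. induction l; [reflexivity|]. rewrite lsum_cons, IHl; lra. Qed.

Lemma lsum_le {A} (l : list A) F G :
  (forall x, In x l -> F x <= G x) -> lsum l F <= lsum l G.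
Proof.
  induction l as [|x l IH]; intros h; [unfold lsum; simpl; lra|].
  rewrite !lsum_cons; apply Rplus_le_compat; [apply h; now left|].
  apply IH; intros; apply h; now right.
Qed.

Lemma lsum_nonneg {A} (l : list A) F :
  (forall x, In x l -> 0 <= F x) -> 0 <= lsum l F.
Proof. intros h; rewrite <- (lsum_zero l); now apply lsum_le. Qed.

Lemma lsum_abs {A} (l : list A) F : Rabs (lsum l F) <= lsum l (fun x => Rabs (F x)).
Proof.
  induction l; [unfold lsum; simpl; rewrite Rabs_R0; lra|].
  rewrite !lsum_cons; eapply Rle_trans; [apply Rabs_triang|lra].
Qed.

Lemma lsum_flat_map {A B} (l : list A) (f : A -> list B) F :
  lsum (flat_map f l) F = lsum l (fun x => lsum (f x) F).
Proof.
  induction l; [reflexivity|]. simpl; rewrite lsum_app, lsum_cons, IHl; lra.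
Qed.

Lemma lsum_map {A B} (l : list A) (f : A -> B) F :
  lsum (map f l) F = lsum l (fun x => F (f x)).
Proof. unfold lsum; rewrite map_map; reflexivity. Qed.

Lemma lsum_filter {A} (l : list A) p F :
  lsum (filter p l) F = lsum l (fun x => if p x then F x else 0).
Proof.
  induction l as [|x l IH]; [reflexivity|]; simpl; rewrite lsum_cons.
  destruct (p x); [rewrite lsum_cons|]; rewrite IH; lra.
Qed.

Lemma lsum_swap {A B} (l : list A) (l' : list B) F :
  lsum l (fun x => lsum l' (F x)) = lsum l' (fun z => lsum l (fun x => F x z)).
Proof.
  induction l; [symmetry; apply lsum_zero|].
  rewrite lsum_cons, IHl, <- lsum_plus; reflexivity.
Qed.

Lemma lsum_perm {A} (l l' : list A) F : Permutation l l' -> lsum l F = lsum l' F.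
Proof. induction 1; rewrite ?lsum_cons; lra. Qed.

Lemma lsum_one {A} (l : list A) : lsum l (fun _ => 1) = INR (length l).
Proof.
  induction l; [reflexivity|]. rewrite lsum_cons, IHl.
  change (length (a :: l)) with (S (length l)); rewrite S_INR; lra.
Qed.

Lemma lsum_single {A} (l : list A) (p : A -> bool) x F :
  NoDup l -> In x l -> (forall z, In z l -> (p z = true <-> z = x)) ->
  lsum l (fun z => if p z then F z else 0) = F x.
Proof.
  intros hn hx; induction hn as [|z l hz hn IH]; intros hp; [destruct hx|].
  rewrite lsum_cons; destruct hx as [->|hx].
  - rewrite (proj2 (hp x (or_introl eq_refl)) eq_refl).
    rewrite (lsum_ext l _ (fun _ => 0)), lsum_zero; [lra|].
    intros y hy; destruct (p y) eqn:E; [|reflexivity].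
    apply hp in E; [subst; contradiction|now right].
  - rewrite (IH hx) by (intros y hy; apply hp; now right).
    destruct (p z) eqn:E; [|lra].
    apply hp in E; [subst; contradiction|now left].
Qed.

Lemma lsum_ge_in {A} (l : list A) F x :
  In x l -> (forall z, In z l -> 0 <= F z) -> F x <= lsum l F.
Proof.
  intros hx h0; destruct (in_split _ _ hx) as (l1 & l2 & ->).
  rewrite lsum_app, lsum_cons.
  assert (0 <= lsum l1 F) by (apply lsum_nonneg; intros; apply h0; apply in_or_app; now left).
  assert (0 <= lsum l2 F)
    by (apply lsum_nonneg; intros; apply h0; apply in_or_app; right; now right).
  lra.
Qed.

(** * Towers *)

Section Towers.
Variables (d : nat) (a : nat -> nat).
Hypothesis Ha : forall j, (j <= d)%nat -> (1 <= a j)%nat.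
Notation labs := (labels d a).
Notation AP := (all_paths d a).

Lemma labels_valid e : In e labs <-> valid_label d a e.
Proof.
  unfold labels, valid_label; rewrite in_flat_map; split.
  - intros (j & hj & he); apply in_map_iff in he; destruct he as (m & <- & hm).
    apply in_seq in hj; apply in_seq in hm; simpl; lia.
  - destruct e as [j m]; cbn [fst snd]; intros [h1 h2]; exists j; split; [apply in_seq; lia|].
    apply in_map_iff; exists m; split; [reflexivity|apply in_seq; lia].
Qed.

Lemma all_paths_valid n c :
  In c (AP n) <-> length c = n /\ Forall (valid_label d a) c.
Proof.
  revert c; induction n as [|n IH]; intros c; simpl.
  - split; [intros [<-|[]]; split; auto|intros [h _]; left].
    symmetry; now apply length_zero_iff_nil.
  - rewrite in_flat_map; split.
    + intros (c' & hc & he); apply in_map_iff in he; destruct he as (e & <- & he).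
      apply IH in hc; destruct hc as [h1 h2].
      rewrite length_app; simpl; split; [lia|].
      apply Forall_app; split; [exact h2|constructor; [now apply labels_valid|constructor]].
    + intros [h1 h2]; destruct (exists_last (l := c)) as (c' & e & ->).
      { intros ->; simpl in h1; lia. }
      rewrite length_app in h1; simpl in h1.
      apply Forall_app in h2; destruct h2 as [h2 h3]; inversion h3; subst.
      exists c'; split; [apply IH; split; [lia|exact h2]|].
      apply in_map_iff; exists e; split; [reflexivity|now apply labels_valid].
Qed.

Lemma lsum_all_paths_S n F :
  lsum (AP (S n)) F = lsum (AP n) (fun c => lsum labs (fun e => F (c ++ [e]))).
Proof.
  simpl; rewrite lsum_flat_map; apply lsum_ext; intros c _; apply lsum_map.
Qed.

Lemma endk_app c c' : endk (c ++ c') = (endk c + endk c')%nat.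
Proof.
  unfold endk; induction c as [|e c IH]; [reflexivity|].
  cbn [app map fold_right]; rewrite IH; lia.
Qed.

Definition psum n k (F : list label -> R) : R := lsum (paths_to d a n k) F.

Lemma psumE n k F :
  psum n k F = lsum (AP n) (fun c => if Nat.eqb (endk c) k then F c else 0).
Proof. apply lsum_filter. Qed.

Lemma paths_to_in n k c : In c (paths_to d a n k) <-> In c (AP n) /\ endk c = k.
Proof.
  unfold paths_to; rewrite filter_In, Nat.eqb_eq; reflexivity.
Qed.

(** Value of [X] at the source of the edge [e] entering column [k], and 0 if the source column would
    be negative. *)
Definition child (k : nat) (X : nat -> R) (e : label) : R :=
  if (fst e <=? k)%nat then X (k - fst e)%nat else 0.

Lemma psum_S n k F :
  psum (S n) k F =
  lsum labs (fun e => child k (fun k' => psum n k' (fun c => F (c ++ [e]))) e).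
Proof.
  rewrite psumE, lsum_all_paths_S, lsum_swap; apply lsum_ext; intros e _.
  unfold child; destruct (fst e <=? k)%nat eqn:E.
  - apply Nat.leb_le in E; rewrite psumE; apply lsum_ext; intros c _.
    rewrite endk_app; unfold endk at 2; simpl; rewrite Nat.add_0_r.
    destruct (Nat.eqb_spec (endk c) (k - fst e)), (Nat.eqb_spec (endk c + fst e) k);
      try reflexivity; lia.
  - apply Nat.leb_gt in E; transitivity (lsum (AP n) (fun _ => 0)); [|apply lsum_zero].
    apply lsum_ext; intros c _.
    rewrite endk_app; unfold endk at 2; simpl; rewrite Nat.add_0_r.
    destruct (Nat.eqb_spec (endk c + fst e) k); [lia|reflexivity].
Qed.

Definition label_eqb (e e' : label) : bool :=
  Nat.eqb (fst e) (fst e') && Nat.eqb (snd e) (snd e').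

Lemma label_eqb_eq e e' : label_eqb e e' = true <-> e = e'.
Proof.
  unfold label_eqb; rewrite andb_true_iff, !Nat.eqb_eq; destruct e, e'; simpl.
  split; [intros [-> ->]; reflexivity|intros [= -> ->]; auto].
Qed.

Lemma edge_precb_spec e e' : edge_precb e e' = true <-> edge_prec e e'.
Proof.
  unfold edge_precb, edge_prec.
  rewrite orb_true_iff, andb_true_iff, Nat.eqb_eq, !Nat.ltb_lt; reflexivity.
Qed.

Lemma edge_prec_irrefl e : ~ edge_prec e e.
Proof. unfold edge_prec; lia. Qed.

Lemma edge_prec_trans e1 e2 e3 : edge_prec e1 e2 -> edge_prec e2 e3 -> edge_prec e1 e3.
Proof. unfold edge_prec; lia. Qed.

Lemma edge_prec_total e e' : e <> e' -> edge_prec e e' \/ edge_prec e' e.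
Proof.
  unfold edge_prec; destruct e as [j m], e' as [j' m']; simpl; intros h.
  destruct (Nat.eq_dec j j') as [->|]; [|lia].
  destruct (Nat.eq_dec m m') as [->|]; [contradiction|lia].
Qed.

Lemma fpath_lt_snoc c e c' e' :
  fpath_lt (c ++ [e]) (c' ++ [e']) =
  if label_eqb e e' then fpath_lt c c' else edge_precb e e'.
Proof. unfold fpath_lt; rewrite !rev_app_distr; reflexivity. Qed.

Lemma NoDup_labels : NoDup labs.
Proof.
  unfold labels.
  enough (h : forall n i, NoDup (flat_map (fun j => map (fun m => (j, m)) (seq 0 (a j)))
    (seq i n))) by apply h.
  intros n; induction n as [|n IH]; intros i; simpl; [constructor|].
  apply NoDup_app; [|apply IH|].
  - apply FinFun.Injective_map_NoDup; [|apply seq_NoDup].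
    intros x z [= ->]; reflexivity.
  - intros e h1 h2; apply in_map_iff in h1; destruct h1 as (m & <- & _).
    apply in_flat_map in h2; destruct h2 as (j & hj & he).
    apply in_map_iff in he; destruct he as (m' & [= -> _] & _).
    apply in_seq in hj; lia.
Qed.

Lemma Hnk_psum n k : Hnk d a n k = psum n k (fun _ => 1).
Proof. unfold Hnk, psum; now rewrite lsum_one. Qed.

Lemma Hnk_nonneg n k : 0 <= Hnk d a n k.
Proof. apply pos_INR. Qed.

Lemma Hnk_S n k : Hnk d a (S n) k = lsum labs (child k (Hnk d a n)).
Proof.
  rewrite Hnk_psum, psum_S; apply lsum_ext; intros e _; unfold child.
  now rewrite Hnk_psum.
Qed.

Lemma frank_psum c : INR (frank d a c) =
  psum (length c) (endk c) (fun c' => if fpath_lt c' c then 1 else 0).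
Proof.
  unfold frank; rewrite <- lsum_one; unfold psum.
  rewrite lsum_filter; reflexivity.
Qed.

(** Position in the tower of (n + 1, k) at which the block of paths ending with [e] begins. *)
Definition offset n k e : R :=
  lsum labs (fun e' => if edge_precb e' e then child k (Hnk d a n) e' else 0).

(** The order looks at the last edge first: paths with an earlier last edge come before, and those
    with the same last edge are ranked by what precedes it. *)
Lemma frank_snoc c e : In e labs ->
  INR (frank d a (c ++ [e])) =
  offset (length c) (endk c + fst e) e + INR (frank d a c).
Proof.
  intros he; rewrite frank_psum, length_app, endk_app.
  unfold endk at 2; simpl; rewrite Nat.add_1_r, Nat.add_0_r, psum_S.
  set (k := (endk c + fst e)%nat); set (n := length c).
  unfold offset.
  transitivity (lsum labs (fun e' =>
     (if edge_precb e' e then child k (Hnk d a n) e' else 0) +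
     (if label_eqb e' e then child k (fun k' => psum n k'
         (fun c' => if fpath_lt c' c then 1 else 0)) e' else 0))).
  - apply lsum_ext; intros e' _; unfold child.
    destruct (fst e' <=? k)%nat.
    + destruct (label_eqb e' e) eqn:E.
      * apply label_eqb_eq in E; subst e'.
        destruct (edge_precb e e) eqn:E2.
        { apply edge_precb_spec, edge_prec_irrefl in E2; contradiction. }
        rewrite Rplus_0_l; apply lsum_ext; intros c' _.
        now rewrite fpath_lt_snoc, (proj2 (label_eqb_eq e e) eq_refl).
      * rewrite Rplus_0_r.
        transitivity (psum n (k - fst e') (fun _ => if edge_precb e' e then 1 else 0)).
        { apply lsum_ext; intros c' _; now rewrite fpath_lt_snoc, E. }
        destruct (edge_precb e' e); [symmetry; apply Hnk_psum|apply lsum_zero].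
    + destruct (edge_precb e' e), (label_eqb e' e); lra.
  - rewrite lsum_plus; f_equal.
    rewrite (lsum_single labs _ e); [|apply NoDup_labels|exact he|].
    + unfold child, k; rewrite (proj2 (Nat.leb_le _ _)) by lia.
      replace (endk c + fst e - fst e)%nat with (endk c) by lia.
      now rewrite frank_psum.
    + intros z _; apply label_eqb_eq.
Qed.

Lemma ext_in_X n c : In c (AP n) -> in_X d a (ext c).
Proof.
  intros hc i; apply all_paths_valid in hc; destruct hc as [_ hc]; unfold ext.
  destruct (Nat.lt_ge_cases i (length c)) as [h|h].
  - rewrite Forall_forall in hc; apply hc, nth_In, h.
  - rewrite nth_overflow by exact h; split; simpl; [lia|]; apply Ha; lia.
Qed.

Variables (g : path -> R) (N : nat).
Hypothesis Hg : cylindric d a N g.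

Definition Tg n k : R := psum n k (fun c => g (ext c)).

Lemma g_snoc n c e : (N <= n)%nat -> In c (AP n) -> In e labs ->
  g (ext (c ++ [e])) = g (ext c).
Proof.
  intros hn hc he; apply Hg.
  - apply (ext_in_X (S n)); simpl; apply in_flat_map; exists c; split; [exact hc|].
    apply in_map_iff; now exists e.
  - now apply (ext_in_X n).
  - intros i hi; unfold ext; apply app_nth1.
    apply all_paths_valid in hc; lia.
Qed.

Lemma Tg_S n k : (N <= n)%nat -> Tg (S n) k = lsum labs (child k (Tg n)).
Proof.
  intros hn; unfold Tg; rewrite psum_S; apply lsum_ext; intros e he; unfold child.
  destruct (fst e <=? k)%nat; [|reflexivity].
  apply lsum_ext; intros c hc; apply paths_to_in in hc; destruct hc as [hc _].
  now apply (g_snoc n).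
Qed.

(** The tower of (n + 1, k) stacks towers of level n, and [g] keeps its values there because it is
    determined by the first [N] edges. *)
Lemma Fg_S n k s : (N <= n)%nat ->
  Fg d a g (S n) k s =
  lsum labs (fun e => child k (fun k' => Fg d a g n k' (s - offset n k e)) e).
Proof.
  intros hn; unfold Fg at 1.
  change (psum (S n) k (fun c => g (ext c) * clamp01 (s - INR (frank d a c))) =
    lsum labs (fun e => child k (fun k' => Fg d a g n k' (s - offset n k e)) e)).
  rewrite psum_S; apply lsum_ext; intros e he; unfold child.
  destruct (Nat.leb_spec (fst e) k) as [hk|hk]; [|reflexivity].
  apply lsum_ext; intros c hc; apply paths_to_in in hc; destruct hc as [hc hk'].
  rewrite (g_snoc n) by assumption; rewrite frank_snoc by assumption.
  pose proof (proj1 (all_paths_valid n c) hc) as [hl _].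
  rewrite hl, hk'; replace (k - fst e + fst e)%nat with k by lia.
  f_equal; f_equal; lra.
Qed.

Lemma clamp01_nonpos u : u <= 0 -> clamp01 u = 0.
Proof. intros h; unfold clamp01; rewrite Rmax_left, Rmin_right; lra. Qed.

Lemma clamp01_ge1 u : 1 <= u -> clamp01 u = 1.
Proof. intros h; unfold clamp01; rewrite Rmax_right, Rmin_left; lra. Qed.

Lemma clamp01_bounds u : 0 <= clamp01 u <= 1.
Proof.
  unfold clamp01, Rmin, Rmax; destruct (Rle_dec 0 u), (Rle_dec 1 _); lra.
Qed.

Lemma clamp01_lip u v : Rabs (clamp01 u - clamp01 v) <= Rabs (u - v).
Proof.
  unfold clamp01, Rmin, Rmax; repeat destruct (Rle_dec _ _);
  unfold Rabs; repeat destruct (Rcase_abs _); lra.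
Qed.

Lemma fpath_lt_irrefl c : fpath_lt c c = false.
Proof.
  unfold fpath_lt; induction (rev c) as [|e r IH]; [reflexivity|]; simpl.
  now rewrite !Nat.eqb_refl.
Qed.

Lemma frank_lt n k c : In c (paths_to d a n k) ->
  INR (frank d a c) + 1 <= Hnk d a n k.
Proof.
  intros hc; pose proof (proj1 (paths_to_in _ _ _) hc) as [h1 h2].
  pose proof (proj1 (all_paths_valid n c) h1) as [h3 _].
  rewrite frank_psum, h2, h3, Hnk_psum.
  assert (h : 1 <= psum n k (fun c' => 1 - if fpath_lt c' c then 1 else 0)).
  { eapply Rle_trans; [|apply (lsum_ge_in _ _ c hc)].
    - simpl; rewrite fpath_lt_irrefl; lra.
    - intros z _; destruct (fpath_lt z c); lra. }
  unfold psum, Rminus in *; rewrite lsum_plus in h.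
  rewrite (lsum_ext _ (fun x => - _) (fun x => (-1) * (if fpath_lt x c then 1 else 0))) in h
    by (intros; lra).
  rewrite lsum_scal in h; lra.
Qed.

Lemma Fg_nonpos n k s : s <= 0 -> Fg d a g n k s = 0.
Proof.
  intros hs; change (psum n k (fun c => g (ext c) * clamp01 (s - INR (frank d a c))) = 0).
  transitivity (lsum (paths_to d a n k) (fun _ => 0)); [|apply lsum_zero].
  apply lsum_ext; intros c _.
  rewrite clamp01_nonpos; [lra|]. pose proof (pos_INR (frank d a c)); lra.
Qed.

Lemma Fg_ge n k s : Hnk d a n k <= s -> Fg d a g n k s = Tg n k.
Proof.
  intros hs; apply lsum_ext; intros c hc.
  rewrite clamp01_ge1; [lra|]. pose proof (frank_lt n k c hc); lra.
Qed.

Lemma g_bounded : exists M, 0 <= M /\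
  forall n c, (N <= n)%nat -> In c (AP n) -> Rabs (g (ext c)) <= M.
Proof.
  exists (lsum (AP N) (fun c => Rabs (g (ext c)))); split.
  - apply lsum_nonneg; intros; apply Rabs_pos.
  - intros n c hn; revert c; induction hn as [|n hn IH]; intros c hc.
    + apply (lsum_ge_in _ (fun c => Rabs (g (ext c)))); [exact hc|].
      intros; apply Rabs_pos.
    + simpl in hc; apply in_flat_map in hc; destruct hc as (c' & h1 & h2).
      apply in_map_iff in h2; destruct h2 as (e & <- & he).
      rewrite (g_snoc n) by assumption; now apply IH.
Qed.

Lemma psum_bound n k F M : (forall c, In c (AP n) -> Rabs (F c) <= M) ->
  Rabs (psum n k F) <= M * Hnk d a n k.
Proof.
  intros h; unfold psum; eapply Rle_trans; [apply lsum_abs|].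
  rewrite Hnk_psum; unfold psum; rewrite <- lsum_scal; apply lsum_le.
  intros c hc; rewrite Rmult_1_r; apply h; now apply paths_to_in in hc.
Qed.

Lemma Fg_bound M n k s : (N <= n)%nat ->
  (forall n c, (N <= n)%nat -> In c (AP n) -> Rabs (g (ext c)) <= M) ->
  Rabs (Fg d a g n k s) <= M * Hnk d a n k.
Proof.
  intros hn hM; apply psum_bound; intros c hc.
  rewrite Rabs_mult; pose proof (clamp01_bounds (s - INR (frank d a c))) as h.
  rewrite (Rabs_pos_eq (clamp01 _)) by lra.
  pose proof (hM n c hn hc); pose proof (Rabs_pos (g (ext c))); nra.
Qed.

Lemma Fg_lip M n k s s' : (N <= n)%nat ->
  (forall n c, (N <= n)%nat -> In c (AP n) -> Rabs (g (ext c)) <= M) ->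
  Rabs (Fg d a g n k s - Fg d a g n k s') <= M * Hnk d a n k * Rabs (s - s').
Proof.
  intros hn hM.
  replace (Fg d a g n k s - Fg d a g n k s') with
   (psum n k (fun c => g (ext c) * (clamp01 (s - INR (frank d a c))
       - clamp01 (s' - INR (frank d a c))))).
  - replace (M * Hnk d a n k * Rabs (s - s')) with (M * Rabs (s - s') * Hnk d a n k) by ring.
    apply psum_bound; intros c hc; rewrite Rabs_mult.
    apply Rmult_le_compat; try apply Rabs_pos; [now apply (hM n)|].
    eapply Rle_trans; [apply clamp01_lip|]; apply Req_le; f_equal; lra.
  - unfold Fg, psum; fold (lsum (paths_to d a n k)).
    change (lsum (paths_to d a n k) (fun c => g (ext c) * (clamp01 (s - INR (frank d a c))
       - clamp01 (s' - INR (frank d a c)))) =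
      lsum (paths_to d a n k) (fun c => g (ext c) * clamp01 (s - INR (frank d a c))) -
      lsum (paths_to d a n k) (fun c => g (ext c) * clamp01 (s' - INR (frank d a c)))).
    generalize (paths_to d a n k); intros l; induction l as [|x l IH];
      [unfold lsum; simpl; lra|].
    rewrite !lsum_cons, IH; lra.
Qed.

End Towers.

(** * Concatenation of blocks *)

Section Concatenation.
Context {A : Type}.
Variables (h : A -> R) (phi : A -> R -> R).

(** Curves of blocks laid end to end, [h] being the lengths. The sum is a concatenation when each
    [phi x] vanishes before its block and is constant after it. *)
Fixpoint conc (l : list A) (s : R) : R :=
  match l with
  | [] => 0
  | x :: l' => phi x s + conc l' (s - h x)
  end.

(** In a sorted list the predecessors of an element are exactly those listed before it, so the
    offsets are cumulative lengths. *)
Lemma lsum_sorted_conc (prec : A -> A -> Prop) (precb : A -> A -> bool) l s :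
  (forall x z, precb x z = true <-> prec x z) ->
  (forall x, ~ prec x x) -> (forall x z, prec x z -> ~ prec z x) ->
  StronglySorted prec l ->
  lsum l (fun x => phi x (s - lsum l (fun z => if precb z x then h z else 0))) =
  conc l s.
Proof.
  intros hp hi has hs; revert s; induction hs as [|x l hs IH hx]; intros s; [reflexivity|].
  rewrite Forall_forall in hx.
  assert (hF : forall x z, ~ prec x z -> precb x z = false).
  { intros y z hyz; destruct (precb y z) eqn:E; [|reflexivity].
    now apply hp in E. }
  rewrite lsum_cons; simpl; f_equal.
  - f_equal; rewrite lsum_cons, hF by apply hi.
    rewrite (lsum_ext l _ (fun _ => 0)), lsum_zero; [lra|].
    intros z hz; rewrite hF; [reflexivity|]. now apply has, hx.
  - rewrite <- IH; apply lsum_ext; intros z hz; f_equal.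
    rewrite lsum_cons, (proj2 (hp x z)) by now apply hx. lra.
Qed.
End Concatenation.

Definition clip (H s : R) : R := Rmax 0 (Rmin s H).

Lemma clip_low H s : 0 <= H -> s <= 0 -> clip H s = 0.
Proof. intros; unfold clip; rewrite Rmin_left, Rmax_left; lra. Qed.

Lemma clip_high H s : 0 <= H -> H <= s -> clip H s = H.
Proof. intros; unfold clip; rewrite Rmin_right, Rmax_right; lra. Qed.

Lemma clip_mid H s : 0 <= s <= H -> clip H s = s.
Proof. intros; unfold clip; rewrite Rmin_left, Rmax_right; lra. Qed.

Lemma clip_lip H s s' : Rabs (clip H s - clip H s') <= Rabs (s - s').
Proof.
  unfold clip, Rmin, Rmax; repeat destruct (Rle_dec _ _);
  unfold Rabs; repeat destruct (Rcase_abs _); lra.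
Qed.

Lemma clip_add H H' s : 0 <= H -> 0 <= H' ->
  clip (H + H') s = clip H s + clip H' (s - H).
Proof.
  intros; unfold clip, Rmin, Rmax; repeat destruct (Rle_dec _ _); lra.
Qed.

(* Up to an error [eps], the deviation of [F] from slope [lam] is an
   [L]-Lipschitz function that is exact outside the block; exactness there makes
   the errors of concatenated blocks add up to their maximum, not to their sum. *)
Definition near_slope (F : R -> R) (H lam L eps : R) : Prop :=
  0 <= H /\ (forall s, s <= 0 -> F s = 0) /\ (forall s, H <= s -> F s = F H) /\
  exists ell : R -> R,
    (forall s s', Rabs (ell s - ell s') <= L * Rabs (s - s')) /\
    (forall s, s <= 0 \/ H <= s -> ell s = F s - lam * clip H s) /\
    (forall s, Rabs (F s - lam * clip H s - ell s) <= eps).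

Lemma lip_glue (f : R -> R) x L : 0 <= L ->
  (forall s s', s <= x -> s' <= x -> Rabs (f s - f s') <= L * Rabs (s - s')) ->
  (forall s s', x <= s -> x <= s' -> Rabs (f s - f s') <= L * Rabs (s - s')) ->
  forall s s', Rabs (f s - f s') <= L * Rabs (s - s').
Proof.
  intros hL h1 h2.
  assert (key : forall s s', s <= x -> x <= s' -> Rabs (f s - f s') <= L * Rabs (s - s')).
  { intros s s' hs hs'.
    replace (f s - f s') with ((f s - f x) + (f x - f s')) by lra.
    eapply Rle_trans; [apply Rabs_triang|].
    pose proof (h1 s x hs (Rle_refl x)) as e1; pose proof (h2 x s' (Rle_refl x) hs') as e2.
    rewrite (Rabs_left1 (s - x)) in e1 by lra; rewrite (Rabs_left1 (x - s')) in e2 by lra.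
    rewrite (Rabs_left1 (s - s')) by lra; lra. }
  intros s s'; destruct (Rle_lt_dec s x), (Rle_lt_dec s' x).
  - now apply h1.
  - apply key; lra.
  - rewrite Rabs_minus_sym, (Rabs_minus_sym s); apply key; lra.
  - apply h2; lra.
Qed.

Lemma near_slope_zero lam L eps : 0 <= L -> 0 <= eps ->
  near_slope (fun _ => 0) 0 lam L eps.
Proof.
  intros hL he; repeat split; try lra; exists (fun _ => 0).
  assert (hc : forall s, clip 0 s = 0).
  { intros s; destruct (Rle_lt_dec s 0); [apply clip_low|apply clip_high]; lra. }
  repeat split; intros.
  - rewrite Rminus_diag, Rabs_R0; pose proof (Rabs_pos (s - s')); nra.
  - rewrite hc; lra.
  - rewrite hc; replace (0 - lam * 0 - 0) with 0 by lra; now rewrite Rabs_R0.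
Qed.

(** At every point at most one block is active: left of [H1] the second is zero, right of [H1] the
    first is constant. Gluing at [H1], rather than adding Lipschitz bounds, therefore keeps both [L]
    and [eps]. *)
Lemma near_slope_app F1 H1 F2 H2 lam L eps : 0 <= L -> 0 <= eps ->
  near_slope F1 H1 lam L eps -> near_slope F2 H2 lam L eps ->
  near_slope (fun s => F1 s + F2 (s - H1)) (H1 + H2) lam L eps.
Proof.
  intros hL he (h1 & z1 & c1 & l1 & lip1 & ex1 & er1) (h2 & z2 & c2 & l2 & lip2 & ex2 & er2).
  split; [lra|]. split; [|split].
  - intros s hs; rewrite z1, z2; lra.
  - intros s hs; rewrite (c1 s), (c1 (H1 + H2)), (c2 (s - H1)) by lra.
    f_equal; f_equal; lra.
  - exists (fun s => l1 s + l2 (s - H1)).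
    assert (e1 : forall s, H1 <= s -> l1 s = F1 H1 - lam * H1).
    { intros s hs; rewrite ex1 by lra; rewrite (c1 s) by lra.
      now rewrite clip_high. }
    assert (e2 : forall s, s <= 0 -> l2 s = 0).
    { intros s hs; rewrite ex2 by lra; rewrite z2 by lra; rewrite clip_low by lra; lra. }
    split; [|split].
    + apply (lip_glue _ H1); [exact hL| |]; intros s s' hs hs'.
      * rewrite !e2 by lra.
        replace (l1 s + 0 - (l1 s' + 0)) with (l1 s - l1 s') by lra; apply lip1.
      * rewrite !e1 by lra.
        replace (F1 H1 - lam * H1 + l2 (s - H1) - (F1 H1 - lam * H1 + l2 (s' - H1)))
          with (l2 (s - H1) - l2 (s' - H1)) by lra.
        eapply Rle_trans; [apply lip2|]; apply Req_le; f_equal; f_equal; lra.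
    + intros s hs; rewrite clip_add by lra; destruct hs.
      * rewrite ex1, ex2 by lra; lra.
      * rewrite ex1, ex2 by lra; lra.
    + intros s; rewrite clip_add by lra; destruct (Rle_lt_dec s H1).
      * rewrite (e2 (s - H1)), (z2 (s - H1)), (clip_low H2) by lra.
        replace (F1 s + 0 - lam * (clip H1 s + 0) - (l1 s + 0))
          with (F1 s - lam * clip H1 s - l1 s) by lra; apply er1.
      * rewrite (e1 s), (c1 s), (clip_high H1) by lra.
        replace (F1 H1 + F2 (s - H1) - lam * (H1 + clip H2 (s - H1)) -
            (F1 H1 - lam * H1 + l2 (s - H1)))
          with (F2 (s - H1) - lam * clip H2 (s - H1) - l2 (s - H1)) by lra; apply er2.
Qed.

Lemma near_slope_conc {A} (h : A -> R) phi (l : list A) lam L eps :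
  0 <= L -> 0 <= eps ->
  (forall x, In x l -> near_slope (phi x) (h x) lam L eps) ->
  near_slope (conc h phi l) (lsum l h) lam L eps.
Proof.
  intros hL he; induction l as [|x l IH]; intros hx; simpl.
  - now apply near_slope_zero.
  - rewrite lsum_cons; apply near_slope_app; auto with datatypes.
Qed.

Lemma near_slope_block F H lam L eps :
  0 < H -> 0 <= eps -> (forall s, s <= 0 -> F s = 0) -> (forall s, H <= s -> F s = F H) ->
  Rabs (F H / H - lam) <= L ->
  (forall s, 0 <= s <= H -> Rabs (F s - F H / H * s) <= eps) ->
  near_slope F H lam L eps.
Proof.
  intros hH he z c hL hF; split; [lra|]. split; [exact z|]. split; [exact c|].
  (* Measured against slope [lam], the chord of the block is a line whose slope is the difference of
     the two. *)
  exists (fun s => (F H / H - lam) * clip H s); split; [|split].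
  - intros s s'; rewrite <- Rmult_minus_distr_l, Rabs_mult.
    apply Rmult_le_compat; try apply Rabs_pos; [exact hL|apply clip_lip].
  - intros s [hs|hs].
    + rewrite (z s), clip_low by lra; lra.
    + rewrite (c s), clip_high by lra; field; lra.
  - intros s; destruct (Rle_lt_dec s 0); [|destruct (Rle_lt_dec H s)].
    + rewrite (z s), clip_low by lra.
      replace (0 - lam * 0 - (F H / H - lam) * 0) with 0 by lra; now rewrite Rabs_R0.
    + rewrite (c s), clip_high by lra.
      replace (F H - lam * H - (F H / H - lam) * H) with 0 by (field; lra).
      now rewrite Rabs_R0.
    + rewrite clip_mid by lra.
      replace (F s - lam * s - (F H / H - lam) * s) with (F s - F H / H * s) by lra.
      apply hF; lra.
Qed.

Lemma near_slope_deviation F H lam L eps : near_slope F H lam L eps ->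
  forall s, 0 <= s <= H -> Rabs (F s - lam * s) <= L * H + eps.
Proof.
  intros (hH & z & c & ell & lip & ex & er) s hs.
  pose proof (er s) as e1; pose proof (lip s 0) as e2.
  rewrite (ex 0), z, clip_low in e2 by lra; rewrite clip_mid in e1 by lra.
  rewrite Rminus_0_r, (Rabs_pos_eq s) in e2 by lra.
  replace (ell s - (0 - lam * 0)) with (ell s) in e2 by lra.
  replace (F s - lam * s) with (ell s + (F s - lam * s - ell s)) by lra.
  eapply Rle_trans; [apply Rabs_triang|].
  assert (0 <= L). {
    pose proof (lip 1 0) as e; pose proof (Rabs_pos (ell 1 - ell 0)).
    replace (1 - 0) with 1 in e by lra; rewrite Rabs_R1 in e; lra. }
  nra.
Qed.

Lemma near_slope_modulus F H lam L eps : near_slope F H lam L eps ->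
  forall s s', 0 <= s <= H -> 0 <= s' <= H ->
  Rabs ((F s - lam * s) - (F s' - lam * s')) <= L * Rabs (s - s') + 2 * eps.
Proof.
  intros (hH & z & c & ell & lip & ex & er) s s' hs hs'.
  pose proof (er s) as e1; pose proof (er s') as e2; pose proof (lip s s') as e3.
  rewrite clip_mid in e1, e2 by lra.
  replace ((F s - lam * s) - (F s' - lam * s')) with
    ((ell s - ell s') + ((F s - lam * s - ell s) + - (F s' - lam * s' - ell s'))) by lra.
  eapply Rle_trans; [apply Rabs_triang|]. apply Rplus_le_compat; [exact e3|].
  eapply Rle_trans; [apply Rabs_triang|]. rewrite Rabs_Ropp; lra.
Qed.

(** * Deviations over the cone below a vertex *)

Section Cone.
Variables (d : nat) (a : nat -> nat).
Hypothesis Ha : forall j, (j <= d)%nat -> (1 <= a j)%nat.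
Variables (g : path -> R) (N : nat).
Hypothesis Hg : cylindric d a N g.
Notation H := (Hnk d a).
Notation T := (Tg d a g).
Notation F := (Fg d a g).

(** [labels] lists the types increasingly, the canonical order decreasingly; here the edges appear
    as their blocks are stacked. *)
Definition sorted_labels : list label :=
  flat_map (fun j => map (fun m => (j, m)) (seq 0 (a j))) (rev (seq 0 (S d))).

Lemma labels_perm : Permutation (labels d a) sorted_labels.
Proof. unfold labels, sorted_labels; apply Permutation_flat_map, Permutation_rev. Qed.

Lemma StronglySorted_app {A} (r : A -> A -> Prop) l l' :
  StronglySorted r l -> StronglySorted r l' ->
  (forall x z, In x l -> In z l' -> r x z) -> StronglySorted r (l ++ l').
Proof.
  intros h h' hr; induction h as [|x l h IH hx]; simpl; [exact h'|].
  constructor; [apply IH; intros; apply hr; [now right|assumption]|].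
  apply Forall_app; split; [exact hx|].
  apply Forall_forall; intros z hz; apply hr; [now left|exact hz].
Qed.

Lemma sorted_labels_sorted : StronglySorted edge_prec sorted_labels.
Proof.
  unfold sorted_labels; generalize (S d); intros n; induction n as [|n IH].
  - constructor.
  - rewrite seq_S, rev_app_distr; simpl; apply StronglySorted_app; [|exact IH|].
    + generalize (a n) as p; intros p; generalize 0%nat as i; induction p as [|p IHp]; intros i; simpl.
      * constructor.
      * constructor; [apply IHp|]. apply Forall_forall; intros e he.
        apply in_map_iff in he; destruct he as (m & <- & hm); apply in_seq in hm.
        right; simpl; lia.
    + intros x z hx hz; apply in_map_iff in hx; destruct hx as (m & <- & _).
      apply in_flat_map in hz; destruct hz as (j & hj & hz).
      apply in_map_iff in hz; destruct hz as (m' & <- & _).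
      apply in_rev, in_seq in hj; left; simpl; lia.
Qed.

Lemma sorted_labels_head : exists l, sorted_labels = (d, 0%nat) :: l.
Proof.
  unfold sorted_labels; rewrite seq_S, rev_app_distr; simpl.
  specialize (Ha d (le_n d)); destruct (a d) as [|p]; [lia|].
  simpl; eexists; reflexivity.
Qed.

Lemma Fg_conc n k s : (N <= n)%nat ->
  F (S n) k s = conc (child k (H n)) (fun e s => child k (fun k' => F n k' s) e)
    sorted_labels s.
Proof.
  intros hn; rewrite (Fg_S d a Ha g N Hg) by exact hn.
  rewrite <- (lsum_sorted_conc _ _ edge_prec edge_precb _ s).
  - rewrite (lsum_perm _ _ _ labels_perm); apply lsum_ext; intros e _.
    unfold offset; now rewrite (lsum_perm _ _ _ labels_perm).
  - intros; apply edge_precb_spec.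
  - apply edge_prec_irrefl.
  - intros x z h1 h2; eapply edge_prec_irrefl, edge_prec_trans; eassumption.
  - apply sorted_labels_sorted.
Qed.

Lemma Hnk_conc n k : H (S n) k = lsum sorted_labels (child k (H n)).
Proof. rewrite Hnk_S; apply lsum_perm, labels_perm. Qed.

Lemma near_slope_ext F1 F2 h lam L eps : (forall s, F1 s = F2 s) ->
  near_slope F1 h lam L eps -> near_slope F2 h lam L eps.
Proof. intros e; now rewrite (functional_extensionality _ _ e). Qed.

Lemma sorted_labels_fst e : In e sorted_labels -> (fst e <= d)%nat.
Proof.
  intros he; apply (Permutation_in _ (Permutation_sym labels_perm)) in he.
  apply (labels_valid d a) in he; apply he.
Qed.

(** [L] and [eps] do not deteriorate under stacking, whatever the number of blocks, so the tower may
    be cut at any depth. *)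
Lemma near_slope_cone lam L eps l : 0 <= L -> 0 <= eps -> forall n k, (N <= n)%nat ->
  (forall i, (i <= d * l)%nat -> (i <= k)%nat ->
     near_slope (F n (k - i)) (H n (k - i)) lam L eps) ->
  near_slope (F (n + l) k) (H (n + l) k) lam L eps.
Proof.
  intros hL he; induction l as [|l IH]; intros n k hn hi.
  - rewrite Nat.add_0_r; specialize (hi 0%nat); rewrite Nat.sub_0_r in hi; apply hi; lia.
  - rewrite Nat.add_succ_r, Hnk_conc.
    eapply near_slope_ext; [intros s; symmetry; apply Fg_conc; lia|].
    apply near_slope_conc; [exact hL|exact he|]. intros e hin.
    apply sorted_labels_fst in hin.
    unfold child; destruct (Nat.leb_spec (fst e) k); [|now apply near_slope_zero].
    apply IH; [exact hn|]. intros i h1 h2.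
    replace (k - fst e - i)%nat with (k - (fst e + i))%nat by lia.
    apply hi; nia.
Qed.

Definition slope n k : R := T n k / H n k.

Definition dev_le n k eps : Prop :=
  forall s, 0 <= s <= H n k -> Rabs (F n k s - slope n k * s) <= eps.

Lemma near_slope_vertex n k lam L eps : 0 < H n k -> 0 <= eps ->
  Rabs (slope n k - lam) <= L -> dev_le n k eps ->
  near_slope (F n k) (H n k) lam L eps.
Proof.
  intros h0 he hL hd.
  assert (eT : F n k (H n k) = T n k) by (apply Fg_ge; lra).
  apply near_slope_block; auto.
  - intros s; apply Fg_nonpos.
  - intros s hs; rewrite eT; now apply Fg_ge.
  - now rewrite eT.
  - intros s hs; rewrite eT; now apply hd.
Qed.

Variable M : R.
Hypothesis M0 : 0 <= M.
Hypothesis HM : forall n c, (N <= n)%nat -> In c (all_paths d a n) -> Rabs (g (ext c)) <= M.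

Lemma dev_le_crude n k : (N <= n)%nat -> 0 < H n k -> dev_le n k (2 * M * H n k).
Proof.
  intros hn h0 s hs.
  pose proof (Fg_bound d a g N M n k s hn HM) as e1.
  pose proof (Fg_bound d a g N M n k (H n k) hn HM) as e2.
  rewrite Fg_ge in e2 by lra.
  assert (e3 : Rabs (slope n k * s) <= M * H n k).
  { unfold slope, Rdiv; rewrite Rabs_mult, Rabs_mult, (Rabs_pos_eq s) by lra.
    rewrite (Rabs_pos_eq (/ _)) by (left; now apply Rinv_0_lt_compat).
    apply Rle_trans with (M * H n k * / H n k * H n k); [|apply Req_le; field; lra].
    apply Rmult_le_compat; try lra.
    - apply Rmult_le_pos; [apply Rabs_pos|left; now apply Rinv_0_lt_compat].
    - apply Rmult_le_compat_r; [left; now apply Rinv_0_lt_compat|exact e2]. }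
  unfold Rminus; eapply Rle_trans; [apply Rabs_triang|]; rewrite Rabs_Ropp; lra.
Qed.

Variables (n k : nat) (C rho eta : R).
Hypotheses (C0 : 0 < C) (rho0 : 0 < rho < 1) (eta0 : 0 <= eta).
Hypothesis cone_H : forall l i, (l * l <= n)%nat -> (i <= d * l)%nat ->
  (i <= k)%nat /\ (N + l < n)%nat /\
  0 < H (n - l) (k - i) <= C * rho ^ l * H n k.
Hypothesis cone_slope : forall l i j, (S l * S l <= n)%nat -> (i <= d * l)%nat ->
  (j <= d)%nat ->
  Rabs (slope (n - S l) (k - (i + j)) - slope (n - l) (k - i)) <= eta.

(** Errors are propagated upward from depth l + r. Each level adds [eta] times a height, and the
    heights decay like [rho ^ l], so the additions form a geometric series; at the lowest depth the
    trivial bound, [2 * M] times the height, is used. *)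
Lemma cone_dev r l i : ((l + r) * (l + r) <= n)%nat -> (i <= d * l)%nat ->
  dev_le (n - l) (k - i)
    (C * H n k * (eta * rho ^ l / (1 - rho) + 2 * M * rho ^ (l + r))).
Proof.
  revert l i; induction r as [|r IH]; intros l i hl hi.
  - rewrite Nat.add_0_r in *; destruct (cone_H l i hl hi) as (h1 & h2 & h3 & h4).
    intros s hs; eapply Rle_trans; [apply dev_le_crude; [lia|exact h3|exact hs]|].
    assert (hH : 0 <= H n k) by apply Hnk_nonneg.
    assert (hr : 0 < rho ^ l) by (apply pow_lt; lra).
    assert (hc : 0 <= C * H n k * (eta * rho ^ l / (1 - rho))).
    { apply Rmult_le_pos; [nra|]. apply Rmult_le_pos; [nra|].
      left; apply Rinv_0_lt_compat; lra. }
    nra.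
  - assert (hl1 : (S l * S l <= n)%nat) by nia.
    assert (hl0 : (l * l <= n)%nat) by nia.
    destruct (cone_H l i hl0 hi) as (h1 & h2 & h3 & h4).
    pose (eps := C * H n k * (eta * rho ^ S l / (1 - rho) + 2 * M * rho ^ (S l + r))).
    assert (Hn0 : 0 <= H n k) by apply Hnk_nonneg.
    assert (eps0 : 0 <= eps).
    { unfold eps; apply Rmult_le_pos; [nra|]. apply Rplus_le_le_0_compat.
      - apply Rmult_le_pos; [|left; apply Rinv_0_lt_compat; lra].
        apply Rmult_le_pos; [lra|apply pow_le; lra].
      - apply Rmult_le_pos; [lra|apply pow_le; lra]. }
    assert (hnear : near_slope (F (n - l) (k - i)) (H (n - l) (k - i))
       (slope (n - l) (k - i)) eta eps).
    { replace (n - l)%nat with (n - S l + 1)%nat by lia.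
      apply near_slope_cone; [lra|exact eps0|lia|]. intros j hj hjk.
      replace (n - S l + 1)%nat with (n - l)%nat by lia.
      replace (k - i - j)%nat with (k - (i + j))%nat by lia.
      assert (hij : (i + j <= d * S l)%nat) by nia.
      destruct (cone_H (S l) (i + j) hl1 hij) as (h5 & h6 & h7 & h8).
      apply near_slope_vertex; [exact h7|exact eps0|apply cone_slope; lia|].
      apply IH; [|exact hij]. replace (S l + r)%nat with (l + S r)%nat by lia; exact hl. }
    intros s hs; eapply Rle_trans; [apply (near_slope_deviation _ _ _ _ _ hnear _ hs)|].
    apply Rle_trans with (eta * (C * rho ^ l * H n k) + eps); [nra|].
    unfold eps; replace (l + S r)%nat with (S l + r)%nat by lia.
    apply Req_le; simpl; field; lra.
Qed.

Lemma cone_slope_sum l i : (l * l <= n)%nat -> (i <= d * l)%nat ->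
  Rabs (slope (n - l) (k - i) - slope n k) <= INR l * eta.
Proof.
  revert i; induction l as [|l IH]; intros i hl hi.
  - replace i with 0%nat by lia; rewrite !Nat.sub_0_r, Rminus_diag, Rabs_R0; simpl; lra.
  - assert (hij : exists i' j, i = (i' + j)%nat /\ (i' <= d * l)%nat /\ (j <= d)%nat).
    { destruct (le_lt_dec i (d * l)) as [h|h].
      - exists i, 0%nat; lia.
      - exists (d * l)%nat, (i - d * l)%nat; nia. }
    destruct hij as (i' & j & -> & h1 & h2).
    replace (slope (n - S l) (k - (i' + j)) - slope n k) with
      ((slope (n - S l) (k - (i' + j)) - slope (n - l) (k - i')) +
       (slope (n - l) (k - i') - slope n k)) by lra.
    eapply Rle_trans; [apply Rabs_triang|].
    pose proof (cone_slope l i' j hl h1 h2) as e1; pose proof (IH i' ltac:(nia) h1) as e2.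
    rewrite S_INR; lra.
Qed.

(** The two depths have different tasks: the cut at [l] fixes the Lipschitz constant, while [l + r]
    reaches deep enough to make the trivial bound negligible. The factor 2 in the error comes from
    comparing two points. *)
Lemma cone_modulus r l : ((l + r) * (l + r) <= n)%nat ->
  forall tt tt', 0 <= tt <= 1 -> 0 <= tt' <= 1 ->
  Rabs (Dg d a g n k tt - Dg d a g n k tt') <=
  H n k * (INR l * eta * Rabs (tt - tt') +
    2 * C * (eta * rho ^ l / (1 - rho) + 2 * M * rho ^ (l + r))).
Proof.
  intros hl tt tt' ht ht'.
  assert (hl0 : (l * l <= n)%nat) by nia.
  destruct (cone_H 0 0 ltac:(lia) ltac:(lia)) as (_ & hN & h3 & _).
  rewrite !Nat.sub_0_r in h3.
  destruct (cone_H l 0 hl0 ltac:(lia)) as (_ & hNl & _).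
  set (eps := C * H n k * (eta * rho ^ l / (1 - rho) + 2 * M * rho ^ (l + r))).
  assert (eps0 : 0 <= eps).
  { unfold eps; apply Rmult_le_pos; [nra|]. apply Rplus_le_le_0_compat.
    - apply Rmult_le_pos; [|left; apply Rinv_0_lt_compat; lra].
      apply Rmult_le_pos; [lra|apply pow_le; lra].
    - apply Rmult_le_pos; [lra|apply pow_le; lra]. }
  assert (L0 : 0 <= INR l * eta) by (apply Rmult_le_pos; [apply pos_INR|lra]).
  assert (hnear : near_slope (F n k) (H n k) (slope n k) (INR l * eta) eps).
  { replace n with (n - l + l)%nat at 1 2 by lia.
    apply near_slope_cone; [exact L0|exact eps0|lia|]. intros i hi hik.
    destruct (cone_H l i hl0 hi) as (h5 & h6 & h7 & h8).
    apply near_slope_vertex; [exact h7|exact eps0|now apply cone_slope_sum|].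
    now apply cone_dev. }
  assert (E : forall u, Dg d a g n k u = F n k (u * H n k) - slope n k * (u * H n k)).
  { intros u; unfold Dg, slope; rewrite (Fg_ge d a g n k (H n k)) by lra; field; lra. }
  rewrite !E; eapply Rle_trans; [apply (near_slope_modulus _ _ _ _ _ hnear); nra|].
  replace (tt * H n k - tt' * H n k) with ((tt - tt') * H n k) by lra.
  rewrite Rabs_mult, (Rabs_pos_eq (H n k)) by lra.
  unfold eps; apply Req_le; ring.
Qed.

(** At the end of the first block, the one of type [d], the curve is the full sum of [g] over that
    smaller tower. This explicit point serves as witness for the lower bound on the maximum. *)
Lemma first_block_dev : (1 <= n)%nat -> exists tt, 0 <= tt <= 1 /\
  Rabs (Dg d a g n k tt) = H (n - 1) (k - d) * Rabs (slope (n - 1) (k - d) - slope n k).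
Proof.
  intros hn.
  destruct (cone_H 0 0 ltac:(lia) ltac:(lia)) as (_ & hN & h3 & _).
  rewrite !Nat.sub_0_r in h3.
  destruct (cone_H 1 d ltac:(lia) ltac:(lia)) as (hk & hN1 & h4 & _).
  destruct sorted_labels_head as [l hl].
  assert (en : n = S (n - 1)) by lia.
  set (H1 := H (n - 1) (k - d)) in *.
  assert (eH : H n k = H1 + lsum l (child k (H (n - 1)))).
  { rewrite en at 1; rewrite Hnk_conc, hl, lsum_cons.
    unfold child at 1; simpl fst; now rewrite (proj2 (Nat.leb_le d k) hk). }
  assert (hle : H1 <= H n k).
  { rewrite eH; pose proof (lsum_nonneg l (child k (H (n - 1)))) as h.
    enough (0 <= lsum l (child k (H (n - 1)))) by lra.
    apply h; intros e _; unfold child; destruct (fst e <=? k)%nat; [apply Hnk_nonneg|lra]. }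
  assert (z : forall l' s, s <= 0 ->
    conc (child k (H (n - 1))) (fun e s => child k (fun k' => F (n - 1) k' s) e) l' s = 0).
  { induction l' as [|e l' IH]; intros s hs; simpl; [reflexivity|].
    rewrite IH.
    - unfold child; destruct (fst e <=? k)%nat; [rewrite Fg_nonpos|]; lra.
    - unfold child; destruct (fst e <=? k)%nat; [pose proof (Hnk_nonneg d a (n - 1) (k - fst e))|]; lra. }
  assert (eF : F n k H1 = T (n - 1) (k - d)).
  { rewrite en at 1; rewrite Fg_conc, hl by lia; simpl conc.
    rewrite z.
    - unfold child; simpl fst; rewrite (proj2 (Nat.leb_le d k) hk).
      rewrite Fg_ge by (unfold H1; lra); lra.
    - unfold child; simpl fst; rewrite (proj2 (Nat.leb_le d k) hk); unfold H1; lra. }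
  exists (H1 / H n k); split.
  - split; [apply Rmult_le_pos; [lra|left; apply Rinv_0_lt_compat; lra]|].
    apply (Rmult_le_reg_r (H n k)); [lra|]. unfold Rdiv; rewrite Rmult_assoc, Rinv_l; lra.
  - unfold Dg; replace (H1 / H n k * H n k) with H1 by (field; lra).
    rewrite eF, (Fg_ge d a g n k (H n k)) by lra.
    transitivity (Rabs H1 * Rabs (slope (n - 1) (k - d) - slope n k));
      [|now rewrite (Rabs_pos_eq H1) by lra].
    rewrite <- Rabs_mult; f_equal.
    unfold slope; fold H1; field; lra.
Qed.
End Cone.

(** * Compactness of asymptotically equicontinuous sequences *)

Lemma Rabs_le_elim x y : Rabs x <= y -> - y <= x <= y.
Proof. unfold Rabs; destruct (Rcase_abs x); lra. Qed.

Definition infinite (S : nat -> Prop) : Prop := forall n, exists m, (n <= m)%nat /\ S m.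

Lemma infinite_pigeonhole (x : nat -> R) eps lo K (S : nat -> Prop) :
  0 < eps -> infinite S -> (forall i, S i -> lo <= x i <= lo + INR K * eps) ->
  exists S' : nat -> Prop, infinite S' /\ (forall i, S' i -> S i) /\
    forall i j, S' i -> S' j -> Rabs (x i - x j) <= eps.
Proof.
  intros he; revert S; induction K as [|K IH]; intros S hS hx.
  - exists S; split; [exact hS|]. split; [auto|]. intros i j hi hj.
    apply hx in hi; apply hx in hj; simpl in *.
    replace (x i - x j) with 0 by lra; rewrite Rabs_R0; lra.
  - rewrite S_INR in hx.
    destruct (classic (infinite (fun i => S i /\ x i <= lo + INR K * eps))) as [h|h].
    + destruct (IH _ h) as (S' & h1 & h2 & h3).
      * intros i [h1 h2]; split; [now apply hx|exact h2].
      * exists S'; split; [exact h1|]. split; [|exact h3].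
        intros i hi; now apply h2.
    + apply not_all_ex_not in h; destruct h as [n0 hn0].
      exists (fun i => S i /\ (n0 <= i)%nat); split; [|split].
      * intros n; destruct (hS (n + n0)%nat) as (m & h1 & h2).
        exists m; split; [lia|split; [exact h2|lia]].
      * tauto.
      * assert (hb : forall i, S i /\ (n0 <= i)%nat -> lo + INR K * eps < x i).
        { intros i [h1 h2]; apply Rnot_le_lt; intros h3; apply hn0; exists i; auto. }
        intros i j hi hj; pose proof (hb i hi); pose proof (hb j hj).
        pose proof (hx i (proj1 hi)); pose proof (hx j (proj1 hj)).
        apply Rabs_le; lra.
Qed.

Section Ascoli.
Variable phi : nat -> R -> R.
Hypothesis phi_bounded : forall j u, 0 <= u <= 1 -> Rabs (phi j u) <= 1.
Hypothesis phi_equi : forall eps, 0 < eps -> exists delta J, 0 < delta /\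
  forall j, (J <= j)%nat -> forall u v, 0 <= u <= 1 -> 0 <= v <= 1 ->
  Rabs (u - v) < delta -> Rabs (phi j u - phi j v) <= eps.

Lemma refine_points eps (pt : nat -> R) P (S : nat -> Prop) :
  0 < eps -> (forall p, (p < P)%nat -> 0 <= pt p <= 1) -> infinite S ->
  exists S' : nat -> Prop, infinite S' /\ (forall i, S' i -> S i) /\
    forall p, (p < P)%nat -> forall i j, S' i -> S' j ->
    Rabs (phi i (pt p) - phi j (pt p)) <= eps.
Proof.
  intros he; induction P as [|P IH]; intros hpt hS.
  - exists S; split; [exact hS|split; [auto|intros; lia]].
  - destruct IH as (S1 & h1 & h2 & h3); [intros; apply hpt; lia|exact hS|].
    destruct (INR_unbounded (2 / eps)) as [K hK].
    destruct (infinite_pigeonhole (fun i => phi i (pt P)) eps (-1) K S1 he h1)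
      as (S2 & h4 & h5 & h6).
    + intros i _; pose proof (phi_bounded i (pt P) (hpt P (Nat.lt_succ_diag_r P))) as hb.
      apply Rabs_le_elim in hb.
      assert (2 < INR K * eps).
      { apply (Rmult_lt_compat_r eps) in hK; [|lra].
        replace (2 / eps * eps) with 2 in hK by (field; lra); lra. }
      lra.
    + exists S2; split; [exact h4|split; [auto|]].
      intros p hp i j hi hj; destruct (Nat.eq_dec p P) as [->|].
      * now apply h6.
      * apply h3; auto; lia.
Qed.

(** Three-epsilon argument on a finite grid of mesh below [delta]; the indices below [J], not
    covered by the equicontinuity, are discarded. *)
Lemma refine_uniform eps (S : nat -> Prop) : 0 < eps -> infinite S ->
  exists S' : nat -> Prop, infinite S' /\ (forall i, S' i -> S i) /\
    forall i j, S' i -> S' j -> forall u, 0 <= u <= 1 -> Rabs (phi i u - phi j u) <= eps.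
Proof.
  intros he hS.
  destruct (phi_equi (eps / 3)) as (delta & J & hd & hphi); [lra|].
  destruct (INR_unbounded (/ delta)) as [P0 hP0].
  set (P := Datatypes.S P0).
  assert (hP : 0 < INR P) by apply (lt_0_INR P), Nat.lt_0_succ.
  assert (hPd : / INR P < delta).
  { rewrite <- (Rinv_inv delta); apply Rinv_lt_contravar.
    - apply Rmult_lt_0_compat; [now apply Rinv_0_lt_compat|exact hP].
    - unfold P; rewrite S_INR; lra. }
  destruct (refine_points (eps / 3) (fun p => INR p / INR P) (Datatypes.S P) S)
    as (S1 & h1 & h2 & h3); [lra| |exact hS|].
  { intros p hp; split.
    - apply Rmult_le_pos; [apply pos_INR|left; now apply Rinv_0_lt_compat].
    - apply (Rmult_le_reg_r (INR P)); [exact hP|].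
      unfold Rdiv; rewrite Rmult_assoc, Rinv_l, Rmult_1_l, Rmult_1_r by lra.
      apply le_INR; lia. }
  exists (fun i => S1 i /\ (J <= i)%nat); split; [|split].
  - intros n; destruct (h1 (n + J)%nat) as (m & e1 & e2); exists m; split; [lia|split; [exact e2|lia]].
  - intros i [hi _]; auto.
  - intros i j [hi hJi] [hj hJj] u hu.
    assert (hp : exists p, (p < Datatypes.S P)%nat /\ 0 <= u - INR p / INR P < / INR P).
    { assert (hex : forall Q, exists p, (p <= Q)%nat /\
        (INR p / INR P <= u /\ (p = Q \/ u < INR (Datatypes.S p) / INR P))).
      { induction Q as [|Q IHQ].
        - exists 0%nat; split; [lia|]; simpl; split; [|now left]. unfold Rdiv; lra.
        - destruct IHQ as (p & e1 & e2 & [e3|e3]).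
          + subst p; destruct (Rle_lt_dec (INR (Datatypes.S Q) / INR P) u).
            * exists (Datatypes.S Q); auto.
            * exists Q; auto.
          + exists p; auto. }
      destruct (hex P) as (p & e1 & e2 & e3); exists p; split; [lia|].
      destruct e3 as [e3|e3].
      - subst p; replace (INR P / INR P) with 1 in * by (field; lra).
        pose proof (Rinv_0_lt_compat _ hP); lra.
      - rewrite S_INR in e3; unfold Rdiv in *; rewrite Rmult_plus_distr_r in e3; lra. }
    destruct hp as (p & hp & hup).
    assert (hpu : 0 <= INR p / INR P <= 1).
    { split; [|lra]. apply Rmult_le_pos; [apply pos_INR|left; now apply Rinv_0_lt_compat]. }
    assert (hdist : Rabs (u - INR p / INR P) < delta) by (rewrite Rabs_pos_eq; lra).
    pose proof (hphi i hJi u _ hu hpu hdist) as e1.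
    pose proof (hphi j hJj u _ hu hpu hdist) as e2.
    pose proof (h3 p hp i j hi hj) as e3.
    apply Rabs_le_elim in e1; apply Rabs_le_elim in e2; apply Rabs_le_elim in e3.
    apply Rabs_le; lra.
Qed.

Lemma refinement_chain : exists SS : nat -> nat -> Prop,
  (forall p, infinite (SS p)) /\ (forall p i, SS (S p) i -> SS p i) /\
  forall p i j, SS (S p) i -> SS (S p) j -> forall u, 0 <= u <= 1 ->
    Rabs (phi i u - phi j u) <= / INR (S p).
Proof.
  assert (step : forall p (Q : {S | infinite S}), {Q' : {S | infinite S} |
    (forall i, proj1_sig Q' i -> proj1_sig Q i) /\
    forall i j, proj1_sig Q' i -> proj1_sig Q' j -> forall u, 0 <= u <= 1 ->
      Rabs (phi i u - phi j u) <= / INR (S p)}).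
  { intros p [Q hQ]; apply constructive_indefinite_description.
    destruct (refine_uniform (/ INR (S p)) Q) as (Q' & h1 & h2 & h3).
    - apply Rinv_0_lt_compat, lt_0_INR; lia.
    - exact hQ.
    - now exists (exist _ Q' h1). }
  assert (hall : infinite (fun _ => True)) by (intros n; now exists n).
  pose (SS := fix SS p := match p with
    | O => exist infinite (fun _ => True) hall
    | S p' => proj1_sig (step p' (SS p')) end).
  exists (fun p => proj1_sig (SS p)); split; [|split].
  - intros p; apply proj2_sig.
  - intros p; simpl; apply (proj2_sig (step p (SS p))).
  - intros p; simpl; apply (proj2_sig (step p (SS p))).
Qed.

(** Diagonal choice in the nested chain. The bound [j <= sigma j] takes the place of monotonicity:
    it gives divergence and reaches the range in which [phi_equi] applies. *)
Theorem uniform_subsequence : exists (sigma : nat -> nat) (psi : R -> R),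
  (forall j, (j <= sigma j)%nat) /\
  (forall u, 0 <= u <= 1 -> forall eps, 0 < eps -> exists delta, 0 < delta /\
     forall v, 0 <= v <= 1 -> Rabs (v - u) < delta -> Rabs (psi v - psi u) < eps) /\
  (forall eps, 0 < eps -> exists J, forall j, (J <= j)%nat -> forall u, 0 <= u <= 1 ->
     Rabs (phi (sigma j) u - psi u) < eps).
Proof.
  destruct refinement_chain as (SS & hinf & hsub & hclose).
  assert (hsig : forall p, exists m, (p <= m)%nat /\ SS p m) by (intros p; apply hinf).
  pose (sigma := fun p => proj1_sig (constructive_indefinite_description _ (hsig p))).
  assert (sigma_ge : forall p, (p <= sigma p)%nat).
  { intros p; apply (proj2_sig (constructive_indefinite_description _ (hsig p))). }
  assert (sigma_in : forall p, SS p (sigma p)).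
  { intros p; apply (proj2_sig (constructive_indefinite_description _ (hsig p))). }
  assert (hmono : forall p r i, SS (p + r)%nat i -> SS p i).
  { intros p r; induction r as [|r IH]; intros i hi.
    - now rewrite Nat.add_0_r in hi.
    - rewrite Nat.add_succ_r in hi; apply IH, hsub, hi. }
  assert (hC : forall p i j, (S p <= i)%nat -> (S p <= j)%nat -> forall u, 0 <= u <= 1 ->
    Rabs (phi (sigma i) u - phi (sigma j) u) <= / INR (S p)).
  { intros p i j hi hj u hu; apply hclose; [| |exact hu].
    - apply (hmono _ (i - S p)%nat); replace (S p + (i - S p))%nat with i by lia; apply sigma_in.
    - apply (hmono _ (j - S p)%nat); replace (S p + (j - S p))%nat with j by lia; apply sigma_in. }
  assert (hsmall : forall eps, 0 < eps -> exists p, / INR (S p) < eps).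
  { intros eps he; destruct (INR_unbounded (/ eps)) as [p hp]; exists p.
    rewrite <- (Rinv_inv eps); apply Rinv_lt_contravar.
    - apply Rmult_lt_0_compat; [now apply Rinv_0_lt_compat|apply lt_0_INR; lia].
    - rewrite S_INR; lra. }
  assert (hlim : forall u, exists l, 0 <= u <= 1 -> Un_cv (fun j => phi (sigma j) u) l).
  { intros u; destruct (classic (0 <= u <= 1)) as [hu|hu]; [|exists 0; tauto].
    destruct (R_complete (fun j => phi (sigma j) u)) as [l hl]; [|now exists l].
    intros eps he; destruct (hsmall eps he) as [p hp]; exists (S p).
    intros i j hi hj; unfold Rdist.
    eapply Rle_lt_trans; [apply (hC p); auto|exact hp]. }
  pose (psi := fun u => proj1_sig (constructive_indefinite_description _ (hlim u))).
  assert (hpsi : forall u, 0 <= u <= 1 -> Un_cv (fun j => phi (sigma j) u) (psi u)).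
  { intros u; apply (proj2_sig (constructive_indefinite_description _ (hlim u))). }
  assert (hunif : forall p j, (S p <= j)%nat -> forall u, 0 <= u <= 1 ->
    Rabs (phi (sigma j) u - psi u) <= / INR (S p)).
  { intros p j hj u hu; apply le_epsilon; intros eps he.
    destruct (hpsi u hu eps he) as [n0 hn0].
    specialize (hn0 (n0 + S p)%nat ltac:(lia)); unfold Rdist in hn0.
    pose proof (hC p j (n0 + S p)%nat hj ltac:(lia) u hu) as e.
    apply Rabs_le_elim in e; apply Rabs_def2 in hn0.
    apply Rabs_le; lra. }
  exists sigma, psi; split; [exact sigma_ge|split].
  - intros u hu eps he.
    destruct (phi_equi (eps / 4)) as (delta & J & hd & hphi); [lra|].
    destruct (hsmall (eps / 4)) as [p hp]; [lra|].
    exists delta; split; [exact hd|]. intros v hv hvu.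
    set (j := (J + S p)%nat).
    pose proof (hunif p j ltac:(lia) u hu) as e1.
    pose proof (hunif p j ltac:(lia) v hv) as e2.
    assert (hj : (J <= sigma j)%nat) by (pose proof (sigma_ge j); lia).
    pose proof (hphi (sigma j) hj v u hv hu hvu) as e3.
    apply Rabs_le_elim in e1; apply Rabs_le_elim in e2; apply Rabs_le_elim in e3.
    apply Rabs_def1; lra.
  - intros eps he; destruct (hsmall eps he) as [p hp]; exists (S p).
    intros j hj u hu; eapply Rle_lt_trans; [now apply (hunif p)|exact hp].
Qed.
End Ascoli.

(** * Null sets *)

Definition prefix (n : nat) (x : path) : list label := map x (seq 0 n).

Lemma length_prefix n x : length (prefix n x) = n.
Proof. unfold prefix; now rewrite length_map, length_seq. Qed.

Lemma nth_prefix n x i e : (i < n)%nat -> nth i (prefix n x) e = x i.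
Proof.
  intros h; unfold prefix; rewrite (nth_indep _ e (x 0%nat)) by (rewrite length_map, length_seq; lia).
  rewrite map_nth, seq_nth by lia; f_equal; lia.
Qed.

Lemma in_cyl_prefix n x : in_cyl (prefix n x) x.
Proof. intros i hi; rewrite length_prefix in hi; now rewrite nth_prefix. Qed.

Lemma prefix_add n r x : prefix (n + r) x = prefix n x ++ map x (seq n r).
Proof. unfold prefix; rewrite seq_app, map_app; reflexivity. Qed.

Lemma prefix_in d a n x : in_X d a x -> In (prefix n x) (all_paths d a n).
Proof.
  intros hx; apply all_paths_valid; split; [apply length_prefix|].
  apply Forall_forall; intros e he; apply in_map_iff in he.
  destruct he as (i & <- & _); apply hx.
Qed.

Section Null.
Variables (d : nat) (a : nat -> nat) (q t : R).
Hypothesis Ha : forall j, (j <= d)%nat -> (1 <= a j)%nat.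
Hypotheses (Hq0 : 0 < q) (Hd : (1 <= d)%nat) (Ht0 : 0 < t).
Hypothesis Hteq : t_eq d a q t.
Notation wt := (cyl_weight q t).
Notation AP := (all_paths d a).

Lemma edge_weight_pos e : 0 < edge_weight q t e.
Proof.
  unfold edge_weight; apply Rmult_lt_0_compat; [lra|].
  apply pow_lt, Rdiv_lt_0_compat; lra.
Qed.

Lemma cyl_weight_app c c' : wt (c ++ c') = wt c * wt c'.
Proof.
  unfold cyl_weight; induction c as [|e c IH]; simpl; [lra|]. rewrite IH; lra.
Qed.

Lemma cyl_weight_pos c : 0 < wt c.
Proof.
  unfold cyl_weight; induction c as [|e c IH]; simpl; [lra|].
  apply Rmult_lt_0_compat; [apply edge_weight_pos|exact IH].
Qed.

Lemma cyl_weightE c : wt c = q ^ length c * (t / q) ^ endk c.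
Proof.
  unfold cyl_weight, endk; induction c as [|e c IH]; simpl; [lra|].
  rewrite IH, pow_add; unfold edge_weight; ring.
Qed.

Lemma lsum_labels (X : nat -> R) :
  lsum (labels d a) (fun e => X (fst e)) = lsum (seq 0 (S d)) (fun j => INR (a j) * X j).
Proof.
  unfold labels; rewrite lsum_flat_map; apply lsum_ext; intros j _.
  rewrite lsum_map; simpl.
  transitivity (X j * lsum (seq 0 (a j)) (fun _ => 1)).
  - rewrite <- lsum_scal; apply lsum_ext; intros; lra.
  - rewrite lsum_one, length_seq; ring.
Qed.

Lemma edge_weight_total : lsum (labels d a) (edge_weight q t) = 1.
Proof.
  transitivity (lsum (labels d a) (fun e => (fun j => q * (t / q) ^ j) (fst e)));
    [reflexivity|].
  rewrite (lsum_labels (fun j => q * (t / q) ^ j)); unfold t_eq in Hteq.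
  change (lsum (seq 0 (S d)) (fun j => INR (a j) * q ^ (d - j) * t ^ j) = q ^ (d - 1)) in Hteq.
  assert (hq : q ^ (d - 1) <> 0) by (apply pow_nonzero; lra).
  apply (Rmult_eq_reg_l (q ^ (d - 1))); [|exact hq].
  rewrite Rmult_1_r, <- lsum_scal; etransitivity; [|exact Hteq].
  apply lsum_ext; intros j hj.
  apply in_seq in hj; cbv beta.
  assert (e : q ^ (d - 1) * q = q ^ (d - j) * q ^ j).
  { rewrite <- pow_add; replace (d - j + j)%nat with (S (d - 1)) by lia; simpl; ring. }
  assert (hqj : q ^ j <> 0) by (apply pow_nonzero; lra).
  replace ((t / q) ^ j) with (t ^ j * / q ^ j)
    by (unfold Rdiv; now rewrite Rpow_mult_distr, pow_inv).
  transitivity (INR (a j) * (q ^ (d - 1) * q) * (t ^ j * / q ^ j)); [ring|].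
  rewrite e; field; exact hqj.
Qed.

Lemma cyl_weight_total n : lsum (AP n) wt = 1.
Proof.
  induction n as [|n IH]; [unfold lsum, cyl_weight; simpl; lra|].
  rewrite lsum_all_paths_S, <- IH; apply lsum_ext; intros c _.
  transitivity (wt c * lsum (labels d a) (edge_weight q t)).
  - rewrite <- lsum_scal; apply lsum_ext; intros e _.
    rewrite cyl_weight_app; unfold cyl_weight at 2; simpl; ring.
  - rewrite edge_weight_total; ring.
Qed.

Lemma mu_ae_impl (P Q : path -> Prop) :
  (forall x, in_X d a x -> P x -> Q x) -> mu_ae d a q t P -> mu_ae d a q t Q.
Proof.
  intros h hP eps he; destruct (hP eps he) as (cs & h1 & h2); exists cs; split; [|exact h2].
  intros x hx hQ; apply h1; [exact hx|]; intros hPx; apply hQ, h; assumption.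
Qed.

Lemma lsum_seq_nth_le {A} (l : list A) (F : A -> R) x0 n :
  (forall x, 0 <= F x) -> (n <= length l)%nat ->
  lsum (seq 0 n) (fun i => F (nth i l x0)) <= lsum l F.
Proof.
  intros hF; revert n; induction l as [|x l IH]; intros n hn.
  - simpl in hn; replace n with 0%nat by lia; apply Rle_refl.
  - destruct n as [|n]; [apply lsum_nonneg; intros; apply hF|].
    simpl seq; rewrite <- seq_shift, !lsum_cons, lsum_map; simpl.
    apply Rplus_le_compat_l, IH; simpl in hn; lia.
Qed.

(** Serves to pad lists of cylinders. The edge [(0, 0)] has weight [q], which is below 1 because an
    edge of type 1 also has positive weight; its repetitions have weight [q ^ n]. *)
Lemma small_cylinder eps : 0 < eps -> exists c, wt c <= eps.
Proof.
  intros he.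
  assert (hlab : In (0%nat, 0%nat) (labels d a) /\ In (1%nat, 0%nat) (labels d a)).
  { split; apply labels_valid; split; simpl; try lia; apply Ha; lia. }
  destruct hlab as [h0 h1].
  assert (hq : q < 1).
  { assert (hs : edge_weight q t (0%nat, 0%nat) + edge_weight q t (1%nat, 0%nat) <= 1).
    { rewrite <- edge_weight_total.
      destruct (in_split _ _ h0) as (l1 & l2 & e); rewrite e in h1 |- *.
      rewrite lsum_app, lsum_cons.
      assert (hn : forall l, 0 <= lsum l (edge_weight q t))
        by (intros; apply lsum_nonneg; intros; left; apply edge_weight_pos).
      pose proof (hn l1); pose proof (hn l2).
      apply in_app_or in h1; destruct h1 as [h1|[h1|h1]]; [|discriminate|].
      - pose proof (lsum_ge_in l1 (edge_weight q t) _ h1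
          (fun z _ => Rlt_le _ _ (edge_weight_pos z))); unfold label in *; lra.
      - pose proof (lsum_ge_in l2 (edge_weight q t) _ h1
          (fun z _ => Rlt_le _ _ (edge_weight_pos z))); unfold label in *; lra. }
    pose proof (edge_weight_pos (1%nat, 0%nat)).
    unfold edge_weight at 1 in hs; simpl in hs; lra. }
  destruct (pow_lt_1_zero q) with (y := eps) as [n hn]; [rewrite Rabs_pos_eq; lra|exact he|].
  exists (repeat (0%nat, 0%nat) n); rewrite cyl_weightE, repeat_length.
  replace (endk (repeat (0%nat, 0%nat) n)) with 0%nat.
  - specialize (hn n (le_n n)); rewrite Rabs_pos_eq in hn by (apply pow_le; lra).
    simpl; lra.
  - clear hn; induction n as [|n IH]; [reflexivity|exact IH].
Qed.

(** Null sets are defined by sequences of cylinders, so finite covers with budgets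
    [eps * (/ 2) ^ S M] have to be strung into a single sequence. *)
Lemma mu_null_union (A : nat -> path -> Prop) :
  (forall M eps, 0 < eps -> exists L, lsum L wt <= eps /\
     forall x, in_X d a x -> A M x -> exists c, In c L /\ in_cyl c x) ->
  mu_null d a q t (fun x => exists M, A M x).
Proof.
  intros hA eps he.
  assert (hex : forall M, exists L, L <> [] /\ lsum L wt <= eps * (/ 2) ^ S M /\
     forall x, in_X d a x -> A M x -> exists c, In c L /\ in_cyl c x).
  { intros M; assert (hp : 0 < (/ 2) ^ S M) by (apply pow_lt; lra).
    assert (he2 : 0 < eps * (/ 2) ^ S M / 2) by nra.
    destruct (hA M _ he2) as (L & h1 & h2); destruct (small_cylinder _ he2) as [c hc].
    exists (c :: L); split; [discriminate|]. rewrite lsum_cons; split; [lra|].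
    intros x hx hAx; destruct (h2 x hx hAx) as (c' & e1 & e2); exists c'; split; [now right|exact e2]. }
  pose (LL := fun M => proj1_sig (constructive_indefinite_description _ (hex M))).
  assert (hLL : forall M, LL M <> [] /\ lsum (LL M) wt <= eps * (/ 2) ^ S M /\
     forall x, in_X d a x -> A M x -> exists c, In c (LL M) /\ in_cyl c x)
    by (intros M; apply (proj2_sig (constructive_indefinite_description _ (hex M)))).
  (* As each cover is nonempty, [CC i] has more than i entries, and its i-th entry no longer changes
     when further covers are appended. *)
  pose (CC := fix CC n := match n with O => LL O | S n' => CC n' ++ LL (S n') end).
  assert (hpre : forall n r, exists l, CC (n + r)%nat = CC n ++ l).
  { intros n r; induction r as [|r [l IH]].
    - exists []; now rewrite Nat.add_0_r, app_nil_r.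
    - exists (l ++ LL (S (n + r))); rewrite Nat.add_succ_r; simpl; now rewrite IH, app_assoc. }
  assert (hlen : forall n, (n < length (CC n))%nat).
  { assert (hl1 : forall M, (1 <= length (LL M))%nat).
    { intros M; destruct (hLL M) as [h _]; destruct (LL M); [contradiction|simpl; lia]. }
    induction n as [|n IH]; simpl; [apply hl1|]. rewrite length_app; specialize (hl1 (S n)); lia. }
  assert (hsum : forall n, lsum (CC n) wt <= eps * (1 - (/ 2) ^ S n)).
  { induction n as [|n IH]; simpl CC.
    - destruct (hLL 0%nat) as (_ & h & _); simpl in *; lra.
    - rewrite lsum_app; destruct (hLL (S n)) as (_ & h & _); simpl in *; lra. }
  exists (fun i => nth i (CC i) []); split.
  - intros x hx [M hM]; destruct (hLL M) as (_ & _ & h).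
    destruct (h x hx hM) as (c & h1 & h2).
    assert (hc : In c (CC M)).
    { destruct M; simpl; [exact h1|apply in_or_app; now right]. }
    destruct (In_nth _ _ [] hc) as (i & hi & hni); exists i.
    replace (nth i (CC i) []) with c; [exact h2|].
    rewrite <- hni; destruct (le_ge_dec i M) as [hle|hge].
    + destruct (hpre i (M - i)%nat) as [l hl].
      replace (i + (M - i))%nat with M in hl by lia.
      rewrite hl, app_nth1; [reflexivity|apply hlen].
    + destruct (hpre M (i - M)%nat) as [l hl].
      replace (M + (i - M))%nat with i in hl by lia.
      now rewrite hl, app_nth1.
  - intros n; fold (lsum (seq 0 n) (fun i => wt (nth i (CC i) []))).
    rewrite (lsum_ext _ _ (fun i => wt (nth i (CC n) []))).
    + eapply Rle_trans; [apply lsum_seq_nth_le|].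
      * intros; left; apply cyl_weight_pos.
      * pose proof (hlen n); lia.
      * eapply Rle_trans; [apply hsum|].
        assert (0 < (/ 2) ^ S n) by (apply pow_lt; lra); nra.
    + intros i hi; apply in_seq in hi; destruct (hpre i (n - i)%nat) as [l hl].
      replace (i + (n - i))%nat with n in hl by lia.
      rewrite hl, app_nth1; [reflexivity|apply hlen].
Qed.

Definition goodb (Good : list label -> Prop) (c : list label) : bool :=
  if excluded_middle_informative (Good c) then true else false.

Lemma goodb_true Good c : goodb Good c = true <-> Good c.
Proof. unfold goodb; destruct (excluded_middle_informative _); intuition discriminate. Qed.

(** Since [r] depends on the level alone, the prefixes surviving a round share a level. Each round
    keeps at most the fraction [1 - delta] of their weight, so the paths without a good prefix
    beyond [M] are covered with weight [(1 - delta) ^ i]. *)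
Lemma mu_ae_frequently (Good : list label -> Prop) delta :
  0 < delta ->
  (forall n0, exists r, forall c, In c (AP n0) ->
     delta <= lsum (AP r) (fun c' => if goodb Good (c ++ c') then wt c' else 0)) ->
  mu_ae d a q t (fun x => forall M, exists n, (M <= n)%nat /\ Good (prefix n x)).
Proof.
  intros hd hG.
  assert (hd1 : delta <= 1).
  { destruct (hG 0%nat) as [r hr]; specialize (hr [] (or_introl eq_refl)).
    eapply Rle_trans; [exact hr|]. rewrite <- (cyl_weight_total r); apply lsum_le.
    intros c _; pose proof (cyl_weight_pos c); destruct (goodb Good ([] ++ c)); lra. }
  assert (cover : forall M i, exists L lev, (M <= lev)%nat /\
    (forall c, In c L -> In c (AP lev)) /\ lsum L wt <= (1 - delta) ^ i /\
    forall x, in_X d a x -> (forall n, (M <= n)%nat -> ~ Good (prefix n x)) ->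
      In (prefix lev x) L).
  { intros M i; induction i as [|i (L & lev & h1 & h2 & h3 & h4)].
    - exists (AP M), M; split; [lia|]. split; [auto|]. split.
      + rewrite cyl_weight_total; simpl; lra.
      + intros x hx _; now apply prefix_in.
    - destruct (hG lev) as [r hr].
      exists (flat_map (fun c => map (app c)
        (filter (fun c' => negb (goodb Good (c ++ c'))) (AP r))) L), (lev + r)%nat.
      split; [lia|]. split; [|split].
      + intros c hc; apply in_flat_map in hc; destruct hc as (c1 & e1 & e2).
        apply in_map_iff in e2; destruct e2 as (c2 & <- & e3).
        apply filter_In in e3; destruct e3 as [e3 _].
        apply h2, all_paths_valid in e1; apply all_paths_valid in e3.
        apply all_paths_valid; rewrite length_app; split; [lia|].
        apply Forall_app; tauto.
      + rewrite lsum_flat_map.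
        apply Rle_trans with (lsum L (fun c => (1 - delta) * wt c)).
        * apply lsum_le; intros c hc; rewrite lsum_map, lsum_filter.
          assert (e : lsum (AP r) (fun c' => if negb (goodb Good (c ++ c')) then wt (c ++ c') else 0)
             = wt c * (lsum (AP r) wt - lsum (AP r) (fun c' => if goodb Good (c ++ c') then wt c' else 0))).
          { replace (lsum (AP r) wt - lsum (AP r) (fun c' => if goodb Good (c ++ c') then wt c' else 0))
              with (lsum (AP r) wt + (-1) * lsum (AP r) (fun c' => if goodb Good (c ++ c') then wt c' else 0)) by lra.
            rewrite <- lsum_scal, <- lsum_plus, <- lsum_scal; apply lsum_ext; intros c' _.
            rewrite cyl_weight_app; destruct (goodb Good (c ++ c')); simpl; lra. }
          rewrite e, cyl_weight_total.
          pose proof (hr c (h2 c hc)); pose proof (cyl_weight_pos c); nra.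
        * rewrite lsum_scal; simpl; apply Rmult_le_compat_l; lra.
      + intros x hx hb; rewrite prefix_add; apply in_flat_map.
        exists (prefix lev x); split; [now apply h4|].
        apply in_map; apply filter_In; split.
        * apply all_paths_valid; rewrite length_map, length_seq; split; [reflexivity|].
          apply Forall_forall; intros e he; apply in_map_iff in he.
          destruct he as (j & <- & _); apply hx.
        * destruct (goodb Good (prefix lev x ++ map x (seq lev r))) eqn:E; [|reflexivity].
          apply goodb_true in E; rewrite <- prefix_add in E.
          destruct (hb (lev + r)%nat); [lia|exact E]. }
  intros eps he.
  destruct (mu_null_union (fun M x => forall n, (M <= n)%nat -> ~ Good (prefix n x)))
    with (eps := eps) as (cs & h1 & h2); [|exact he|].
  - intros M e hpos.
    destruct (pow_lt_1_zero (1 - delta)) with (y := e) as [i hi];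
      [rewrite Rabs_pos_eq; lra|exact hpos|].
    destruct (cover M i) as (L & lev & e1 & e2 & e3 & e4); exists L; split.
    + specialize (hi i (le_n i)); rewrite Rabs_pos_eq in hi by (apply pow_le; lra); lra.
    + intros x hx hb; exists (prefix lev x); split; [now apply e4|apply in_cyl_prefix].
  - exists cs; split; [|exact h2]. intros x hx hn; apply h1; [exact hx|].
    apply not_all_ex_not in hn; destruct hn as [M hM]; exists M.
    intros n hn hg; apply hM; now exists n.
Qed.
End Null.

(** * The adic order *)

Lemma lt_rev_app_same r s s' : lt_rev (r ++ s) (r ++ s') = lt_rev s s'.
Proof.
  induction r as [|e r IH]; [reflexivity|]; simpl. now rewrite !Nat.eqb_refl.
Qed.

Lemma lt_rev_app_diff r r' s s' : length r = length r' -> r <> r' ->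
  lt_rev (r ++ s) (r' ++ s') = lt_rev r r'.
Proof.
  revert r'; induction r as [|e r IH]; intros [|e' r'] hl hn; simpl in *; try discriminate.
  - contradiction.
  - fold (label_eqb e e'); destruct (label_eqb e e') eqn:E; [|reflexivity].
    apply label_eqb_eq in E; subst e'; apply IH; congruence.
Qed.

Lemma lt_rev_trans r1 r2 r3 : lt_rev r1 r2 = true -> lt_rev r2 r3 = true ->
  lt_rev r1 r3 = true.
Proof.
  revert r2 r3; induction r1 as [|e1 r1 IH]; intros [|e2 r2] [|e3 r3]; simpl; try discriminate.
  fold (label_eqb e1 e2); fold (label_eqb e2 e3); fold (label_eqb e1 e3).
  destruct (label_eqb e1 e2) eqn:E12.
  - apply label_eqb_eq in E12; subst e2; destruct (label_eqb e1 e3); [apply IH|auto].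
  - destruct (label_eqb e2 e3) eqn:E23.
    + apply label_eqb_eq in E23; subst e3; rewrite E12; auto.
    + rewrite !edge_precb_spec; intros h1 h2.
      pose proof (edge_prec_trans _ _ _ h1 h2) as h.
      destruct (label_eqb e1 e3) eqn:E13; [|now apply edge_precb_spec].
      apply label_eqb_eq in E13; subst e3; now apply edge_prec_irrefl in h.
Qed.

Lemma lt_rev_total r r' : length r = length r' -> r <> r' ->
  lt_rev r r' = true \/ lt_rev r' r = true.
Proof.
  revert r'; induction r as [|e r IH]; intros [|e' r'] hl hn; simpl in *; try discriminate.
  - contradiction.
  - fold (label_eqb e e'); fold (label_eqb e' e); destruct (label_eqb e e') eqn:E.
    + apply label_eqb_eq in E; subst e'; rewrite (proj2 (label_eqb_eq e e) eq_refl).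
      apply IH; congruence.
    + assert (hne : e <> e') by (intros ->; rewrite (proj2 (label_eqb_eq e' e') eq_refl) in E; discriminate).
      destruct (label_eqb e' e) eqn:E'; [apply label_eqb_eq in E'; congruence|].
      rewrite !edge_precb_spec; now apply edge_prec_total.
Qed.

Lemma fpath_lt_trans c1 c2 c3 : fpath_lt c1 c2 = true -> fpath_lt c2 c3 = true ->
  fpath_lt c1 c3 = true.
Proof. apply lt_rev_trans. Qed.

Lemma fpath_lt_total c c' : length c = length c' -> c <> c' ->
  fpath_lt c c' = true \/ fpath_lt c' c = true.
Proof.
  intros hl hn; apply lt_rev_total; [now rewrite !length_rev|].
  intros h; apply hn; now rewrite <- (rev_involutive c), h, rev_involutive.
Qed.

Lemma fpath_lt_app_same A A' B : fpath_lt (A ++ B) (A' ++ B) = fpath_lt A A'.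
Proof. unfold fpath_lt; rewrite !rev_app_distr; apply lt_rev_app_same. Qed.

Lemma fpath_lt_app_diff A A' B B' : length B = length B' -> B <> B' ->
  fpath_lt (A ++ B) (A' ++ B') = fpath_lt B B'.
Proof.
  intros hl hn; unfold fpath_lt; rewrite !rev_app_distr; apply lt_rev_app_diff.
  - now rewrite !length_rev.
  - intros h; apply hn; now rewrite <- (rev_involutive B), h, rev_involutive.
Qed.

Lemma kn_endk x n : kn x n = endk (prefix n x).
Proof. unfold kn, endk, prefix; now rewrite map_map. Qed.

Lemma prefix_S n x : prefix (S n) x = prefix n x ++ [x n].
Proof. unfold prefix; rewrite seq_S, map_app; reflexivity. Qed.

Lemma kn_S n x : kn x (S n) = (kn x n + fst (x n))%nat.
Proof. rewrite !kn_endk, prefix_S, endk_app; unfold endk at 2; simpl; lia. Qed.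

Lemma label_eqb_refl e : label_eqb e e = true.
Proof. now apply label_eqb_eq. Qed.

Lemma label_eqb_neq e e' : e <> e' -> label_eqb e e' = false.
Proof.
  intros h; destruct (label_eqb e e') eqn:E; [|reflexivity].
  now apply label_eqb_eq in E.
Qed.

Lemma path_prec_of_prefix n x y : (forall i, (n <= i)%nat -> x i = y i) ->
  kn x n = kn y n -> fpath_lt (prefix n x) (prefix n y) = true -> path_prec x y.
Proof.
  induction n as [|n IH]; intros ht hk hlt; [discriminate|].
  rewrite !prefix_S, fpath_lt_snoc in hlt.
  destruct (label_eqb (x n) (y n)) eqn:E.
  - apply label_eqb_eq in E; apply IH; [|rewrite !kn_S, E in hk; lia|exact hlt].
    intros i hi; destruct (Nat.eq_dec i n) as [->|]; [exact E|apply ht; lia].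
  - exists n; split; [|split; [now apply edge_precb_spec|split; [exact hk|]]].
    + intros h; rewrite h, label_eqb_refl in E; discriminate.
    + intros i hi; apply ht; lia.
Qed.

(** For a common tail the order on infinite paths reduces to that on prefixes; the prefixes end at
    one vertex by the vertex condition in [path_prec]. *)
Lemma prefix_of_path_prec n x y : (forall i, (n <= i)%nat -> x i = y i) ->
  path_prec x y -> kn x n = kn y n /\ fpath_lt (prefix n x) (prefix n y) = true.
Proof.
  intros ht (i & h1 & h2 & h3 & h4).
  assert (hi : (i < n)%nat).
  { destruct (Nat.lt_ge_cases i n) as [|h]; [assumption|]; now destruct h1; apply ht. }
  clear ht; induction n as [|n IH]; [lia|].
  destruct (Nat.eq_dec i n) as [->|hne].
  - split; [exact h3|]. rewrite !prefix_S, fpath_lt_snoc, label_eqb_neq by exact h1.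
    now apply edge_precb_spec.
  - destruct IH as [e1 e2]; [lia|].
    rewrite !kn_S, !prefix_S, fpath_lt_snoc, (h4 n) by lia.
    rewrite label_eqb_refl; split; [lia|exact e2].
Qed.

Lemma minimal_element {A} (lt : A -> A -> bool) (l : list A) :
  (forall x, lt x x = false) ->
  (forall x y z, lt x y = true -> lt y z = true -> lt x z = true) ->
  l <> [] -> exists m, In m l /\ forall x, In x l -> lt x m = false.
Proof.
  intros hi ht; induction l as [|x l IH]; intros hl; [contradiction|].
  destruct l as [|x' l'].
  - exists x; split; [now left|]. intros z [<-|[]]; apply hi.
  - destruct IH as (m & h1 & h2); [discriminate|].
    destruct (lt x m) eqn:E.
    + exists x; split; [now left|]. intros z [<-|hz]; [apply hi|].
      destruct (lt z x) eqn:E'; [|reflexivity].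
      rewrite <- (h2 z hz); symmetry; eapply ht; eassumption.
    + exists m; split; [now right|]. intros z [<-|hz]; auto.
Qed.

(** * Constant means give a transfer function *)

Section Transfer.
Variables (d : nat) (a : nat -> nat) (q t : R).
Hypothesis Ha : forall j, (j <= d)%nat -> (1 <= a j)%nat.
Hypotheses (Hq0 : 0 < q) (Hd : (1 <= d)%nat) (Ht0 : 0 < t).
Hypothesis Hteq : t_eq d a q t.
Variables (g : path -> R) (N : nat).
Hypothesis Hg : cylindric d a N g.
Notation AP := (all_paths d a).

Lemma NoDup_all_paths n : NoDup (AP n).
Proof.
  induction n as [|n IH]; simpl; [repeat constructor; auto|].
  induction IH as [|c l hc hl IHl]; simpl; [constructor|].
  apply NoDup_app; [|exact IHl|].
  - apply FinFun.Injective_map_NoDup; [|apply NoDup_labels].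
    intros e e' h; now apply app_inj_tail in h.
  - intros z h1 h2; apply in_map_iff in h1; destruct h1 as (e & <- & _).
    apply in_flat_map in h2; destruct h2 as (c' & h3 & h4).
    apply in_map_iff in h4; destruct h4 as (e' & h5 & _).
    apply app_inj_tail in h5; destruct h5 as [-> _]; contradiction.
Qed.

Lemma app_in_all_paths n r c c' : In c (AP n) -> In c' (AP r) -> In (c ++ c') (AP (n + r)).
Proof.
  rewrite !all_paths_valid; intros [h1 h2] [h3 h4]; rewrite length_app.
  split; [lia|now apply Forall_app].
Qed.

Lemma segment_in n r x : in_X d a x -> In (map x (seq n r)) (AP r).
Proof.
  intros hx; apply all_paths_valid; rewrite length_map, length_seq; split; [reflexivity|].
  apply Forall_forall; intros e he; apply in_map_iff in he.
  destruct he as (i & <- & _); apply hx.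
Qed.

(** Once some path to the same vertex lies above the prefix, the least such path, continued by the
    tail of [x], is the successor. *)
Lemma next_path x n c0 : in_X d a x -> In c0 (paths_to d a n (kn x n)) ->
  fpath_lt (prefix n x) c0 = true ->
  exists y, in_X d a y /\ (forall i, (n <= i)%nat -> y i = x i) /\
    kn y n = kn x n /\ fpath_lt (prefix n x) (prefix n y) = true /\
    (forall c, In c (paths_to d a n (kn x n)) -> fpath_lt (prefix n x) c = true ->
       fpath_lt c (prefix n y) = false) /\ succ d a x y.
Proof.
  intros hx hc0 hlt0.
  destruct (minimal_element fpath_lt
    (filter (fpath_lt (prefix n x)) (paths_to d a n (kn x n)))) as (m & h1 & h2).
  { apply fpath_lt_irrefl. }
  { apply fpath_lt_trans. }
  { intros h; assert (hin : In c0 []) by (rewrite <- h; now apply filter_In). destruct hin. }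
  apply filter_In in h1; destruct h1 as [h1 h3].
  pose proof (proj1 (paths_to_in _ _ _ _ _) h1) as [h4 h5].
  pose proof (proj1 (all_paths_valid _ _ _ _) h4) as [h6 h7].
  set (y := fun i => if (i <? n)%nat then nth i m (0%nat, 0%nat) else x i).
  assert (hpre : prefix n y = m).
  { apply (nth_ext _ _ (0%nat, 0%nat) (0%nat, 0%nat)); rewrite length_prefix; [now symmetry|].
    intros i hi; rewrite nth_prefix by exact hi; unfold y.
    now rewrite (proj2 (Nat.ltb_lt i n) hi). }
  assert (htail : forall i, (n <= i)%nat -> y i = x i).
  { intros i hi; unfold y; destruct (Nat.ltb_spec i n); [lia|reflexivity]. }
  assert (hy : in_X d a y).
  { intros i; unfold y; destruct (Nat.ltb_spec i n) as [hi|]; [|apply hx].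
    rewrite Forall_forall in h7; apply h7, nth_In; lia. }
  assert (hkn : kn y n = kn x n) by (rewrite kn_endk, hpre; exact h5).
  assert (hmin : forall c, In c (paths_to d a n (kn x n)) -> fpath_lt (prefix n x) c = true ->
       fpath_lt c (prefix n y) = false).
  { intros c hc hlt; rewrite hpre; apply h2, filter_In; auto. }
  exists y; split; [exact hy|]. split; [exact htail|]. split; [exact hkn|].
  split; [now rewrite hpre|]. split; [exact hmin|].
  split; [exact hx|]. split; [exact hy|]. split.
  - apply (path_prec_of_prefix n); [intros; now rewrite htail|now symmetry|now rewrite hpre].
  - intros (z & hz & hxz & hzy).
    (* An intermediate [z] keeps the tail. Otherwise compare the last index where [x] and [z] differ
       with the last one where [z] and [y] differ; from n on, [x] and [y] agree. *)
    assert (hzt : forall i, (n <= i)%nat -> x i = z i).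
    { pose proof hxz as (i1 & e1 & e2 & e3 & e4).
      destruct (Nat.lt_ge_cases i1 n) as [hlt|hge]; [intros i hi; apply e4; lia|exfalso].
      destruct hzy as (i2 & f1 & f2 & f3 & f4).
      destruct (Nat.lt_trichotomy i2 i1) as [hl|[->|hl]].
      - apply e1; rewrite f4 by exact hl; symmetry; now apply htail.
      - rewrite htail in f2 by exact hge.
        apply (edge_prec_irrefl (x i1)); eapply edge_prec_trans; eassumption.
      - apply f1; rewrite <- e4 by exact hl; symmetry; apply htail; lia. }
    destruct (prefix_of_path_prec n x z hzt hxz) as [k1 l1].
    destruct (prefix_of_path_prec n z y) as [k2 l2]; [|exact hzy|].
    { intros i hi; rewrite htail by exact hi; symmetry; now apply hzt. }
    rewrite hmin in l2; [discriminate| |exact l1].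
    apply paths_to_in; split; [now apply prefix_in|]. rewrite <- kn_endk; now symmetry.
Qed.

Variable kappa : R.
Hypothesis means : forall k, Tg d a g N k = kappa * Hnk d a N k.

(** Because the full sum over a tower is zero by [total_deviation], this function remains correct
    when the successor leaves the top of one tower of level [N] for the bottom of another. *)
Definition transfer (c : list label) : R :=
  lsum (AP N) (fun c' => if Nat.eqb (endk c') (endk c) && fpath_lt c' c
                         then g (ext c') - kappa else 0).

Lemma total_deviation k :
  lsum (AP N) (fun c' => if Nat.eqb (endk c') k then g (ext c') - kappa else 0) = 0.
Proof.
  pose proof (means k) as h; unfold Tg in h; rewrite Hnk_psum, !psumE in h.
  transitivity (lsum (AP N) (fun c => if Nat.eqb (endk c) k then g (ext c) else 0) +
    (- kappa) * lsum (AP N) (fun c => if Nat.eqb (endk c) k then 1 else 0)).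
  - rewrite <- lsum_scal, <- lsum_plus; apply lsum_ext; intros c _.
    destruct (Nat.eqb (endk c) k); lra.
  - rewrite h; lra.
Qed.

Lemma cylinder_value c : In c (AP N) ->
  lsum (AP N) (fun c' => if goodb (eq c) c' then g (ext c') - kappa else 0) =
  g (ext c) - kappa.
Proof.
  intros hc; apply (lsum_single _ (goodb (eq c)) c (fun c' => g (ext c') - kappa)).
  - apply NoDup_all_paths.
  - exact hc.
  - intros z _; rewrite goodb_true; split; congruence.
Qed.

Lemma transfer_next A B : In A (AP N) -> endk B = endk A -> fpath_lt A B = true ->
  (forall C, In C (AP N) -> endk C = endk A -> fpath_lt A C = true -> fpath_lt C B = false) ->
  transfer B - transfer A = g (ext A) - kappa.
Proof.
  intros hA hk hlt hmin.
  enough (h : transfer B = transfer A + (g (ext A) - kappa)) by lra.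
  rewrite <- (cylinder_value A hA); unfold transfer; rewrite <- lsum_plus.
  apply lsum_ext; intros C hC; rewrite hk.
  destruct (Nat.eqb_spec (endk C) (endk A)) as [hCA|hCA]; cbn [andb].
  - pose proof (proj1 (all_paths_valid _ _ _ _) hA) as [lA _].
    pose proof (proj1 (all_paths_valid _ _ _ _) hC) as [lC _].
    destruct (goodb (eq A) C) eqn:E.
    + apply goodb_true in E; subst C; rewrite hlt, fpath_lt_irrefl; lra.
    + assert (hne : C <> A) by (intros ->; rewrite (proj2 (goodb_true (eq A) A) eq_refl) in E; discriminate).
      destruct (fpath_lt C A) eqn:E1.
      * rewrite (fpath_lt_trans C A B E1 hlt); lra.
      * destruct (fpath_lt_total C A) as [h|h]; [lia|exact hne|congruence|].
        rewrite (hmin C hC hCA h); lra.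
  - destruct (goodb (eq A) C) eqn:E; [apply goodb_true in E; subst; contradiction|lra].
Qed.

Lemma transfer_min B : (forall C, In C (AP N) -> endk C = endk B -> fpath_lt C B = false) ->
  transfer B = 0.
Proof.
  intros h; unfold transfer; rewrite (lsum_ext _ _ (fun _ => 0)); [apply lsum_zero|].
  intros C hC; destruct (Nat.eqb_spec (endk C) (endk B)) as [e|e]; [|reflexivity].
  now rewrite h.
Qed.

Lemma transfer_max A : In A (AP N) ->
  (forall C, In C (AP N) -> endk C = endk A -> fpath_lt A C = false) ->
  transfer A = - (g (ext A) - kappa).
Proof.
  intros hA hmax.
  enough (h : transfer A + (g (ext A) - kappa) = 0) by lra.
  rewrite <- (cylinder_value A hA).
  etransitivity; [|apply (total_deviation (endk A))].
  unfold transfer; rewrite <- lsum_plus; apply lsum_ext; intros C hC.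
  pose proof (proj1 (all_paths_valid _ _ _ _) hA) as [lA _].
  pose proof (proj1 (all_paths_valid _ _ _ _) hC) as [lC _].
  destruct (Nat.eqb_spec (endk C) (endk A)) as [e|e]; cbn [andb].
  - destruct (goodb (eq A) C) eqn:E.
    + apply goodb_true in E; subst C; rewrite fpath_lt_irrefl; lra.
    + assert (hne : C <> A) by (intros ->; rewrite (proj2 (goodb_true (eq A) A) eq_refl) in E; discriminate).
      destruct (fpath_lt_total C A) as [h|h]; [lia|exact hne|rewrite h; lra|].
      rewrite hmax in h; congruence.
  - destruct (goodb (eq A) C) eqn:E; [apply goodb_true in E; subst; contradiction|lra].
Qed.

(** If [x] and [y] share the edges between levels [N] and n, their prefixes are neighbours in one
    tower of level [N]. Otherwise minimality forces the prefix of [x] to the top of its tower and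
    that of [y] to the bottom of its own. *)
Lemma transfer_eq x y n : (N <= n)%nat -> in_X d a x -> in_X d a y ->
  kn y n = kn x n -> fpath_lt (prefix n x) (prefix n y) = true ->
  (forall c, In c (paths_to d a n (kn x n)) -> fpath_lt (prefix n x) c = true ->
     fpath_lt c (prefix n y) = false) ->
  transfer (prefix N y) - transfer (prefix N x) = g (ext (prefix N x)) - kappa.
Proof.
  intros hn hx hy hk hlt hmin.
  set (r := (n - N)%nat); assert (en : n = (N + r)%nat) by lia.
  pose proof (prefix_in d a N x hx) as hA; pose proof (prefix_in d a N y hy) as hB.
  set (A := prefix N x) in *; set (B := prefix N y) in *.
  set (tx := map x (seq N r)); set (ty := map y (seq N r)).
  assert (ex : prefix n x = A ++ tx) by (rewrite en; apply prefix_add).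
  assert (ey : prefix n y = B ++ ty) by (rewrite en; apply prefix_add).
  assert (htx : In tx (AP r)) by now apply segment_in.
  assert (hty : In ty (AP r)) by now apply segment_in.
  assert (hlen : length tx = length ty) by (unfold tx, ty; now rewrite !length_map).
  rewrite !kn_endk, ex, ey, !endk_app in hk.
  assert (hin : forall C tl, In C (AP N) -> In tl (AP r) ->
    (endk C + endk tl = endk A + endk tx)%nat -> In (C ++ tl) (paths_to d a n (kn x n))).
  { intros C tl h1 h2 h3; apply paths_to_in; rewrite en; split; [now apply app_in_all_paths|].
    rewrite kn_endk, <- en, ex, !endk_app; exact h3. }
  rewrite ex, ey in hlt, hmin.
  destruct (list_eq_dec (fun e e' : label => excluded_middle_informative (e = e')) tx ty)
    as [e|hne].
  - rewrite <- e in *; rewrite fpath_lt_app_same in hlt.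
    apply transfer_next; [exact hA|lia|exact hlt|].
    intros C hC hCk hAC; rewrite <- (fpath_lt_app_same C B tx); apply hmin.
    + apply hin; [exact hC|exact htx|lia].
    + now rewrite fpath_lt_app_same.
  - rewrite fpath_lt_app_diff in hlt by assumption.
    rewrite transfer_min, transfer_max; [lra|exact hA| |].
    + intros C hC hCk; destruct (fpath_lt A C) eqn:E; [|reflexivity].
      rewrite <- (hmin (C ++ tx)).
      * symmetry; now rewrite fpath_lt_app_diff.
      * apply hin; [exact hC|exact htx|lia].
      * now rewrite fpath_lt_app_same.
    + intros C hC hCk; destruct (fpath_lt C B) eqn:E; [|reflexivity].
      rewrite <- (hmin (C ++ ty)).
      * symmetry; now rewrite fpath_lt_app_same.
      * apply hin; [exact hC|exact hty|lia].
      * now rewrite fpath_lt_app_diff.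
Qed.

Lemma cyl_meas_False : cyl_meas (fun _ => False).
Proof.
  apply (cm_ext (fun x => ~ in_cyl [] x)); [apply cm_compl, cm_cyl|].
  intros x; split; [|tauto]. intros h; apply h; intros i hi; simpl in hi; lia.
Qed.

(** Labels are pairs of arbitrary naturals, so fixing one more label is a countable union,
    enumerated by the Cantor pairing; the induction extends a fixed cylinder label by label. *)
Lemma cyl_meas_prefix (P : list label -> Prop) n : cyl_meas (fun x => P (prefix n x)).
Proof.
  enough (h : forall r c Q, cyl_meas (fun x => in_cyl c x /\ Q (map x (seq (length c) r)))).
  { apply (cm_ext _ _ (h n [] P)); intros x; split; [intros [_ h1]; exact h1|].
    intros h1; split; [intros i hi; simpl in hi; lia|exact h1]. }
  intros r; induction r as [|r IH]; intros c Q.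
  - simpl; destruct (classic (Q [])) as [h|h].
    + apply (cm_ext _ _ (cm_cyl c)); tauto.
    + apply (cm_ext _ _ cyl_meas_False); tauto.
  - apply (cm_ext (fun x => exists m, in_cyl (c ++ [Cantor.of_nat m]) x /\
      Q (Cantor.of_nat m :: map x (seq (length (c ++ [Cantor.of_nat m])) r)))).
    + apply cm_union; intros m.
      apply (IH (c ++ [Cantor.of_nat m]) (fun l => Q (Cantor.of_nat m :: l))).
    + intros x.
      assert (hsplit : forall e, in_cyl (c ++ [e]) x <-> in_cyl c x /\ x (length c) = e).
      { intros e; unfold in_cyl; rewrite length_app; simpl; split.
        - intros h; split.
          + intros i hi; rewrite h, app_nth1 by lia; reflexivity.
          + rewrite h, app_nth2, Nat.sub_diag by lia; reflexivity.
        - intros [h1 h2] i hi; destruct (Nat.eq_dec i (length c)) as [->|].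
          + rewrite app_nth2, Nat.sub_diag by lia; exact h2.
          + rewrite app_nth1 by lia; apply h1; lia. }
      split.
      * intros (m & h1 & h2); apply hsplit in h1; destruct h1 as [h1 h3].
        split; [exact h1|]. simpl; rewrite h3.
        rewrite length_app in h2; simpl in h2; rewrite Nat.add_1_r in h2; exact h2.
      * intros [h1 h2]; exists (Cantor.to_nat (x (length c))).
        rewrite Cantor.cancel_of_to; split; [now apply hsplit|].
        rewrite length_app; simpl; rewrite Nat.add_1_r; exact h2.
Qed.

(** A prefix ending with an edge of type 0 and then one of type 1 is not maximal: exchanging the
    types keeps the endpoint, and a last edge of type 0 comes later in the order. The pattern
    follows any prefix with a fixed positive probability. *)
Lemma not_maximal_ae : mu_ae d a q t (fun x => forall M, exists n, (M <= n)%nat /\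
  exists c0, In c0 (paths_to d a n (kn x n)) /\ fpath_lt (prefix n x) c0 = true).
Proof.
  set (Good := fun c : list label => exists c' m m', c = c' ++ [(0, m); (1, m')]%nat).
  assert (hv0 : valid_label d a (0, 0)%nat) by (split; simpl; [lia|apply Ha; lia]).
  assert (hv1 : valid_label d a (1, 0)%nat) by (split; simpl; [lia|apply Ha; lia]).
  apply (mu_ae_impl d a q t (fun x => forall M, exists n, (M <= n)%nat /\ Good (prefix n x))).
  - intros x hx h M; destruct (h M) as (n & hn & c' & m & m' & e).
    exists n; split; [exact hn|]. exists (c' ++ [(1, 0); (0, 0)]%nat).
    pose proof (proj1 (all_paths_valid _ _ _ _) (prefix_in d a n x hx)) as [h1 h2].
    rewrite e in h1, h2; rewrite kn_endk, e; apply Forall_app in h2; destruct h2 as [h2 _].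
    rewrite length_app in h1; simpl in h1.
    split.
    + apply paths_to_in; split; [|rewrite !endk_app; reflexivity].
      apply all_paths_valid; rewrite length_app; simpl; split; [lia|].
      apply Forall_app; split; [exact h2|auto].
    + rewrite fpath_lt_app_diff; [reflexivity|reflexivity|discriminate].
  - set (e2 := [(0, 0); (1, 0)]%nat).
    apply (mu_ae_frequently d a q t Ha Hq0 Hd Ht0 Hteq Good (cyl_weight q t e2)).
    + apply cyl_weight_pos; assumption.
    + intros n0; exists 2%nat; intros c hc.
      assert (hin : In e2 (AP 2)) by (apply all_paths_valid; unfold e2; split; [reflexivity|auto]).
      eapply Rle_trans; [|apply (lsum_ge_in _ _ e2 hin)].
      * simpl; rewrite (proj2 (goodb_true Good _)); [apply Rle_refl|].
        exists c, 0%nat, 0%nat; reflexivity.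
      * intros z _; destruct (goodb Good (c ++ z)); [left; apply cyl_weight_pos; assumption|lra].
Qed.

Theorem cohom_of_constant_means : cohom_const d a q t g.
Proof.
  exists kappa, (fun x => transfer (prefix N x)); split.
  - exists (fun x => transfer (prefix N x)), (lsum (AP N) (fun c => Rabs (g (ext c) - kappa))).
    split; [|split].
    + intros r; apply (cyl_meas_prefix (fun c => transfer c <= r)).
    + intros x; eapply Rle_trans; [apply lsum_abs|]; apply lsum_le; intros c _.
      destruct (_ && _); [apply Rle_refl|rewrite Rabs_R0; apply Rabs_pos].
    + apply (mu_ae_impl d a q t (fun x => forall M, exists n, (M <= n)%nat /\
        exists c0, In c0 (paths_to d a n (kn x n)) /\ fpath_lt (prefix n x) c0 = true));
        [reflexivity|apply not_maximal_ae].
  - apply (mu_ae_impl d a q t (fun x => forall M, exists n, (M <= n)%nat /\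
        exists c0, In c0 (paths_to d a n (kn x n)) /\ fpath_lt (prefix n x) c0 = true));
        [|apply not_maximal_ae].
    intros x hx h; destruct (h N) as (n & hn & c0 & h1 & h2).
    destruct (next_path x n c0 hx h1 h2) as (y & hy & htail & hk & hlt & hmin & hsucc).
    exists y; split; [exact hsucc|].
    pose proof (transfer_eq x y n hn hx hy hk hlt hmin) as e.
    assert (eg : g x = g (ext (prefix N x))).
    { apply Hg; [exact hx|apply (ext_in_X d a Ha N); now apply prefix_in|].
      intros i hi; unfold ext; now rewrite nth_prefix. }
    rewrite eg; lra.
Qed.
End Transfer.

(** * Limiting curves *)

(** Each of the L + 1 terms of the geometric sum 1 + x + ... + x^L is at least x^L. *)
Lemma pow_linear_bound x L : 0 < x < 1 -> INR (S L) * x ^ L * (1 - x) <= 1 - x ^ S L.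
Proof.
  intros hx; induction L as [|L IH]; [simpl; lra|].
  assert (h : 0 < x ^ S L <= 1).
  { split; [apply pow_lt; lra|]. rewrite <- (pow1 (S L)); apply pow_incr; lra. }
  rewrite S_INR; replace (x ^ S (S L)) with (x * x ^ S L) by reflexivity.
  set (z := x ^ S L) in *; replace z with (x * x ^ L) in h |- * at 1 by reflexivity.
  assert (e : INR (S L) * (x * x ^ L) * (1 - x) <= x * (1 - z)).
  { replace (INR (S L) * (x * x ^ L) * (1 - x)) with (x * (INR (S L) * x ^ L * (1 - x))) by ring.
    apply Rmult_le_compat_l; lra. }
  replace (x * x ^ L) with z in * by reflexivity.
  nra.
Qed.

(** Induction on the degree with [sqrt x] in place of [x]: one factor [sqrt x ^ L] absorbs the power
    p, the other the additional factor [INR (S L)]. *)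
Lemma pow_poly_bounded p x : 0 < x < 1 ->
  exists B, 0 < B /\ forall L, x ^ L * INR (S L) ^ p <= B.
Proof.
  revert x; induction p as [|p IH]; intros x hx.
  - exists 1; split; [lra|]. intros L; simpl; rewrite Rmult_1_r, <- (pow1 L).
    apply pow_incr; lra.
  - assert (hs : 0 < sqrt x < 1).
    { split; [apply sqrt_lt_R0; lra|]. rewrite <- sqrt_1; apply sqrt_lt_1; lra. }
    destruct (IH (sqrt x) hs) as (B & hB & h).
    exists (B * / (1 - sqrt x)).
    assert (hi : 0 < / (1 - sqrt x)) by (apply Rinv_0_lt_compat; lra).
    split; [nra|]. intros L.
    assert (e : x ^ L = sqrt x ^ L * sqrt x ^ L)
      by (rewrite <- Rpow_mult_distr, sqrt_sqrt by lra; reflexivity).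
    rewrite e; change (INR (S L) ^ S p) with (INR (S L) * INR (S L) ^ p).
    replace (sqrt x ^ L * sqrt x ^ L * (INR (S L) * INR (S L) ^ p)) with
      ((sqrt x ^ L * INR (S L) ^ p) * (INR (S L) * sqrt x ^ L)) by ring.
    assert (p0 : 0 < sqrt x ^ L) by (apply pow_lt; lra).
    pose proof (pos_INR (S L)) as hL.
    apply Rmult_le_compat; [apply Rmult_le_pos; [lra|now apply pow_le]|
      apply Rmult_le_pos; [exact hL|lra]|apply h|].
    + pose proof (pow_linear_bound (sqrt x) L hs) as hl.
      assert (0 < sqrt x ^ S L) by (apply pow_lt; lra).
      apply (Rmult_le_reg_r (1 - sqrt x)); [lra|]. rewrite Rinv_l by lra; lra.
Qed.

Lemma pow_poly_small p x eps : 0 < x < 1 -> 0 < eps ->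
  exists L0, forall L, (L0 <= L)%nat -> x ^ L * INR (S L) ^ p < eps.
Proof.
  intros hx he.
  assert (hs : 0 < sqrt x < 1).
  { split; [apply sqrt_lt_R0; lra|]. rewrite <- sqrt_1; apply sqrt_lt_1; lra. }
  destruct (pow_poly_bounded p (sqrt x) hs) as (B & hB & h).
  destruct (pow_lt_1_zero (sqrt x)) with (y := eps / B) as [L0 hL0];
    [rewrite Rabs_pos_eq; lra|now apply Rdiv_lt_0_compat|].
  exists L0; intros L hL; specialize (hL0 L hL).
  assert (p0 : 0 < sqrt x ^ L) by (apply pow_lt; lra).
  rewrite Rabs_pos_eq in hL0 by lra.
  assert (e : x ^ L = sqrt x ^ L * sqrt x ^ L)
    by (rewrite <- Rpow_mult_distr, sqrt_sqrt by lra; reflexivity).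
  rewrite e, Rmult_assoc; apply Rle_lt_trans with (sqrt x ^ L * B).
  - apply Rmult_le_compat_l; [lra|apply h].
  - apply (Rmult_lt_compat_r B) in hL0; [|lra].
    replace (eps / B * B) with eps in hL0 by (field; lra); lra.
Qed.

Lemma rt_pos n : 0 < rt n.
Proof. apply sqrt_lt_R0, lt_0_INR; lia. Qed.

Lemma rt_le_sqrt n : rt n <= INR (S (Nat.sqrt n)).
Proof.
  unfold rt; rewrite <- (sqrt_square (INR (S (Nat.sqrt n)))) by apply pos_INR.
  apply sqrt_le_1_alt; rewrite <- mult_INR; apply le_INR.
  pose proof (Nat.sqrt_spec n (Nat.le_0_l n)); lia.
Qed.

Lemma sum_f_R0_lsum F n : sum_f_R0 F n = lsum (seq 0 (S n)) F.
Proof.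
  induction n as [|n IH]; [unfold lsum; simpl; lra|].
  rewrite seq_S, lsum_app, <- IH; unfold lsum; simpl; lra.
Qed.

(** * The random walk carried by the towers *)

Section Main.
Variables (d : nat) (a : nat -> nat) (q t : R).
Hypotheses (Hd : (1 <= d)%nat) (Ha : forall j, (j <= d)%nat -> (1 <= a j)%nat).
Hypotheses (Hq0 : 0 < q) (Ht0 : 0 < t) (Hteq : t_eq d a q t).
Variables (g : path -> R) (N : nat).
Hypothesis Hg : cylindric d a N g.
Notation AP := (all_paths d a).
Notation u := (t / q).

Let u0 : 0 < u.
Proof. now apply Rdiv_lt_0_compat. Qed.

(* [scale n k] is the mu_q-measure of each cylinder of the tower (n, k), so
   [mass n] is the law of k_n and [mean_value] is the mu_q-integral of [g]. *)
Definition scale n k : R := q ^ n * u ^ k.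
Definition step_law j : R := INR (a j) * (q * u ^ j).
Definition mass n k : R := scale n k * Hnk d a n k.
Definition mean_value : R := sum_f_R0 (fun k => scale N k * Tg d a g N k) (N * d).
Definition signed_mass n k : R := scale n k * (Tg d a g n k - mean_value * Hnk d a n k).

Lemma scale_pos n k : 0 < scale n k.
Proof. apply Rmult_lt_0_compat; now apply pow_lt. Qed.

Lemma step_law_pos j : (j <= d)%nat -> 0 < step_law j.
Proof.
  intros hj; apply Rmult_lt_0_compat; [apply lt_0_INR; specialize (Ha j hj); lia|].
  apply Rmult_lt_0_compat; [lra|now apply pow_lt].
Qed.

Lemma step_law_total : sum_f_R0 step_law d = 1.
Proof.
  rewrite sum_f_R0_lsum, <- (edge_weight_total d a q t Hq0 Hd Hteq).
  symmetry; apply (lsum_labels d a (fun j => q * u ^ j)).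
Qed.

(** [scale] is multiplicative along edges, which turns the recursion of heights and tower sums into
    a convolution with [step_law]. *)
Lemma walk_step_scale n k X :
  scale (S n) k * lsum (labels d a) (child k X) =
  walk_step d step_law (fun k => scale n k * X k) k.
Proof.
  transitivity (scale (S n) k * lsum (labels d a)
     (fun e => (fun j => if (j <=? k)%nat then X (k - j)%nat else 0) (fst e))); [reflexivity|].
  rewrite (lsum_labels d a (fun j => if (j <=? k)%nat then X (k - j)%nat else 0)).
  unfold walk_step; rewrite sum_f_R0_lsum, <- lsum_scal; apply lsum_ext; intros j _.
  destruct (Nat.leb_spec j k) as [h|h]; [|lra].
  unfold scale, step_law; replace (u ^ k) with (u ^ (k - j) * u ^ j)
    by (rewrite <- pow_add; f_equal; lia).
  simpl; ring.
Qed.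

Lemma endk_le n c : In c (AP n) -> (endk c <= n * d)%nat.
Proof.
  intros hc; apply all_paths_valid in hc; destruct hc as [hl hv]; subst n.
  induction hv as [|e c he hv IH]; [apply Nat.le_refl|].
  destruct he as [he _].
  change (fst e + endk c <= S (length c) * d)%nat; lia.
Qed.

Lemma psum_beyond n k F : (n * d < k)%nat -> psum d a n k F = 0.
Proof.
  intros hk; rewrite psumE, <- (lsum_zero (AP n)) at 1; apply lsum_ext; intros c hc.
  apply endk_le in hc; destruct (Nat.eqb_spec (endk c) k); [lia|reflexivity].
Qed.

Lemma mass_psum n k : mass n k =
  lsum (AP n) (fun c => if Nat.eqb (endk c) k then cyl_weight q t c else 0).
Proof.
  unfold mass; rewrite Hnk_psum, psumE, <- lsum_scal; apply lsum_ext; intros c hc.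
  destruct (Nat.eqb_spec (endk c) k) as [<-|]; [|lra].
  apply all_paths_valid in hc; destruct hc as [<- _].
  rewrite cyl_weightE; unfold scale; ring.
Qed.

Lemma mass_total n : sum_f_R0 (mass n) (n * d) = 1.
Proof.
  rewrite sum_f_R0_lsum, <- (cyl_weight_total d a q t Hq0 Hd Hteq n).
  rewrite (lsum_ext _ _ _ (fun k _ => mass_psum n k)), lsum_swap.
  apply lsum_ext; intros c hc.
  apply (lsum_single _ (fun k => Nat.eqb (endk c) k) (endk c) (fun _ => cyl_weight q t c)).
  - apply seq_NoDup.
  - apply in_seq; apply endk_le in hc; lia.
  - intros k _; rewrite Nat.eqb_eq; split; auto.
Qed.

Hypothesis Hnc : ~ cohom_const d a q t g.

Lemma walk_data_masses : walk_data d N step_law mass signed_mass.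
Proof.
  split.
  - exact Hd.
  - exact step_law_pos.
  - exact step_law_total.
  - intros k; rewrite mass_psum; simpl; unfold lsum, cyl_weight; simpl.
    destruct k; simpl; lra.
  - intros n k; unfold mass at 1; rewrite Hnk_S; apply walk_step_scale.
  - intros n k hn; unfold signed_mass.
    rewrite (Tg_S d a Ha g N Hg) by exact hn; rewrite Hnk_S.
    rewrite <- (walk_step_scale n k (fun k => Tg d a g n k - mean_value * Hnk d a n k)).
    f_equal.
    transitivity (lsum (labels d a) (child k (Tg d a g n)) +
      (- mean_value) * lsum (labels d a) (child k (Hnk d a n))); [lra|].
    rewrite <- lsum_scal, <- lsum_plus; apply lsum_ext; intros e _; unfold child.
    destruct (fst e <=? k)%nat; lra.
  - intros k hk; unfold signed_mass, Tg; rewrite Hnk_psum, !psum_beyond by exact hk; lra.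
  - transitivity (mean_value - mean_value * sum_f_R0 (mass N) (N * d));
      [|rewrite mass_total; lra].
    unfold mean_value at 1; rewrite scal_sum, <- minus_sum; apply sum_eq; intros k _.
    unfold signed_mass, mass; ring.
  (* If all signed masses at level [N] vanished, every tower of that level would have mean
     [mean_value], and [g] would be cohomologous to a constant. *)
  - apply NNPP; intros h; apply Hnc.
    apply (cohom_of_constant_means d a q t Ha Hq0 Hd Ht0 Hteq g N Hg mean_value).
    intros k; apply NNPP; intros hk; apply h; exists k; unfold signed_mass.
    intros e; apply Rmult_integral in e; destruct e as [e|e]; [|lra].
    pose proof (scale_pos N k); lra.
Qed.

(** Largest weight of a single edge: q u^j is monotone in j, so its maximum over the types is
    attained at 0 or at [d]. *)
Definition decay : R := Rmax q (q * u ^ d).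

Lemma decay_bounds : 0 < decay < 1.
Proof.
  pose proof step_law_total as h1.
  assert (hj : forall j, (j <= d)%nat -> q * u ^ j < 1).
  { intros j hj; apply Rlt_le_trans with (sum_f_R0 step_law d); [|lra].
    assert (hle : q * u ^ j <= step_law j).
    { unfold step_law; assert (1 <= INR (a j)) by (apply (le_INR 1), Ha, hj).
      assert (0 < q * u ^ j) by (apply Rmult_lt_0_compat; [lra|now apply pow_lt]). nra. }
    eapply Rle_lt_trans; [exact hle|].
    rewrite sum_f_R0_lsum.
    assert (hin : forall i, (i <= d)%nat -> In i (seq 0 (S d))) by (intros; apply in_seq; lia).
    (* A type other than [j], whose positive probability makes the inequality strict. *)
    set (i := if Nat.eqb j 0 then 1%nat else 0%nat).
    assert (hi : (i <= d)%nat /\ i <> j) by (unfold i; destruct (Nat.eqb_spec j 0); lia).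
    destruct (in_split _ _ (hin j hj)) as (l1 & l2 & e).
    pose proof (hin i (proj1 hi)) as hii; rewrite e in hii |- *.
    assert (hpos : forall z, In z (l1 ++ j :: l2) -> 0 <= step_law z).
    { intros z hz; rewrite <- e in hz; apply in_seq in hz; left; apply step_law_pos; lia. }
    rewrite lsum_app, lsum_cons.
    assert (p1 : 0 <= lsum l1 step_law)
      by (apply lsum_nonneg; intros; apply hpos, in_or_app; now left).
    assert (p2 : 0 <= lsum l2 step_law)
      by (apply lsum_nonneg; intros; apply hpos, in_or_app; right; now right).
    pose proof (step_law_pos i (proj1 hi)) as p3.
    apply in_app_or in hii; destruct hii as [hii|[hii|hii]]; [| destruct hi; congruence|].
    - pose proof (lsum_ge_in l1 step_law i hii
        (fun z hz => hpos z (in_or_app _ _ _ (or_introl hz)))); lra.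
    - pose proof (lsum_ge_in l2 step_law i hii
        (fun z hz => hpos z (in_or_app _ _ _ (or_intror (in_cons _ _ _ hz))))); lra. }
  pose proof (hj 0%nat (Nat.le_0_l d)) as h2; pose proof (hj d (le_n d)) as h3.
  simpl in h2; unfold decay, Rmax; destruct (Rle_dec _ _); lra.
Qed.

Lemma scale_decay l i : (i <= d * l)%nat -> scale l i <= decay ^ l.
Proof.
  intros hi; unfold scale.
  assert (ql : 0 < q ^ l) by now apply pow_lt.
  assert (ud : 0 < u ^ d) by now apply pow_lt.
  destruct (Rle_lt_dec u 1) as [h|h].
  - apply Rle_trans with (q ^ l).
    + rewrite <- (Rmult_1_r (q ^ l)) at 2; apply Rmult_le_compat_l; [lra|].
      rewrite <- (pow1 i); apply pow_incr; lra.
    + apply pow_incr; split; [lra|apply Rmax_l].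
  - apply Rle_trans with ((q * u ^ d) ^ l).
    + rewrite Rpow_mult_distr, <- pow_mult; apply Rmult_le_compat_l; [lra|].
      apply Rle_pow; [lra|exact hi].
    + apply pow_incr; split; [nra|apply Rmax_r].
Qed.

Lemma Dg_continuity n k : (N <= n)%nat -> continuity (Dg d a g n k).
Proof.
  intros hn; destruct (g_bounded d a Ha g N Hg) as (M & hM0 & hM).
  set (L := M * Hnk d a n k * Hnk d a n k + Rabs (Fg d a g n k (Hnk d a n k))).
  pose proof (Hnk_nonneg d a n k) as hH.
  assert (hL : forall s s', Rabs (Dg d a g n k s - Dg d a g n k s') <= L * Rabs (s - s')).
  { intros s s'; unfold Dg, L.
    set (T := Fg d a g n k (Hnk d a n k)).
    replace (Fg d a g n k (s * Hnk d a n k) - s * T - (Fg d a g n k (s' * Hnk d a n k) - s' * T))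
      with ((Fg d a g n k (s * Hnk d a n k) - Fg d a g n k (s' * Hnk d a n k)) + (s' - s) * T) by ring.
    eapply Rle_trans; [apply Rabs_triang|].
    rewrite Rmult_plus_distr_r; apply Rplus_le_compat.
    - eapply Rle_trans; [apply (Fg_lip d a g N M n k _ _ hn hM)|].
      replace (s * Hnk d a n k - s' * Hnk d a n k) with (Hnk d a n k * (s - s')) by ring.
      rewrite Rabs_mult, (Rabs_pos_eq (Hnk d a n k)) by exact hH; lra.
    - rewrite Rabs_mult, Rabs_minus_sym; lra. }
  assert (hL0 : 0 <= L).
  { unfold L; pose proof (Rabs_pos (Fg d a g n k (Hnk d a n k))); nra. }
  intros x eps he; exists (eps / (L + 1)); split; [apply Rdiv_lt_0_compat; lra|].
  intros y [_ hy]; simpl in *; unfold Rdist in *.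
  eapply Rle_lt_trans; [apply hL|].
  apply (Rmult_lt_compat_l (L + 1)) in hy; [|lra].
  replace ((L + 1) * (eps / (L + 1))) with eps in hy by (field; lra).
  pose proof (Rabs_pos (y - x)); nra.
Qed.

Lemma is_Rg_exists n k : (N <= n)%nat -> exists r, is_Rg d a g n k r.
Proof.
  intros hn.
  destruct (continuity_ab_maj (fun s => Rabs (Dg d a g n k s)) 0 1) as (s & h1 & h2).
  - lra.
  - intros c _; apply (continuity_pt_comp (Dg d a g n k) Rabs);
      [now apply Dg_continuity|apply Rcontinuity_abs].
  - exists (Rabs (Dg d a g n k s)); split; [exact h1|].
    now exists s.
Qed.

(** * Curves at the vertices of the window *)

Section Window.
Variables (m : nat) (good : nat -> nat -> Prop) (c C : R) (n1 : nat).
Hypotheses (c0 : 0 < c) (C0 : 0 < C).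
Hypothesis W : window_estimates d N mass signed_mass m good c C n1.

(** The diagram looks the same from each of its vertices, so a prefix ending at (n0, k0) continues
    to (n, k) with probability [mass (n - n0) (k - k0)]. For a good vertex (n, k) this is one of the
    masses bounded below in its cone, and a run of about sqrt n good vertices adds up to a
    constant. *)
Lemma good_frequently : mu_ae d a q t (fun x =>
  forall M, exists n, (M <= n)%nat /\ good n (kn x n)).
Proof.
  destruct W as [W1 W2].
  set (Good := fun l : list label => good (length l) (endk l)).
  apply (mu_ae_impl d a q t (fun x => forall M, exists n, (M <= n)%nat /\ Good (prefix n x))).
  { intros x _ h M; destruct (h M) as (n & hn & hG); exists n; split; [exact hn|].
    unfold Good in hG; now rewrite length_prefix, <- kn_endk in hG. }
  apply (mu_ae_frequently d a q t Ha Hq0 Hd Ht0 Hteq Good (c / 2)); [lra|].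
  (* The term [n0 * n0] makes n0 an admissible depth below level n; the 4 gives a run of length at
     least 2, so that [c * INR L] is at least half of [c * rt n]. *)
  intros n0; set (n := (n1 + n0 * n0 + n0 + 4)%nat); exists (n - n0)%nat.
  intros c' hc'.
  pose proof (endk_le n0 c' hc') as hk0.
  pose proof (proj1 (all_paths_valid _ _ _ _) hc') as [hlen _].
  assert (hn1 : (n1 <= n)%nat) by (unfold n; lia).
  destruct (W1 n hn1) as [k1 hk1].
  set (L := Nat.sqrt n).
  assert (hL : (L * L <= n)%nat) by (unfold L; pose proof (Nat.sqrt_spec n (Nat.le_0_l n)); lia).
  assert (hgood : forall i, (i < L)%nat -> good n (k1 + i)%nat).
  { intros i hi; apply hk1; nia. }
  assert (hn0 : (n0 * n0 <= n)%nat) by (unfold n; lia).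
  apply Rle_trans with (lsum (seq 0 L) (fun i => mass (n - n0) (k1 + i - endk c'))).
  - apply Rle_trans with (lsum (seq 0 L) (fun _ => c / rt n)).
    + transitivity (c / rt n * lsum (seq 0 L) (fun _ => 1)).
      * rewrite lsum_one, length_seq.
        pose proof (rt_le_sqrt n) as h1; pose proof (rt_pos n) as h2.
        fold L in h1; rewrite S_INR in h1.
        assert (h3 : 2 <= INR L).
        { apply (le_INR 2); unfold L; apply Nat.sqrt_le_square; unfold n; lia. }
        apply (Rmult_le_reg_r (rt n)); [exact h2|].
        replace (c / rt n * INR L * rt n) with (c * INR L) by (field; lra). nra.
      * rewrite <- lsum_scal; apply lsum_le; intros; lra.
    + apply lsum_le; intros i hi; apply in_seq in hi.
      destruct (W2 n (k1 + i)%nat hn1 (hgood i ltac:(lia))) as [h _].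
      apply (h n0 (endk c') hn0); lia.
  - rewrite (lsum_ext _ _ _ (fun i _ => mass_psum (n - n0) (k1 + i - endk c'))), lsum_swap.
    apply lsum_le; intros c2 hc2.
    pose proof (proj1 (all_paths_valid _ _ _ _) hc2) as [hlen2 _].
    assert (hGE : Good (c' ++ c2) <-> good n (endk c' + endk c2)%nat).
    { unfold Good; rewrite length_app, endk_app, hlen, hlen2.
      replace (n0 + (n - n0))%nat with n by (unfold n; lia); reflexivity. }
    assert (hk1k : forall i, (i < L)%nat -> (endk c' <= k1 + i)%nat).
    { intros i hi; destruct (W2 n (k1 + i)%nat hn1 (hgood i hi)) as [h _].
      apply (h n0 (endk c') hn0); lia. }
    pose proof (cyl_weight_pos q t Hq0 Ht0 c2) as hw.
    destruct (classic (exists i, (i < L)%nat /\ endk c2 = (k1 + i - endk c')%nat))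
      as [(i & hi & e)|hno].
    + pose proof (hk1k i hi) as hle.
      rewrite (proj2 (goodb_true Good _)).
      * apply Req_le.
        apply (lsum_single _ (fun i => Nat.eqb (endk c2) (k1 + i - endk c')) i
          (fun _ => cyl_weight q t c2)).
        -- apply seq_NoDup.
        -- apply in_seq; lia.
        -- intros z hz; apply in_seq in hz; pose proof (hk1k z ltac:(lia)).
           rewrite Nat.eqb_eq; split; [lia|now intros ->].
      * apply hGE; replace (endk c' + endk c2)%nat with (k1 + i)%nat by lia.
        now apply hgood.
    + rewrite (lsum_ext _ _ (fun _ => 0)), lsum_zero.
      * destruct (goodb Good (c' ++ c2)); lra.
      * intros i hi; apply in_seq in hi.
        destruct (Nat.eqb_spec (endk c2) (k1 + i - endk c')) as [e|]; [|reflexivity].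
        exfalso; apply hno; exists i; split; [lia|exact e].
Qed.

Section Vertex.
Variables (n k : nat).
Hypotheses (Hn : (n1 <= n)%nat) (Hgood : good n k).

Lemma vertex_mass l i : (l * l <= n)%nat -> (i <= d * l)%nat ->
  (i <= k)%nat /\ (N + l < n)%nat /\ c / rt n <= mass (n - l) (k - i) <= C / rt n.
Proof. destruct W as [_ W2]; destruct (W2 n k Hn Hgood) as [h _]; apply h. Qed.

Lemma scale_split l i : (l <= n)%nat -> (i <= k)%nat ->
  scale n k = scale l i * scale (n - l) (k - i).
Proof.
  intros hl hi; unfold scale.
  replace (q ^ n) with (q ^ l * q ^ (n - l)) by (rewrite <- pow_add; f_equal; lia).
  replace (u ^ k) with (u ^ i * u ^ (k - i)) by (rewrite <- pow_add; f_equal; lia).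
  ring.
Qed.

Lemma mass_vertex : c / rt n <= scale n k * Hnk d a n k <= C / rt n.
Proof.
  destruct (vertex_mass 0 0) as (_ & _ & h); [lia|lia|].
  now rewrite !Nat.sub_0_r in h.
Qed.

(** Heights are masses divided by [scale]. The masses in the cone are comparable up to C/c, and the
    ratio of the scales is [scale l i], at most [decay ^ l]. *)
Lemma vertex_height l i : (l * l <= n)%nat -> (i <= d * l)%nat ->
  (i <= k)%nat /\ (N + l < n)%nat /\
  0 < Hnk d a (n - l) (k - i) <= C / c * decay ^ l * Hnk d a n k.
Proof.
  intros hl hi; destruct (vertex_mass l i hl hi) as (h1 & h2 & h3 & h4).
  split; [exact h1|]. split; [exact h2|].
  unfold mass in h3, h4; pose proof (scale_pos (n - l) (k - i)) as p1.
  assert (hc : 0 < c / rt n) by (apply Rdiv_lt_0_compat; [lra|apply rt_pos]).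
  split.
  - apply (Rmult_lt_reg_l (scale (n - l) (k - i))); lra.
  - destruct mass_vertex as [h5 _].
    rewrite (scale_split l i) in h5 by lia.
    apply (Rmult_le_reg_l (scale (n - l) (k - i))); [exact p1|].
    apply Rle_trans with (C / c * (c / rt n));
      [rewrite <- (Rmult_1_l (C / rt n)) in h4; pose proof (rt_pos n);
       replace (C / c * (c / rt n)) with (1 * (C / rt n)) by (field; lra); exact h4|].
    apply Rle_trans with (C / c * (scale l i * scale (n - l) (k - i) * Hnk d a n k)).
    + apply Rmult_le_compat_l; [left; now apply Rdiv_lt_0_compat|exact h5].
    + replace (scale (n - l) (k - i) * (C / c * decay ^ l * Hnk d a n k)) with
        (C / c * (decay ^ l * scale (n - l) (k - i) * Hnk d a n k)) by ring.
      apply Rmult_le_compat_l; [left; now apply Rdiv_lt_0_compat|].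
      apply Rmult_le_compat_r; [apply Hnk_nonneg|].
      apply Rmult_le_compat_r; [lra|now apply scale_decay].
Qed.

Lemma signed_ratio n' k' : 0 < Hnk d a n' k' ->
  signed_mass n' k' / mass n' k' = slope d a g n' k' - mean_value.
Proof.
  intros h; unfold signed_mass, mass, slope; pose proof (scale_pos n' k').
  field; lra.
Qed.

Lemma vertex_slope l i j : (S l * S l <= n)%nat -> (i <= d * l)%nat -> (j <= d)%nat ->
  Rabs (slope d a g (n - S l) (k - (i + j)) - slope d a g (n - l) (k - i))
  <= C / rt n ^ S m.
Proof.
  intros hl hi hj; destruct W as [_ W2]; destruct (W2 n k Hn Hgood) as (_ & h & _).
  specialize (h l i j hl hi hj).
  rewrite !signed_ratio in h.
  - eapply Rle_trans; [apply Req_le|exact h]; f_equal; lra.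
  - apply vertex_height; [lia|exact hi].
  - apply vertex_height; [exact hl|nia].
Qed.

(** The first block has at least the fraction [c / C * scale 1 d] of the height, and its mean
    differs from that of the whole tower by at least [c / rt n ^ S m]. *)
Lemma vertex_large : exists tt, 0 <= tt <= 1 /\
  c / C * scale 1 d * c / rt n ^ S m * Hnk d a n k <= Rabs (Dg d a g n k tt).
Proof.
  assert (hn : (1 <= n)%nat) by (destruct (vertex_mass 0 0); lia).
  destruct (first_block_dev d a Ha g N Hg n k (C / c) decay
    vertex_height) as (tt & h1 & h2); [exact hn|].
  exists tt; split; [exact h1|]; rewrite h2.
  destruct W as [_ W2]; destruct (W2 n k Hn Hgood) as (_ & _ & h).
  destruct (vertex_height 1 d) as (hk & _ & h3 & _); [lia|lia|].
  destruct (vertex_height 0 0) as (_ & _ & h4 & _); [lia|lia|].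
  rewrite !Nat.sub_0_r in h4.
  rewrite !signed_ratio in h by assumption.
  replace (slope d a g (n - 1) (k - d) - mean_value - (slope d a g n k - mean_value))
    with (slope d a g (n - 1) (k - d) - slope d a g n k) in h by lra.
  destruct (vertex_mass 1 d) as (_ & _ & h5 & _); [lia|lia|].
  unfold mass in h5; destruct mass_vertex as [_ h6].
  rewrite (scale_split 1 d) in h6 by lia.
  pose proof (scale_pos (n - 1) (k - d)) as p1; pose proof (rt_pos n) as p2.
  assert (hlow : c / C * scale 1 d * Hnk d a n k <= Hnk d a (n - 1) (k - d)).
  { apply (Rmult_le_reg_l (scale (n - 1) (k - d))); [exact p1|].
    eapply Rle_trans; [|exact h5].
    replace (c / rt n) with (c / C * (C / rt n)) by (field; lra).
    replace (scale (n - 1) (k - d) * (c / C * scale 1 d * Hnk d a n k)) with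
      (c / C * (scale 1 d * scale (n - 1) (k - d) * Hnk d a n k)) by ring.
    apply Rmult_le_compat_l; [left; now apply Rdiv_lt_0_compat|exact h6]. }
  assert (p3 : 0 < rt n ^ S m) by now apply pow_lt.
  replace (c / C * scale 1 d * c / rt n ^ S m * Hnk d a n k) with
    (c / C * scale 1 d * Hnk d a n k * (c / rt n ^ S m)) by (field; lra).
  apply Rmult_le_compat; [|left; now apply Rdiv_lt_0_compat|exact hlow|exact h].
  apply Rmult_le_pos; [|lra].
  apply Rmult_le_pos; [left; now apply Rdiv_lt_0_compat|left; apply scale_pos].
Qed.

Lemma vertex_modulus M l : 0 <= M ->
  (forall n c, (N <= n)%nat -> In c (AP n) -> Rabs (g (ext c)) <= M) ->
  (l <= Nat.sqrt n)%nat ->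
  forall s s', 0 <= s <= 1 -> 0 <= s' <= 1 ->
  Rabs (Dg d a g n k s - Dg d a g n k s') <=
  Hnk d a n k * (INR l * (C / rt n ^ S m) * Rabs (s - s') +
    2 * (C / c) * (C / rt n ^ S m * decay ^ l / (1 - decay)
      + 2 * M * decay ^ Nat.sqrt n)).
Proof.
  intros hM0 hM hl s s' hs hs'.
  pose proof (Nat.sqrt_spec n (Nat.le_0_l n)) as hsq.
  replace (Nat.sqrt n) with (l + (Nat.sqrt n - l))%nat by lia.
  apply (cone_modulus d a Ha g N Hg M hM0 hM n k (C / c) decay (C / rt n ^ S m)).
  - now apply Rdiv_lt_0_compat.
  - apply decay_bounds.
  - left; apply Rdiv_lt_0_compat; [lra|apply pow_lt, rt_pos].
  - exact vertex_height.
  - exact vertex_slope.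
  - replace (l + (Nat.sqrt n - l))%nat with (Nat.sqrt n) by lia; lia.
  - exact hs.
  - exact hs'.
Qed.
End Vertex.

Lemma limiting_curve x :
  (forall M, exists n, (M <= n)%nat /\ good n (kn x n)) ->
  exists (ns : nat -> nat) (r : nat -> R) (phi : R -> R),
      (forall M, exists J, forall j, (J <= j)%nat -> (M <= ns j)%nat) /\
      (forall j, (N <= ns j)%nat) /\
      (forall j, is_Rg d a g (ns j) (kn x (ns j)) (r j) /\ 0 < r j) /\
      (forall tt, 0 <= tt <= 1 -> forall eps, 0 < eps -> exists delta, 0 < delta /\
         forall s, 0 <= s <= 1 -> Rabs (s - tt) < delta -> Rabs (phi s - phi tt) < eps) /\
      (forall eps, 0 < eps -> exists J, forall j, (J <= j)%nat ->
         forall tt, 0 <= tt <= 1 ->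
           Rabs (Dg d a g (ns j) (kn x (ns j)) tt / r j - phi tt) < eps).
Proof.
  intros hx; destruct (g_bounded d a Ha g N Hg) as (M & hM0 & hM).
  set (low := c / C * scale 1 d * c).
  assert (low0 : 0 < low).
  { unfold low; apply Rmult_lt_0_compat; [|exact c0].
    apply Rmult_lt_0_compat; [now apply Rdiv_lt_0_compat|apply scale_pos]. }
  assert (hex : forall j, exists nr : nat * R, let (n, r) := nr in
    (j + n1 + N <= n)%nat /\ good n (kn x n) /\ is_Rg d a g n (kn x n) r /\
    0 < Hnk d a n (kn x n) /\ low / rt n ^ S m * Hnk d a n (kn x n) <= r).
  { intros j; destruct (hx (j + n1 + N)%nat) as (n & h1 & h2).
    destruct (is_Rg_exists n (kn x n)) as [r hr]; [lia|].
    exists (n, r); split; [exact h1|]. split; [exact h2|]. split; [exact hr|]. split.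
    - destruct (vertex_height n (kn x n) ltac:(lia) h2 0 0) as (_ & _ & h3 & _); [lia|lia|].
      now rewrite !Nat.sub_0_r in h3.
    - destruct (vertex_large n (kn x n) ltac:(lia) h2) as (s & h3 & h4).
      eapply Rle_trans; [exact h4|]; apply hr, h3. }
  pose (nr := fun j => proj1_sig (constructive_indefinite_description _ (hex j))).
  pose (n_ := fun j => fst (nr j)); pose (r_ := fun j => snd (nr j)).
  assert (hnr : forall j, (j + n1 + N <= n_ j)%nat /\ good (n_ j) (kn x (n_ j)) /\
    is_Rg d a g (n_ j) (kn x (n_ j)) (r_ j) /\ 0 < Hnk d a (n_ j) (kn x (n_ j)) /\
    low / rt (n_ j) ^ S m * Hnk d a (n_ j) (kn x (n_ j)) <= r_ j).
  { intros j; pose proof (proj2_sig (constructive_indefinite_description _ (hex j))) as h.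
    unfold n_, r_, nr; destruct (proj1_sig _) as [n r]; exact h. }
  assert (hr0 : forall j, 0 < low / rt (n_ j) ^ S m * Hnk d a (n_ j) (kn x (n_ j))).
  { intros j; destruct (hnr j) as (_ & _ & _ & h & _); apply Rmult_lt_0_compat; [|exact h].
    apply Rdiv_lt_0_compat; [exact low0|apply pow_lt, rt_pos]. }
  assert (hrpos : forall j, 0 < r_ j).
  { intros j; destruct (hnr j) as (_ & _ & _ & _ & h); pose proof (hr0 j); lra. }
  pose (phi := fun j s => Dg d a g (n_ j) (kn x (n_ j)) s / r_ j).
  assert (hdiv : forall X j, Rabs (X / r_ j) = Rabs X / r_ j).
  { intros X j; unfold Rdiv; rewrite Rabs_mult, (Rabs_pos_eq (/ r_ j)); [reflexivity|].
    left; apply Rinv_0_lt_compat, hrpos. }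
  assert (hbound : forall j s, 0 <= s <= 1 -> Rabs (phi j s) <= 1).
  { intros j s hs; unfold phi; rewrite hdiv; destruct (hnr j) as (_ & _ & [h _] & _).
    pose proof (hrpos j); apply (Rmult_le_reg_r (r_ j)); [lra|].
    replace (Rabs (Dg d a g (n_ j) (kn x (n_ j)) s) / r_ j * r_ j)
      with (Rabs (Dg d a g (n_ j) (kn x (n_ j)) s)) by (field; lra).
    rewrite Rmult_1_l; now apply h. }
  pose proof decay_bounds as hdec.
  (* Division by [r_ j] cancels the height and, in the first two terms, the power [rt (n_ j) ^ S m].
     In the last term the power remains and is beaten by the geometric factor. *)
  assert (hmod : forall l j, (l <= Nat.sqrt (n_ j))%nat ->
    forall s s', 0 <= s <= 1 -> 0 <= s' <= 1 ->
    Rabs (phi j s - phi j s') <= INR l * C / low * Rabs (s - s') +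
      2 * C * C / (c * low * (1 - decay)) * decay ^ l +
      4 * C * M / (c * low) * (decay ^ Nat.sqrt (n_ j) * INR (S (Nat.sqrt (n_ j))) ^ S m)).
  { intros l j hl s s' hs hs'; unfold phi.
    replace (Dg d a g (n_ j) (kn x (n_ j)) s / r_ j - Dg d a g (n_ j) (kn x (n_ j)) s' / r_ j)
      with ((Dg d a g (n_ j) (kn x (n_ j)) s - Dg d a g (n_ j) (kn x (n_ j)) s') / r_ j)
      by (field; pose proof (hrpos j); lra).
    rewrite hdiv; destruct (hnr j) as (h1 & h2 & _ & h4 & h5).
    assert (h1' : (n1 <= n_ j)%nat) by lia.
    pose proof (vertex_modulus (n_ j) (kn x (n_ j)) h1' h2 M l hM0 hM hl s s' hs hs') as e.
    apply (Rmult_le_reg_r (r_ j)); [apply hrpos|].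
    replace (Rabs (Dg d a g (n_ j) (kn x (n_ j)) s - Dg d a g (n_ j) (kn x (n_ j)) s') / r_ j * r_ j)
      with (Rabs (Dg d a g (n_ j) (kn x (n_ j)) s - Dg d a g (n_ j) (kn x (n_ j)) s'))
      by (field; pose proof (hrpos j); lra).
    eapply Rle_trans; [exact e|].
    set (X := INR l * C / low * Rabs (s - s') +
      2 * C * C / (c * low * (1 - decay)) * decay ^ l).
    set (Z := 4 * C * M / (c * low)).
    set (sq := Nat.sqrt (n_ j)); set (rr := rt (n_ j)); set (HH := Hnk d a (n_ j) (kn x (n_ j))) in *.
    assert (rr0 : 0 < rr ^ S m) by apply pow_lt, rt_pos.
    assert (Z0 : 0 <= Z).
    { unfold Z; apply Rmult_le_pos; [nra|left; apply Rinv_0_lt_compat; nra]. }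
    assert (dl0 : 0 < decay ^ l) by (apply pow_lt; lra).
    assert (ds0 : 0 < decay ^ sq) by (apply pow_lt; lra).
    assert (X0 : 0 <= X).
    { unfold X; apply Rplus_le_le_0_compat.
      - apply Rmult_le_pos; [|apply Rabs_pos].
        apply Rmult_le_pos; [|left; now apply Rinv_0_lt_compat].
        apply Rmult_le_pos; [apply pos_INR|lra].
      - apply Rmult_le_pos; [|lra]. apply Rmult_le_pos; [nra|].
        left; apply Rinv_0_lt_compat; apply Rmult_lt_0_compat; [nra|lra]. }
    assert (hpow : rr ^ S m <= INR (S sq) ^ S m).
    { apply pow_incr; split; [left; apply rt_pos|apply rt_le_sqrt]. }
    apply Rle_trans with ((X + Z * (decay ^ sq * rr ^ S m)) * (low / rr ^ S m * HH)).
    - apply Req_le; unfold X, Z; field; repeat split; lra.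
    - apply Rmult_le_compat.
      + apply Rplus_le_le_0_compat; [exact X0|]. apply Rmult_le_pos; [exact Z0|nra].
      + left; apply hr0.
      + apply Rplus_le_compat_l, Rmult_le_compat_l; [exact Z0|].
        apply Rmult_le_compat_l; [lra|exact hpow].
      + exact h5. }
  assert (hequi : forall eps, 0 < eps -> exists delta J, 0 < delta /\
    forall j, (J <= j)%nat -> forall s s', 0 <= s <= 1 -> 0 <= s' <= 1 ->
    Rabs (s - s') < delta -> Rabs (phi j s - phi j s') <= eps).
  { intros eps he.
    set (Y := 2 * C * C / (c * low * (1 - decay))); set (Z := 4 * C * M / (c * low)).
    assert (Y0 : 0 < Y).
    { unfold Y; apply Rdiv_lt_0_compat; [nra|]. apply Rmult_lt_0_compat; [nra|lra]. }
    assert (Z0 : 0 <= Z).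
    { unfold Z; apply Rmult_le_pos; [nra|left; apply Rinv_0_lt_compat; nra]. }
    (* [l] is fixed before [delta], since the Lipschitz constant depends on it. *)
    destruct (pow_lt_1_zero decay) with (y := eps / 3 / Y) as [l hl];
      [rewrite Rabs_pos_eq; lra|apply Rdiv_lt_0_compat; lra|].
    specialize (hl l (le_n l)); rewrite Rabs_pos_eq in hl by (apply pow_le; lra).
    destruct (pow_poly_small (S m) decay (eps / 3 / (Z + 1)) hdec) as [L0 hL0];
      [apply Rdiv_lt_0_compat; lra|].
    assert (K0 : 0 <= INR l * C / low).
    { apply Rmult_le_pos; [|left; now apply Rinv_0_lt_compat].
      apply Rmult_le_pos; [apply pos_INR|lra]. }
    exists (eps / 3 / (INR l * C / low + 1)), (L0 * L0 + l * l)%nat.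
    split; [apply Rdiv_lt_0_compat; lra|].
    intros j hj s s' hs hs' hss.
    assert (hn : (L0 * L0 + l * l <= n_ j)%nat) by (destruct (hnr j) as (h & _); lia).
    assert (hlj : (l <= Nat.sqrt (n_ j))%nat) by (apply Nat.sqrt_le_square; nia).
    assert (hLj : (L0 <= Nat.sqrt (n_ j))%nat) by (apply Nat.sqrt_le_square; nia).
    eapply Rle_trans; [apply (hmod l j hlj s s' hs hs')|]; fold Y Z.
    specialize (hL0 _ hLj); set (V := decay ^ Nat.sqrt (n_ j) * _) in *.
    assert (V0 : 0 <= V).
    { apply Rmult_le_pos; apply pow_le; [lra|apply pos_INR]. }
    assert (e1 : INR l * C / low * Rabs (s - s') <= eps / 3).
    { set (K := INR l * C / low) in *.
      apply (Rmult_lt_compat_l (K + 1)) in hss; [|lra].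
      replace ((K + 1) * (eps / 3 / (K + 1))) with (eps / 3) in hss by (field; lra).
      pose proof (Rabs_pos (s - s')); nra. }
    assert (e2 : Y * decay ^ l <= eps / 3).
    { apply (Rmult_lt_compat_l Y) in hl; [|lra].
      replace (Y * (eps / 3 / Y)) with (eps / 3) in hl by (field; lra); lra. }
    assert (e3 : Z * V <= eps / 3).
    { apply (Rmult_lt_compat_l (Z + 1)) in hL0; [|lra].
      replace ((Z + 1) * (eps / 3 / (Z + 1))) with (eps / 3) in hL0 by (field; lra). nra. }
    lra. }
  destruct (uniform_subsequence phi hbound hequi) as (sigma & psi & h1 & h2 & h3).
  exists (fun j => n_ (sigma j)), (fun j => r_ (sigma j)), psi.
  split; [|split; [|split; [|split]]].
  - intros M'; exists M'; intros j hj; destruct (hnr (sigma j)) as (h & _).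
    specialize (h1 j); lia.
  - intros j; destruct (hnr (sigma j)) as (h & _); lia.
  - intros j; split; [apply (hnr (sigma j))|apply hrpos].
  - exact h2.
  - exact h3.
Qed.
End Window.
End Main.

Theorem mainTheorem5 (d : nat) (a : nat -> nat)
  (Hd : (1 <= d)%nat) (Ha : forall j, (j <= d)%nat -> (1 <= a j)%nat)
  (q t : R) (Hq0 : 0 < q) (Hq1 : q < / INR (a 0%nat))
  (Ht : 0 < t < 1) (Hteq : t_eq d a q t)
  (g : path -> R) (N : nat) (Hg : cylindric d a N g)
  (Hnc : ~ cohom_const d a q t g) :
  mu_ae d a q t (fun x =>
    exists (ns : nat -> nat) (r : nat -> R) (phi : R -> R),
      (forall M, exists J, forall j, (J <= j)%nat -> (M <= ns j)%nat) /\
      (forall j, (N <= ns j)%nat) /\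
      (forall j, is_Rg d a g (ns j) (kn x (ns j)) (r j) /\ 0 < r j) /\
      (forall tt, 0 <= tt <= 1 -> forall eps, 0 < eps -> exists delta, 0 < delta /\
         forall s, 0 <= s <= 1 -> Rabs (s - tt) < delta -> Rabs (phi s - phi tt) < eps) /\
      (forall eps, 0 < eps -> exists J, forall j, (J <= j)%nat ->
         forall tt, 0 <= tt <= 1 ->
           Rabs (Dg d a g (ns j) (kn x (ns j)) tt / r j - phi tt) < eps)).
Proof.
  destruct (LocalLimit.walk_window_estimates
    (walk_data_masses d a q t Hd Ha Hq0 (proj1 Ht) Hteq g N Hg Hnc))
    as (m & good & c & C & n1 & hW).
  destruct hW as [c0 C0 W].
  apply (mu_ae_impl d a q t (fun x => forall M, exists n, (M <= n)%nat /\ good n (kn x n))).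
  - intros x _ hx.
    exact (limiting_curve d a q t Hd Ha Hq0 (proj1 Ht) Hteq g N Hg m good c C n1 c0 C0 W x hx).
  - exact (good_frequently d a q t Hd Ha Hq0 (proj1 Ht) Hteq g N m good c C n1 c0 W).
Qed.
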